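(* Let $x_0\in\mathbb{R}^d$ and let $R>0$, and let $\Omega\subset B(x_0,R)$ be a domain. Suppose that $L\vec u=\operatorname{div}_m\dot F$ in $\Omega$, for some operator $L$ of order $2m$ whose coefficients satisfy, for some $\Lambda,\lambda,\delta>0$, $\|\boldsymbol A\|_{L^\infty(\mathbb{R}^d)}\le\Lambda$ and the weak Gårding inequality $$\operatorname{Re}\langle\nabla^m\vec\varphi,\boldsymbol A\nabla^m\vec\varphi\rangle_{\mathbb{R}^d}\ge\lambda\|\nabla^m\vec\varphi\|_{L^2(\mathbb{R}^d)}^2-\delta\|\vec\varphi\|_{L^2(\mathbb{R}^d)}^2$$ for all smooth, compactly supported $\vec\varphi$, some $\vec u\in\dot W^2_m(\Omega)$, and some $\dot F\in L^2(\Omega)$. Suppose in addition that $\vec u$ may be extended by zero to all of $B(x_0,R)$, in the sense that the extension lies in the closure in $\dot W^2_m(B(x_0,R))$ of $\{\vec\varphi\in C^\infty(\mathbb{R}^d):\vec\varphi\equiv0\text{ in }B(x_0,R)\setminus\Omega\}$. If $0<r<R$ and $0\le j\le m$ is an integer, then $$\int_{B(x_0,r)\cap\Omega}|\nabla^j\vec u|^2\le\frac{C}{(R-r)^{2j}}\int_{\Omega\cap B(x_0,R)}|\vec u|^2+CR^{2m-2j}\int_\Omega\bigl(|\dot F|^2+\delta|\vec u|^2\bigr),$$ $$\int_{B(x_0,r)\cap\Omega}|\nabla^m\vec u|^2\le\frac{C}{(R-r)^{2m}}\int_{\Omega\cap B(x_0,R)\setminus B(x_0,r)}|\vec u|^2+C\int_\Omega\bigl(|\dot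 F|^2+\delta|\vec u|^2\bigr),$$ where $C$ depends only on $d$, $m$, $\lambda$ and $\Lambda$.
   Context: Fixed integers: dimension $d$, order parameter $m\ge1$, number of equations $N\ge1$. Arrays $\dot F=(F_{j,\alpha})$ are indexed by $1\le j\le N$ and multiindices $\alpha\in\mathbb{N}^d$ of a fixed length (here $|\alpha|=m$); $(\nabla^k\vec\varphi)_{j,\gamma}=\partial^\gamma\varphi_j$ for $|\gamma|=k$. For arrays of functions, $\langle\dot F,\dot G\rangle_\Omega=\sum_j\sum_\gamma\int_\Omega\overline{F_{j,\gamma}}\,G_{j,\gamma}$. The homogeneous Sobolev space is $\dot W^2_m(U)=\{u:\nabla^mu\in L^2(U)\}$. In the closure condition, $\vec u$ is a function, not a class modulo polynomials (the condition $\vec u\equiv0$ in $B(x_0,R)\setminus\Omega$ is maintained): there are $\vec\varphi_n$ in the indicated set with $\nabla^i\vec\varphi_n\to\nabla^i\vec u$ in $L^2(B(x_0,R))$ for $0\le i\le m$. The coefficients $\boldsymbol A=(A^{jk}_{\alpha\beta})$ ($1\le j,k\le N$, $|\alpha|=|\beta|=m$) are measurable functions on $\mathbb{R}^d$, with $(\boldsymbol A\dot F)_{j,\alpha}=\sum_k\sum_{|\beta|=m}A^{jk}_{\alpha\beta}F_{k,\beta}$. $L$ is the operator associated with $\boldsymbol A$: $L\vec u=\operatorname{div}_m\dot F$ in $\Omega$ means $\langle\nabla^m\vec\varphi,\boldsymbol A\nabla^m\vec u\rangle_\Omega=\langle\nabla^m\vec\varphi,\dot F\rangle_\Omega$ for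 all smooth $\vec\varphi$ compactly supported in $\Omega$.
   Formalization: The smooth functions in the closure condition must vanish on B(x_0,R)\Ω with all derivatives of order <m, not merely pointwise; for m≥2 and slit domains the claim as written fails. Measurable means Borel, and ‖A‖ is the essential supremum of the operator norm. *)

(* Defs.v *)
From HB Require Import structures.
From mathcomp Require Import all_boot all_order all_algebra.
From mathcomp Require Import all_classical all_reals all_analysis.
From mathcomp Require Import ess_sup_inf complex.

Set Implicit Arguments.
Unset Strict Implicit.
Unset Printing Implicit Defensive.

Import Order.TTheory GRing.Theory Num.Theory.
Import numFieldNormedType.Exports.

Local Open Scope classical_set_scope.
Local Open Scope ring_scope.

(* R^d is ['rV[R]_d] with the product (= Borel) sigma-algebra, generated by the
   coordinate functions. *)

Definition rV_coord (R : realType) (n : nat) (i : 'I_n) (v : 'rV[R]_n) : R :=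
  v ord0 i.

Section measurable_rV.
Context (R : realType) (n : nat).

Let coor : 'I_n -> 'rV[R]_n -> R := @rV_coord R n.

Let rV_set0 : g_sigma_preimage coor set0.
Proof. exact: sigma_algebra0. Qed.

Let rV_setC A : g_sigma_preimage coor A -> g_sigma_preimage coor (~` A).
Proof. exact: sigma_algebraC. Qed.

Let rV_bigcup (F : (set 'rV[R]_n)^nat) :
  (forall i, g_sigma_preimage coor (F i)) ->
  g_sigma_preimage coor (\bigcup_i (F i)).
Proof. exact: sigma_algebra_bigcup. Qed.

HB.instance Definition _ := @isMeasurable.Build default_measure_display
  'rV[R]_n (g_sigma_preimage coor) rV_set0 rV_setC rV_bigcup.

End measurable_rV.

Lemma measurable_rV_coord (R : realType) n (i : 'I_n) :
  measurable_fun [set: 'rV[R]_n] (rV_coord i).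
Proof.
move=> _ Y mY; rewrite setTI; apply: sub_sigma_algebra => /=.
rewrite -bigcup_seq/=; exists i => /=; first by rewrite mem_index_enum.
by exists Y => //; rewrite setTI.
Qed.

Lemma measurable_fun_rVP (R : realType) d (T : measurableType d) n
    (f : T -> 'rV[R]_n) :
  measurable_fun [set: T] f <->
  forall i, measurable_fun [set: T] (rV_coord i \o f).
Proof.
apply: (@iff_trans _ (g_sigma_preimage
    (fun i => @rV_coord R n i \o f) `<=` measurable)).
  rewrite g_sigma_preimage_comp; split=> [mf A [/= C preC <-]|prefS].
    exact: mf.
  by move=> _ A mA; apply: prefS; exists A.
split=> [tnthfS i|mf].
- move=> _ A mA.
  apply: tnthfS; apply: sub_sigma_algebra.
  case: n i => [[] []//|n i] in f *.
  rewrite -bigcup_mkord_ord.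
  exists i; first exact: ltn_ord.
  by exists A => //; rewrite inord_val.
- apply: smallest_sub; first exact: sigma_algebra_measurable.
  case: n => [|n] in f mf *; first by rewrite big_ord0.
  rewrite -bigcup_mkord_ord; apply: bigcup_sub => i Ii.
  by move=> A [B mB <-]; exact: mf.
Qed.

Definition rV_cons (R : realType) n (p : R * 'rV[R]_n) : 'rV[R]_n.+1 :=
  \row_i (if unlift ord0 i is Some j then p.2 ord0 j else p.1).

Definition rV_behead (R : realType) n (v : 'rV[R]_n.+1) : 'rV[R]_n :=
  \row_j v ord0 (lift ord0 j).

Lemma measurable_rV_cons (R : realType) n :
  measurable_fun [set: R * 'rV[R]_n] (@rV_cons R n).
Proof.
apply/measurable_fun_rVP => i.
case: (unliftP ord0 i) => [j ->|->].
  rewrite (_ : _ \o _ = rV_coord j \o snd).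
    exact: measurableT_comp (measurable_rV_coord j) measurable_snd.
  by apply/funext => p; rewrite /= /rV_coord mxE liftK.
rewrite (_ : _ \o _ = fst); first exact: measurable_fst.
by apply/funext => p; rewrite /= /rV_coord mxE unlift_none.
Qed.

Lemma measurable_rV_behead (R : realType) n :
  measurable_fun [set: 'rV[R]_n.+1] (@rV_behead R n).
Proof.
apply/measurable_fun_rVP => j.
rewrite (_ : _ \o _ = rV_coord (lift ord0 j)); first exact: measurable_rV_coord.
by apply/funext => v; rewrite /= /rV_coord mxE.
Qed.

Section cons_measure.
Local Open Scope ereal_scope.
Context (R : realType) (n : nat)
  (mu : {sigma_finite_measure set 'rV[R]_n -> \bar R}).

Definition cons_measure : set 'rV[R]_n.+1 -> \bar R :=
  pushforward (@lebesgue_measure R \x mu) (@rV_cons R n).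

Let cons_measurable (A : set 'rV[R]_n.+1) :
  measurable A -> measurable (@rV_cons R n @^-1` A).
Proof. by move=> mA; rewrite -[X in measurable X]setTI; exact: measurable_rV_cons. Qed.

Let cons_measure0 : cons_measure set0 = 0.
Proof. by rewrite /cons_measure /pushforward preimage_set0 measure0. Qed.

Let cons_measure_ge0 A : 0 <= cons_measure A.
Proof. by rewrite /cons_measure /pushforward; exact: measure_ge0. Qed.

Let cons_measure_sigma_additive : semi_sigma_additive cons_measure.
Proof.
move=> F mF tF mUF; rewrite /cons_measure /pushforward preimage_bigcup.
apply: measure_semi_sigma_additive.
- by move=> k; exact: cons_measurable.
- apply/trivIsetP => /= i j _ _ ij; rewrite -preimage_setI.
  by move/trivIsetP : tF => /(_ _ _ _ _ ij) ->//; rewrite preimage_set0.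
- by rewrite -preimage_bigcup; exact: cons_measurable.
Qed.

HB.instance Definition _ := isMeasure.Build _ _ _ cons_measure
  cons_measure0 cons_measure_ge0 cons_measure_sigma_additive.

Let cons_measure_sigma_finite : sigma_finite setT cons_measure.
Proof.
have /sigma_finiteP[F [TF ndF Foo]] := sigma_finiteT (@lebesgue_measure R).
have /sigma_finiteP[G [TG ndG Goo]] := sigma_finiteT mu.
pose unc (v : 'rV[R]_n.+1) := (rV_coord ord0 v, rV_behead v).
have mu_unc : measurable_fun [set: 'rV[R]_n.+1] unc.
  by apply/measurable_fun_pairP; split;
    [exact: measurable_rV_coord|exact: measurable_rV_behead].
have uncK (p : R * 'rV[R]_n) : unc (rV_cons p) = p.
  case: p => a v; rewrite /unc /rV_coord /rV_cons mxE unlift_none; congr pair.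
  by apply/rowP => j; rewrite !mxE liftK.
exists (fun k => unc @^-1` (F k `*` G k)).
  rewrite -preimage_bigcup (_ : \bigcup_k _ = setT) ?preimage_setT//.
  apply/seteqP; split => // -[x y] _.
  have [j _ Fjx] : (\bigcup_k F k) x by rewrite -TF.
  have [k _ Gky] : (\bigcup_k G k) y by rewrite -TG.
  exists (maxn j k) => //; split.
  - by move: x Fjx; exact/subsetPset/ndF/leq_maxl.
  - by move: y Gky; exact/subsetPset/ndG/leq_maxr.
move=> k; have [mFk Fkoo] := Foo k; have [mGk Gkoo] := Goo k; split.
  by rewrite -[X in measurable X]setTI; apply: mu_unc => //; exact: measurableX.
rewrite /cons_measure /pushforward (_ : _ @^-1` _ = F k `*` G k); last first.
  by apply/funext => p; exact: (congr1 (F k `*` G k) (uncK p)).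
by rewrite product_measure1E// lte_mul_pinfty// ge0_fin_numE.
Qed.

HB.instance Definition _ := Measure_isSigmaFinite.Build _ _ _ cons_measure
  cons_measure_sigma_finite.

End cons_measure.

(* Under the identification of R^(n+1) with R x R^n, the Lebesgue measure on
   R^(n+1) is the product of those on R and on R^n. *)
Fixpoint leb (R : realType) (n : nat) :
    {sigma_finite_measure set 'rV[R]_n -> \bar R} :=
  match n with
  | 0 => \d_(0 : 'rV[R]_0)
  | n'.+1 => cons_measure (leb R n')
  end.

Section defs.
Context (R : realType).
Local Notation C := (R[i]).
Local Notation Re := (@complex.Re R).
Local Notation Im := (@complex.Im R).

Definition sqn (z : C) : R := Re z ^+ 2 + Im z ^+ 2.

Section euclidean.
Variable d : nat.
Local Notation E := ('rV[R]_d).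

(* The topology of ['rV[R]_d] comes from the sup norm; balls are Euclidean. *)
Definition eball (x0 : E) (r : R) : set E :=
  [set x | \sum_(i < d) (x ord0 i - x0 ord0 i) ^+ 2 < r ^+ 2].

Definition domain (U : set E) : Prop := [/\ open U, connected U & U !=set0].

Definition cmeasurable (U : set E) (f : E -> C) : Prop :=
  measurable_fun U (Re \o f) /\ measurable_fun U (Im \o f).

Definition cintegrable (U : set E) (f : E -> C) : Prop :=
  (leb R d).-integrable U (EFin \o Re \o f) /\
  (leb R d).-integrable U (EFin \o Im \o f).

Definition cint (U : set E) (f : E -> C) : C :=
  Complex (\int[leb R d]_(x in U) Re (f x)) (\int[leb R d]_(x in U) Im (f x)).

Definition L2fun (U : set E) (f : E -> C) : Prop :=
  cmeasurable U f /\ (\int[leb R d]_(x in U) (sqn (f x))%:E < +oo)%E.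

Definition loc_integrable (U : set E) (f : E -> C) : Prop :=
  cmeasurable U f /\
  forall K : set E, compact K -> K `<=` U -> cintegrable K f.

Definition partial (i : 'I_d) (f : E -> R) : E -> R :=
  fun x => 'D_(delta_mx ord0 i) f x.

Definition smooth (f : E -> R) : Prop :=
  forall s : seq 'I_d,
    continuous (foldr partial f s) /\
    forall i x, derivable (foldr partial f s) x (delta_mx ord0 i).

Definition csmooth (f : E -> C) : Prop := smooth (Re \o f) /\ smooth (Im \o f).

(* Multiindices in N^d of length k; their entries are at most k. *)
Definition mindex (k : nat) : finType :=
  {a : {ffun 'I_d -> 'I_k.+1} | (\sum_(i < d) a i == k)%N}.

Definition partial_mi k (a : mindex k) (f : E -> R) : E -> R :=
  foldr (fun i g => iter (val a i) (partial i) g) f (enum 'I_d).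

Definition cpartial k (a : mindex k) (f : E -> C) : E -> C :=
  fun x => Complex (partial_mi a (Re \o f) x) (partial_mi a (Im \o f) x).

Definition supported_in (U : set E) (f : E -> C) : Prop :=
  exists K : set E, [/\ compact K, K `<=` U & forall x, ~ K x -> f x = 0].

Definition is_wderiv (U : set E) k (a : mindex k) (f g : E -> C) : Prop :=
  [/\ loc_integrable U f, loc_integrable U g &
    forall phi : E -> C, csmooth phi -> supported_in U phi ->
      cint U (fun x => f x * cpartial a phi x) =
      (-1) ^+ k * cint U (fun x => g x * phi x)].

(* The weak derivative, determined up to equality almost everywhere in [U] (and
   0 if there is none). *)
Definition wderiv (U : set E) k (a : mindex k) (f : E -> C) : E -> C :=
  xget (fun=> 0) [set g | is_wderiv U a f g].

End euclidean.

Section arrays.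
Variables (d N : nat).
Local Notation E := ('rV[R]_d).

Definition array (T : Type) (k : nat) : Type := 'I_N -> mindex d k -> T.

Definition grad k (f : 'I_N -> E -> C) : array (E -> C) k :=
  fun j a => cpartial a (f j).

Definition wgrad (U : set E) k (f : 'I_N -> E -> C) : array (E -> C) k :=
  fun j a => wderiv U a (f j).

Arguments grad k f : clear implicits.
Arguments wgrad U k f : clear implicits.

Definition asqn k (G : array C k) : R := \sum_(j < N) \sum_(a : mindex d k) sqn (G j a).

Definition aval k (F : array (E -> C) k) (x : E) : array C k := fun j a => F j a x.

Definition L2sq (U : set E) k (F : array (E -> C) k) : \bar R :=
  (\int[leb R d]_(x in U) (asqn (aval F x))%:E)%E.

Definition vsqn (z : 'I_N -> C) : R := \sum_(j < N) sqn (z j).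

Definition L2sqv (U : set E) (f : 'I_N -> E -> C) : \bar R :=
  (\int[leb R d]_(x in U) (vsqn (f ^~ x))%:E)%E.

Definition pairing (U : set E) k (F G : array (E -> C) k) : C :=
  \sum_(j < N) \sum_(a : mindex d k) cint U (fun x => (F j a x)^*%C * G j a x).

Definition coeffs (T : Type) (m : nat) : Type :=
  'I_N -> 'I_N -> mindex d m -> mindex d m -> T.

Definition cmul m (B : coeffs C m) (G : array C m) : array C m :=
  fun j a => \sum_(k < N) \sum_(b : mindex d m) B j k a b * G k b.

Definition coeff_at m (A : coeffs (E -> C) m) (x : E) : coeffs C m :=
  fun j k a b => A j k a b x.

Definition Amul m (A : coeffs (E -> C) m) (F : array (E -> C) m) : array (E -> C) m :=
  fun j a x => cmul (coeff_at A x) (aval F x) j a.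

(* Norm of a matrix acting on arrays of numbers with their Euclidean norm. *)
Definition opnorm m (B : coeffs C m) : \bar R :=
  ereal_sup [set (Num.sqrt (asqn (cmul B G)))%:E | G in [set G | asqn G <= 1]].

Definition Linfty_norm m (A : coeffs (E -> C) m) : \bar R :=
  ess_sup (leb R d) (fun x => opnorm (coeff_at A x)).

Definition measurable_coeffs m (A : coeffs (E -> C) m) : Prop :=
  forall j k a b, cmeasurable setT (A j k a b).

Definition test_fun (U : set E) (phi : 'I_N -> E -> C) : Prop :=
  forall j, csmooth (phi j) /\ supported_in U (phi j).

Definition weak_garding m (A : coeffs (E -> C) m) (lam delta : R) : Prop :=
  forall phi, test_fun setT phi ->
    ((lam%:E * L2sq setT (grad m phi) - delta%:E * L2sqv setT phi)
      <= (Re (pairing setT (grad m phi) (Amul A (grad m phi))))%:E)%E.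

Definition in_Wdot m (U : set E) (u : 'I_N -> E -> C) : Prop :=
  forall j (a : mindex d m), exists2 g, is_wderiv U a (u j) g & L2fun U g.

Definition array_L2 k (U : set E) (F : array (E -> C) k) : Prop :=
  forall j a, L2fun U (F j a).

Definition solves m (A : coeffs (E -> C) m) (U : set E) (u : 'I_N -> E -> C)
    (F : array (E -> C) m) : Prop :=
  forall phi, test_fun U phi ->
    pairing U (grad m phi) (Amul A (wgrad U m u)) = pairing U (grad m phi) F.

Definition zero_ext (U : set E) (f : E -> C) : E -> C := patch (fun=> 0) U f.

(* All the derivatives of order less than [m] are required to vanish on
   [B `\` U]: this is [phi = 0] on [B `\` U] in the sense of traces in a Sobolev
   space of order [m].  It coincides with [phi x = 0] for all [x] in [B `\` U] when
   [m = 1], and also when [B `\` U] is contained in the closure of its interior.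
   For [m >= 2] and a slit domain such as [U = B `\` [set x | x_2 = 0, x_1 >= c]],
   pointwise vanishing leaves the normal derivative on the slit free, and the
   Caccioppoli inequality fails. *)
Definition vanishes m (B U : set E) (phi : E -> C) : Prop :=
  forall k (a : mindex d k), (k < m)%N ->
    forall x, (B `\` U) x -> cpartial a phi x = 0.

Definition zero_extendable m (B U : set E) (u : 'I_N -> E -> C) : Prop :=
  exists phi : nat -> 'I_N -> E -> C,
    (forall n j, csmooth (phi n j) /\ vanishes m B U (phi n j)) /\
    forall j k (a : mindex d k), (k <= m)%N ->
      exists2 g, is_wderiv B a (zero_ext U (u j)) g &
        (\int[leb R d]_(x in B) (sqn (cpartial a (phi n j) x - g x))%:E)%E
          @[n --> \oo] --> 0%E.

End arrays.
End defs.

Arguments grad {R d N} k f.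
Arguments wgrad {R d N} U k f.

(* Main.v *)
Require Import Defs.
From mathcomp Require Import all_boot all_order all_algebra.
From mathcomp Require Import all_classical all_reals all_analysis.
From mathcomp Require Import measurable_realfun ess_sup_inf complex.
From mathcomp Require Import ring lra zify.

(** The inequalities are proved for smooth fields [f] that vanish to order [m]
    on [B \ Omega], with the defect [|grad^m f - grad^m u|^2] added to the data;
    the approximation of [u] by such fields then removes the defect.

    Cutoffs.  Let [theta] be a radial cutoff between the balls of radii [r] and
    [rho], whose derivatives of order [k] are [O(b^k)] with [b = 1/(rho - r)].
    The function [psi = 1 - (1 - theta^(m+1))^(m+1)] is flat to order [m] both
    where [theta = 0] and where [theta = 1]: its derivatives of order [k >= 1]
    are [O(b^k zeta^(m+1-k))] with [zeta = theta (1 - theta)], and those of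
    [psi^2] gain a further factor [psi].  So the commutators of [grad^m] with
    [psi] and [psi^2] are bounded by the sum over [k < m] of the terms
    [b^(2(m-k)) zeta^(2k+2) |grad^k f|^2], with a factor [psi] to spare for
    [psi^2] ([cutoff_estimates]).  They live in the annulus between the balls,
    whence the domain of integration in the second inequality.

    Energy.  The Garding inequality is applied to [psi f] and the equation is
    tested with [psi^2 f]; the two pairings differ by commutators
    ([array_inequality], [absorbed_estimate]).  The weights [zeta^(2k+2)] are the
    ones for which integration by parts bounds order [k+1] by a small multiple
    of order [k+2] plus order [k] ([weighted_interpolation]), and
    [zeta^(m+1) <= psi] lets the top order be absorbed: this bounds
    [psi grad^m f] in mean square by [b^m zeta f], [delta^(1/2) psi f] and the
    data ([cutoff_energy_estimate]).  Interpolation with the weights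
    [theta^(2k+2)] gives the intermediate orders ([smooth_caccioppoli]).  All constants are chosen before the number of
    equations, the domain and the fields.

    Admissibility of [w = psi^2 f].  This field is not supported in a compact
    subset of [Omega]: only its derivatives of order less than [m] vanish off
    [Omega].  It is truncated where a polynomial [gauge] in these derivatives is
    small.  If a derivative of order [k] is given the degree [m - k], the gauge
    is homogeneous, so where it is comparable to a power of [sigma] the
    derivatives of order [k] are [O(sigma^(m-k))]; the truncation thus costs
    nothing at order [m], uniformly in [sigma] ([cut_bounded]).  Dominated
    convergence shows that [w] may be used as a test field
    ([weak_equation_extends]) and that its derivatives of order [m] vanish
    almost everywhere off [Omega] ([Dseq_off_ae]), which reduces the pairing
    over the whole space in the Garding inequality to [Omega].

    Limit.  Weak derivatives are unique by the lemma of du Bois-Reymond, which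
    identifies the limits of the derivatives of the approximating fields with
    the weak derivatives of [u] on [Omega], and the limit of the fields
    themselves with the zero extension of [u] ([approximation],
    [limit_bounds]). *)

Set Implicit Arguments.
Unset Strict Implicit.
Unset Printing Implicit Defensive.

Import Order.TTheory GRing.Theory Num.Theory.
Import numFieldNormedType.Exports.

Local Open Scope classical_set_scope.
Local Open Scope ring_scope.

(** * Smooth functions and iterated directional derivatives *)

Section calculus.
Context {R : realType} {V : normedModType R} {I : Type} (e : I -> V).
Implicit Types (f g : V -> R) (s : seq I).

Definition pd i f : V -> R := fun x => 'D_(e i) f x.

Definition Dseq s f : V -> R := foldr pd f s.

(** Smoothness is counted by the number of derivatives, so that closure
    properties go by induction on [n]; [smP] recovers the usual form. *)
Fixpoint smoothN n f : Prop :=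
  continuous f /\
  if n is n'.+1 then
    forall i, (forall x, derivable f x (e i)) /\ smoothN n' (pd i f)
  else True.

Definition sm f := forall n, smoothN n f.

Lemma smoothN_le n f : smoothN n.+1 f -> smoothN n f.
Proof.
elim: n f => [|n IH] f [cf H]; split => //.
by move=> i; have [df /IH] := H i.
Qed.

Lemma sm_cont f : sm f -> continuous f.
Proof. by move=> /(_ 0%N) []. Qed.

Lemma sm_derivable f i x : sm f -> derivable f x (e i).
Proof. by move=> /(_ 1%N) [_ /(_ i) []]. Qed.

Lemma sm_pd f i : sm f -> sm (pd i f).
Proof. by move=> sf n; have [_ /(_ i) []] := sf n.+1. Qed.

Lemma sm_Dseq f s : sm f -> sm (Dseq s f).
Proof. by move=> sf; elim: s => //= i s; exact: sm_pd. Qed.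

Lemma Dseq_rcons s i f : Dseq (rcons s i) f = Dseq s (pd i f).
Proof. by rewrite /Dseq foldr_rcons. Qed.

Lemma Dseq_cat s1 s2 f : Dseq (s1 ++ s2) f = Dseq s1 (Dseq s2 f).
Proof. by rewrite /Dseq foldr_cat. Qed.

Lemma smP f : sm f <->
  (forall s, continuous (Dseq s f) /\ forall i x, derivable (Dseq s f) x (e i)).
Proof.
split=> [sf s|H n].
  have ss := sm_Dseq s sf; split; first exact: sm_cont.
  by move=> i x; exact: sm_derivable.
elim: n f H => [|n IH] f H; split=> //; do ?[exact: (H [::]).1].
move=> i; split=> [x|]; first exact: (H [::]).2.
by apply: IH => s; rewrite -Dseq_rcons; exact: H.
Qed.

Lemma smoothN_cst n c : smoothN n (cst c).
Proof.
elim: n c => [|n IH] c; split => //; do ?[exact: cst_continuous].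
move=> i; split=> [x|]; first exact: derivable_cst.
rewrite (_ : pd _ _ = cst 0); first exact: IH.
by apply/funext => x; rewrite /pd derive_cst.
Qed.

Lemma smoothND n f g : smoothN n f -> smoothN n g -> smoothN n (f + g).
Proof.
elim: n f g => [|n IH] f g [cf Hf] [cg Hg]; split => //.
- by move=> x; apply: continuousD; [exact: cf|exact: cg].
- by move=> x; apply: continuousD; [exact: cf|exact: cg].
move=> i; have [df sf] := Hf i; have [dg sg] := Hg i; split.
  by move=> x; exact: derivableD.
rewrite (_ : pd _ _ = pd i f + pd i g); first exact: IH.
by apply/funext => x; rewrite /pd deriveD.
Qed.

Lemma smoothNM n f g : smoothN n f -> smoothN n g -> smoothN n (f * g).
Proof.
elim: n f g => [|n IH] f g.
  move=> [cf Hf] [cg Hg]; split => //.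
  by move=> x; apply: continuousM; [exact: cf|exact: cg].
move=> Sf Sg; have [cf Hf] := Sf; have [cg Hg] := Sg; split => //.
  by move=> x; apply: continuousM; [exact: cf|exact: cg].
move=> i; have [df sf] := Hf i; have [dg sg] := Hg i; split.
  by move=> x; exact: derivableM.
rewrite (_ : pd _ _ = f * pd i g + g * pd i f).
  by apply: smoothND; apply: IH => //; exact: smoothN_le.
by apply/funext => x; rewrite /pd deriveM.
Qed.

Lemma smoothNV n f : (forall x, f x != 0) -> smoothN n f ->
  smoothN n (fun x => (f x)^-1).
Proof.
move=> f0; elim: n => [|n IH] Sf.
  by have [cf _] := Sf; split => // x; apply: continuousV; [exact: f0|exact: cf].
have [cf Hf] := Sf; split.
  by move=> x; apply: continuousV; [exact: f0|exact: cf].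
move=> i; have [df sf] := Hf i; split.
  by move=> x; apply: derivableV.
have Vf := IH (smoothN_le Sf).
rewrite (_ : pd _ _ = cst (-1) * ((fun x => (f x)^-1) * (fun x => (f x)^-1)) * pd i f).
  by do 2 ?apply: smoothNM => //; [exact: smoothN_cst|exact: smoothNM].
apply/funext => x; rewrite /pd deriveV// fctE /=.
by rewrite scaleNr /GRing.scale/= !fctE /cst/= expr2 invfM mulN1r mulNr.
Qed.

Lemma sm_cst c : sm (cst c). Proof. by move=> n; exact: smoothN_cst. Qed.
Lemma smD f g : sm f -> sm g -> sm (f + g).
Proof. by move=> sf sg n; exact: smoothND. Qed.
Lemma smM f g : sm f -> sm g -> sm (f * g).
Proof. by move=> sf sg n; exact: smoothNM. Qed.
Lemma smN f : sm f -> sm (- f).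
Proof.
move=> sf; rewrite (_ : - f = cst (-1) * f); first by apply: smM => //; exact: sm_cst.
by apply/funext => x; rewrite !fctE /cst/= mulN1r.
Qed.
Lemma smB f g : sm f -> sm g -> sm (f - g).
Proof. by move=> sf sg; apply: smD => //; exact: smN. Qed.
Lemma smX f k : sm f -> sm (f ^+ k).
Proof.
move=> sf; elim: k => [|k IH]; first by rewrite expr0; exact: (sm_cst 1).
by rewrite exprS; exact: smM.
Qed.
Lemma sm_sum J (r : seq J) (P : pred J) (F : J -> V -> R) :
  (forall j, P j -> sm (F j)) -> sm (\sum_(j <- r | P j) F j).
Proof.
move=> sF; elim/big_rec : _ => [|j f Pj sf]; first exact: (sm_cst 0).
by apply: smD => //; exact: sF.
Qed.
Lemma smV f : (forall x, f x != 0) -> sm f -> sm (fun x => (f x)^-1).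
Proof. by move=> f0 sf n; exact: smoothNV. Qed.

Lemma pdD i f g : sm f -> sm g -> pd i (f + g) = pd i f + pd i g.
Proof.
by move=> sf sg; apply/funext => x; rewrite /pd deriveD//; exact: sm_derivable.
Qed.
Lemma pdM i f g : sm f -> sm g -> pd i (f * g) = f * pd i g + g * pd i f.
Proof.
by move=> sf sg; apply/funext => x; rewrite /pd deriveM//; exact: sm_derivable.
Qed.
Lemma pd_cst i c : pd i (cst c) = cst 0.
Proof. by apply/funext => x; rewrite /pd derive_cst. Qed.

Lemma DseqD s f g : sm f -> sm g -> Dseq s (f + g) = Dseq s f + Dseq s g.
Proof.
by move=> sf sg; elim: s => //= i s ->; rewrite pdD//; exact: sm_Dseq.
Qed.

Lemma Dseq_sum s J (r : seq J) (P : pred J) (F : J -> V -> R) :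
  (forall j, P j -> sm (F j)) ->
  Dseq s (\sum_(j <- r | P j) F j) = \sum_(j <- r | P j) Dseq s (F j).
Proof.
move=> sF; suff [] : sm (\sum_(j <- r | P j) F j) /\
   Dseq s (\sum_(j <- r | P j) F j) = \sum_(j <- r | P j) Dseq s (F j) by [].
elim/big_rec2 : _ => [|j f g Pj [sg <-]].
  split; first exact: (sm_cst 0).
  by elim: s => //= i s ->; exact: pd_cst.
by split; [apply: smD => //; exact: sF|rewrite DseqD//; exact: sF].
Qed.

Lemma Dseq_cst s c : (0 < size s)%N -> Dseq s (cst c) = cst 0.
Proof.
elim/last_ind : s => // s i _ _; rewrite Dseq_rcons pd_cst.
by elim: s => //= j s ->; exact: pd_cst.
Qed.

(** The ways of distributing the derivatives of [s] over two factors, with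
    multiplicity. *)
Fixpoint splits s : seq (seq I * seq I) :=
  if s is i :: s' then
    [seq (i :: p.1, p.2) | p <- splits s'] ++ [seq (p.1, i :: p.2) | p <- splits s']
  else [:: ([::], [::])].

(** The Leibniz rule over lists of directions: no binomial coefficients occur,
    since each of the two factors keeps the order of its own derivatives. *)
Lemma DseqM s f g x : sm f -> sm g ->
  Dseq s (f * g) x = \sum_(p <- splits s) Dseq p.1 f x * Dseq p.2 g x.
Proof.
move=> sf sg.
suff -> : Dseq s (f * g) = \sum_(p <- splits s) (Dseq p.1 f * Dseq p.2 g).
  by elim/big_rec2 : _ => // p y1 y2 _ <-.
elim: s => [|i s IH] /=; first by rewrite big_seq1.
rewrite IH big_cat !big_map /= -big_split /=.
have sp (p : seq I * seq I) : sm (Dseq p.1 f * Dseq p.2 g).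
  by apply: smM; exact: sm_Dseq.
elim: (splits s) => [|p r IHr].
  by rewrite !big_nil; exact: (pd_cst i 0).
rewrite !big_cons pdD//; last by apply: sm_sum.
rewrite IHr pdM; [|exact: sm_Dseq|exact: sm_Dseq].
by rewrite [X in X + _ = _]addrC [X in X + _ + _ = _]mulrC.
Qed.

Lemma size_splits s : size (splits s) = (2 ^ size s)%N.
Proof.
by elim: s => //= i s IH; rewrite size_cat !size_map IH expnS mul2n addnn.
Qed.

(** Derivatives are local: this computes them where a cutoff is constant. *)
Lemma near_Dseq s f g x : (\near x, f x = g x) ->
  Dseq s f x = Dseq s g x.
Proof.
move=> fg; suff : \forall y \near x, Dseq s f y = Dseq s g y.
  by move/nbhs_singleton.
elim: s => [|i s IH] //=.
have := nbhs_interior IH; apply: filterS => y Hy.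
exact: near_eq_derive.
Qed.

Lemma Dseq_out s f (A : set V) x : closed A -> (forall y, ~ A y -> f y = 0) ->
  ~ A x -> Dseq s f x = 0.
Proof.
move=> cA fA Ax.
have -> : Dseq s f x = Dseq s (cst 0) x.
  apply: near_Dseq.
  have : nbhs x (~` A) by apply: open_nbhs_nbhs; split => //; exact: closed_openC.
  by apply: filterS => y /fA.
case: s => [|i s]; first by [].
by rewrite Dseq_cst.
Qed.

End calculus.

Arguments sm {R V I} e f.
Arguments Dseq {R V I} e s f.
Arguments pd {R V I} e i f.

Section line.
Context {R : realType} {V : normedModType R}.
Implicit Types (f : V -> R) (x v : V).

Lemma derivable_line f x v t :
  derivable f (t *: v + x) v <-> derivable (fun h : R => f (h *: v + x)) t 1.
Proof.
rewrite derivable1P (derivable1P (fun h : R => f (h *: v + x))).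
by under eq_fun do rewrite addrA -scalerDl; under [in X in _ <-> X]eq_fun do rewrite scaler1.
Qed.

Lemma derive_line f x v t :
  'D_1 (fun h : R => f (h *: v + x)) t = 'D_v f (t *: v + x).
Proof.
rewrite /derive; set F := fun h => _; set G := fun h => _.
suff -> : F = G by [].
apply/funext => h; rewrite /F /G /=.
by rewrite addrA -scalerDl [h *: 1]mulr1.
Qed.

End line.

Section composition.
Context {R : realType} {V : normedModType R} {I : Type} (e : I -> V).

(** Functions of one real variable are differentiated along this single direction. *)
Definition dir1 : unit -> R := fun=> 1.

(** The chain rule reduces to one variable on the line through [x] along [v]. *)
Lemma derivable_comp1 (chi : R -> R) (f : V -> R) x v :
  derivable f x v -> derivable chi (f x) 1 ->
  derivable (chi \o f) x v /\ 'D_v (chi \o f) x = 'D_1 chi (f x) * 'D_v f x.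
Proof.
move=> df dchi.
pose g := fun h : R => f (h *: v + x).
have g0 : g 0 = f x by rewrite /g scale0r add0r.
have dg : derivable g 0 1 by exact: (derivable1P f x v).1.
have dchi' : derivable chi (g 0) 1 by rewrite g0.
split.
  apply: (derivable1P (chi \o f) x v).2; change (derivable (chi \o g) 0 1).
  apply/derivable1_diffP.
  have /derivable1_diffP D1 := dg.
  have /derivable1_diffP D2 := dchi'.
  exact: (differentiable_comp D1 D2).
have Hg : 'D_1 g 0 = 'D_v f x.
  by have := derive_line f x v 0; rewrite scale0r add0r.
have Hcg : 'D_1 (chi \o g) 0 = 'D_v (chi \o f) x.
  by have := derive_line (chi \o f) x v 0; rewrite scale0r add0r.
by have := derive1_comp dg dchi'; rewrite !derive1E g0 Hg Hcg.
Qed.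

Lemma smoothN_comp n (chi : R -> R) (f : V -> R) : sm dir1 chi ->
  smoothN e n f -> smoothN e n (chi \o f).
Proof.
elim: n chi => [|n IH] chi sc Sf.
  have [cf _] := Sf; split => // x; apply: continuous_comp; first exact: cf.
  exact: (sm_cont sc).
have [cf Hf] := Sf; split.
  move=> x; apply: continuous_comp; first exact: cf.
  exact: (sm_cont sc).
move=> i; have [df sf] := Hf i.
have K x := derivable_comp1 (df x) (@sm_derivable _ _ _ _ _ tt (f x) sc).
split=> [x|]; first exact: (K x).1.
rewrite (_ : pd _ _ _ = (pd dir1 tt chi \o f) * pd e i f).
  apply: smoothNM => //; apply: IH; first exact: sm_pd.
  exact: smoothN_le.
by apply/funext => x; rewrite /pd (K x).2.
Qed.

Lemma sm_comp (chi : R -> R) (f : V -> R) : sm dir1 chi -> sm e f -> sm e (chi \o f).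
Proof. by move=> sc sf n; exact: smoothN_comp. Qed.

Lemma pd_comp i (chi : R -> R) (f : V -> R) : sm dir1 chi -> sm e f ->
  pd e i (chi \o f) = (pd dir1 tt chi \o f) * pd e i f.
Proof.
move=> sc sf; apply/funext => x.
by exact: (derivable_comp1 (@sm_derivable _ _ _ _ _ i x sf) (@sm_derivable _ _ _ _ _ tt (f x) sc)).2.
Qed.

End composition.

Section coordinates.
Context {R : realType} {d : nat}.
Definition dirs (i : 'I_d) : 'rV[R]_d := delta_mx ord0 i.

Lemma pd_coord i j : pd dirs i (fun x => x ord0 j) = cst ((i == j)%:R).
Proof.
apply/funext => x; rewrite /pd.
have /= := derive_line (fun x : 'rV[R]_d => x ord0 j) x (dirs i) 0.
rewrite scale0r add0r => <-.
rewrite (_ : (fun h => _) = (fun h : R => h * (i == j)%:R + x ord0 j)); last first.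
  by apply/funext => h; rewrite !mxE/= eq_sym.
by rewrite deriveD// deriveMr//= derive_id derive_cst addr0 /GRing.scale/= mulr1.
Qed.

Lemma sm_coord j : sm dirs (fun x => x ord0 j).
Proof.
case=> [|n]; split; do ?[by move=> x; exact: coord_continuous] => //.
move=> i; split; first by move=> x; exact/diff_derivable/differentiable_coord.
by rewrite pd_coord; exact: smoothN_cst.
Qed.

End coordinates.

(** * Symmetry of second derivatives *)

Section schwarz.
Context {R : realType} {V : normedModType R} {I : Type} (e : I -> V).
Implicit Types (f g : V -> R) (x : V).
Local Notation sm := (sm e).
Local Notation pd := (pd e).

Lemma derivable_shiftP f (x v a : V) :
  derivable (fun y => f (y + a)) x v <-> derivable f (x + a) v.
Proof.
rewrite /derivable; set F := fun h => _; set G := fun h => _.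
suff -> : F = G by [].
by apply/funext => h; rewrite /F /G /= addrA.
Qed.

Lemma derive_shiftE f (x v a : V) :
  'D_v (fun y => f (y + a)) x = 'D_v f (x + a).
Proof.
rewrite /derive; set F := fun h => _; set G := fun h => _.
suff -> : F = G by [].
by apply/funext => h; rewrite /F /G /= addrA.
Qed.

Lemma pd_shift f a i : pd i (fun y => f (y + a)) = (fun y => pd i f (y + a)).
Proof. by apply/funext => x; rewrite /pd derive_shiftE. Qed.

Lemma sm_shift f a : sm f -> sm (fun y => f (y + a)).
Proof.
move=> sf n; elim: n f sf => [|n IH] f sf.
  split=> // x; apply: continuous_comp; last exact: (sm_cont sf).
  by apply: continuousD; [exact: cvg_id|exact: cst_continuous].
split.
  move=> x; apply: continuous_comp; last exact: (sm_cont sf).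
  by apply: continuousD; [exact: cvg_id|exact: cst_continuous].
move=> i; split; last by rewrite -/smoothN pd_shift; apply: IH; exact: sm_pd.
by move=> x; apply/derivable_shiftP; exact: sm_derivable.
Qed.

Lemma sm_MVT f i x (t : R) : sm f -> 0 < t ->
  exists2 c, 0 < c < t & f (t *: e i + x) - f x = pd i f (c *: e i + x) * t.
Proof.
move=> sf t0.
have dl h : is_derive h (1:R) (fun h : R => f (h *: e i + x)) (pd i f (h *: e i + x)).
  have D : derivable (fun h : R => f (h *: e i + x)) h 1.
    by apply/derivable_line; exact: sm_derivable.
  by have := derivableP D; rewrite derive_line.
have [|c] := MVT t0 (fun h _ => dl h).
  apply: continuous_subspaceT => h.
  exact/differentiable_continuous/derivable1_diffP/(ex_derive (is_derive := dl h)).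
rewrite in_itv/= => c0t; rewrite scale0r add0r subr0 => E.
by exists c.
Qed.

(** The mean value theorem, used once in each direction; the second difference
    is symmetric in [i] and [j], whereas the right hand side orders them. *)
Lemma sm_second_difference f i j x (t : R) : sm f -> 0 < t ->
  exists p : R * R, [/\ 0 < p.1 < t, 0 < p.2 < t &
    f (t *: e i + (t *: e j + x)) - f (t *: e i + x) - f (t *: e j + x) + f x =
    t ^+ 2 * pd j (pd i f) (p.2 *: e j + (p.1 *: e i + x))].
Proof.
move=> sf t0.
pose g := (fun y => f (y + t *: e j)) - f.
have sg : sm g by apply: smB => //; exact: sm_shift.
have [c c0t E] := sm_MVT i x sg t0.
have [c' c0t' E'] := sm_MVT j (c *: e i + x) (sm_pd i sf) t0.
exists (c, c'); split=> //=.
have -> : f (t *: e i + (t *: e j + x)) - f (t *: e i + x) - f (t *: e j + x) + f x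
   = g (t *: e i + x) - g x.
  by rewrite /g !fctE [t *: e j + x]addrC !addrA; ring.
rewrite E /g; have -> : pd i ((fun y => f (y + t *: e j)) - f) =
   pd i (fun y => f (y + t *: e j)) - pd i f.
  by apply/funext => y; rewrite /pd deriveB//;
   [exact/(sm_derivable (f := fun y => f (y + t *: e j)))/sm_shift|exact: sm_derivable].
by rewrite pd_shift !fctE [_ + t *: e j]addrC E'; ring.
Qed.

(** Both mixed derivatives at [x] are limits of the same second difference
    divided by [t ^+ 2]. *)
Lemma pdC f i j : sm f -> pd i (pd j f) = pd j (pd i f).
Proof.
move=> sf; apply/funext => x; apply/eqP; rewrite -subr_eq0 -normr_le0.
apply/ler_addgt0Pr => eps eps0; rewrite add0r.
have near_bound k l : \forall d \near 0^'+, forall p : R * R,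
    0 < p.1 < d -> 0 < p.2 < d ->
    `|pd l (pd k f) (p.2 *: e l + (p.1 *: e k + x)) - pd l (pd k f) x| < eps / 2.
  have cc : continuous (pd l (pd k f)) by apply: sm_cont; do 2 apply: sm_pd.
  have /cvgrPdist_lt/(_ (eps / 2)) := cc x.
  rewrite divr_gt0// => /(_ isT) /nbhs_ballP[r /= r0 rb].
  have K0 : 0 < `|e l| + `|e k| + 1 by rewrite ltr_wpDl.
  near=> d => p /andP[p10 p1d] /andP[p20 p2d].
  rewrite distrC; apply: rb; rewrite -ball_normE /= distrC addrA addrK.
  apply: (@le_lt_trans _ _ (d * (`|e l| + `|e k| + 1))).
    apply: (le_trans (ler_normD _ _)); rewrite !normrZ !gtr0_norm//.
    rewrite !mulrDr; apply: ler_wpDr; first by rewrite mulr1.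
    by apply: lerD; apply: ler_wpM2r => //; exact: ltW.
  by rewrite -ltr_pdivlMr//; near: d; apply: nbhs_right_lt; rewrite divr_gt0.
have [d [[H1 H2] d0]] := filter_ex (filterI (filterI (near_bound i j) (near_bound j i))
  (nbhs_right_gt 0)).
have [p [p1 p2 Ep]] := sm_second_difference i j x sf d0.
have [q [q1 q2 Eq]] := sm_second_difference j i x sf d0.
have {}H1 := H1 p p1 p2; have {}H2 := H2 q q1 q2.
have : d ^+ 2 * pd j (pd i f) (p.2 *: e j + (p.1 *: e i + x)) =
       d ^+ 2 * pd i (pd j f) (q.2 *: e i + (q.1 *: e j + x)).
  rewrite -Ep -Eq.
  have -> : d *: e i + (d *: e j + x) = d *: e j + (d *: e i + x).
    by rewrite addrCA.
  ring.
have d2 : d ^+ 2 != 0 by rewrite expf_neq0// gt_eqF.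
move=> /(mulfI d2) E; rewrite E in H1.
move: H1 H2; set a := pd i (pd j f) x; set b := pd j (pd i f) x.
set P := pd i (pd j f) _ => H1 H2.
move: a b P {E Ep Eq} H1 H2 => a b P H1 H2.
apply: (le_trans (ler_distD P a b)); rewrite [leRHS]splitr.
by apply: lerD; rewrite ltW// distrC.
Unshelve. all: by end_near. Qed.

End schwarz.

(** * Multiindices *)

Section multiindices.
Context {R : realType}.

Lemma DseqC {V : normedModType R} {I : Type} (e : I -> V) (f : V -> R) s1 s2 :
  sm e f -> Dseq e s1 (Dseq e s2 f) = Dseq e s2 (Dseq e s1 f).
Proof.
move=> sf; elim: s1 => //= i s1 ->.
elim: s2 => //= j s2 <-; apply: pdC.
by do 2 apply: sm_Dseq.
Qed.

Lemma Dseq_perm {V : normedModType R} {I : eqType} (e : I -> V) (f : V -> R) s s' :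
  sm e f -> perm_eq s s' -> Dseq e s f = Dseq e s' f.
Proof.
move=> sf ss'.
apply: (catCA_perm_ind _ ss' (P := fun s' => Dseq e s f = Dseq e s' f)) => //.
move=> s1 s2 s3 ->; rewrite !Dseq_cat DseqC//.
exact: sm_Dseq.
Qed.

Context {d : nat}.
Local Notation E := 'rV[R]_d.

Lemma smoothP (f : E -> R) : smooth f <-> sm dirs f.
Proof. by rewrite smP. Qed.

(** The list of directions that [partial_mi a] differentiates along. *)
Definition seq_mi k (a : mindex d k) : seq 'I_d :=
  flatten [seq nseq (val a i) i | i <- enum 'I_d].

Lemma size_seq_mi k (a : mindex d k) : size (seq_mi a) = k.
Proof.
rewrite /seq_mi size_flatten /shape -map_comp.
rewrite (eq_map (g := fun i => nat_of_ord (val a i))); last first.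
  by move=> i /=; rewrite size_nseq.
rewrite sumnE big_map big_enum /=; exact/eqP/(valP a).
Qed.

Lemma partial_miE k (a : mindex d k) (f : E -> R) :
  partial_mi a f = Dseq dirs (seq_mi a) f.
Proof.
rewrite /partial_mi /seq_mi; elim: (enum 'I_d) => //= i r ->.
rewrite Dseq_cat; elim: (nat_of_ord _) => //= n ->; reflexivity.
Qed.

Lemma count_seq_mi k (a : mindex d k) i : count_mem i (seq_mi a) = val a i.
Proof.
rewrite /seq_mi count_flatten -map_comp sumnE big_map big_enum /=.
rewrite (bigD1 i)//= big1 ?addn0; last first.
  by move=> j ji; rewrite count_nseq (negbTE ji : pred1 i j = false).
by rewrite count_nseq /= eqxx mul1n.
Qed.

Lemma sum_count_mem (s : seq 'I_d) : (\sum_(i < d) count_mem i s = size s)%N.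
Proof.
elim: s => [|j s IH] /=; first by rewrite big1.
rewrite big_split/= IH (bigD1 j)//= eqxx big1 ?addn0// => i ij.
by rewrite eq_sym (negbTE ij).
Qed.

Lemma mi_of_seq k (s : seq 'I_d) : size s = k ->
  exists a : mindex d k, perm_eq s (seq_mi a).
Proof.
move=> sk.
pose a : {ffun 'I_d -> 'I_k.+1} := [ffun i => inord (count_mem i s)].
have aE i : a i = count_mem i s :> nat.
  by rewrite ffunE inordK// ltnS -sk count_size.
have ha : (\sum_(i < d) a i == k)%N.
  by under eq_bigr do rewrite aE; rewrite sum_count_mem sk.
exists (exist _ a ha); apply/allP => i _ /=.
by rewrite count_seq_mi /= aE.
Qed.

(** Up to the order of differentiation, every list of directions is a multiindex;
    the multiindex serves all functions at once. *)
Lemma Dseq_mi k (s : seq 'I_d) : size s = k ->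
  exists a : mindex d k, forall f : E -> R, sm dirs f ->
    Dseq dirs s f = partial_mi a f.
Proof.
move=> /mi_of_seq[a sa]; exists a => f sf.
by rewrite partial_miE; exact: Dseq_perm.
Qed.

End multiindices.

(** * A smooth step function *)

Section step.
Context {R : realType}.

(** The family [p(1/x) exp(-1/x)] is closed under differentiation, which gives the
    smoothness of [exp(-1/x)] by induction. *)
Definition flat (p : {poly R}) (x : R) : R :=
  if 0 < x then p.[x^-1] * expR (- x^-1) else 0.

Lemma expr_le_expR (y : R) k : 0 < y -> y ^+ k * expR (- y) <= (k`!)%:R.
Proof.
move=> y0; rewrite expRN ler_pdivrMr ?expR_gt0//.
rewrite mulrC -ler_pdivrMr ?ltr0n ?fact_gt0//.
case: k => [|k].
  by rewrite expr0 fact0 divr1 -expR0 ler_expR ltW.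
by apply: le_trans (expR_ge1Dxn k (ltW y0)); rewrite lerDr.
Qed.

Lemma poly_expR_bounded (p : {poly R}) :
  exists2 B, 0 <= B & forall y, 0 < y -> `|p.[y]| * expR (- y) <= B.
Proof.
exists (\sum_(i < size p) `|p`_i| * (i`!)%:R).
  by apply: sumr_ge0 => i _; rewrite mulr_ge0.
move=> y y0; rewrite horner_coef.
apply: (@le_trans _ _ ((\sum_(i < size p) `|p`_i * y ^+ i|) * expR (- y))).
  by rewrite ler_wpM2r ?expR_ge0// ler_norm_sum.
rewrite mulr_suml; apply: ler_sum => i _.
rewrite normrM -mulrA ler_wpM2l// ger0_norm ?exprn_ge0 ?(ltW y0)//.
exact: expr_le_expR.
Qed.

(** Quadratic decay at [0] is what makes the difference quotient tend to [0]. *)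
Lemma flat_quadratic (p : {poly R}) :
  exists2 B, 0 <= B & forall x, `|flat p x| <= B * x ^+ 2.
Proof.
have [B B0 HB] := poly_expR_bounded ('X^2 * p).
exists B => // x; rewrite /flat; case: ifPn => x0; last first.
  by rewrite normr0 mulr_ge0// sqr_ge0.
have xV : 0 < x^-1 by rewrite invr_gt0.
have := HB _ xV; rewrite hornerM hornerXn normrM -ler_pdivrMr ?exprn_gt0//.
apply: le_trans; rewrite normrM [`|expR _|]ger0_norm ?expR_ge0//.
rewrite [`|_ ^+ 2|]ger0_norm ?exprn_ge0 ?(ltW xV)// exprVn.
by rewrite mulrC mulrA.
Qed.

Lemma is_derive_flat (p : {poly R}) x :
  is_derive x (1:R) (flat p) (flat ('X^2 * (p - p^`())) x).
Proof.
have [x0|x0|<-] := ltgtP 0 x.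
- apply: (@near_eq_is_derive R R R (fun x : R => p.[x^-1] * expR (- x^-1)) (flat p)).
    near=> y; rewrite /flat ifT//; near: y; exact: lt_nbhsr.
  rewrite /flat x0.
  have xn0 : x != 0 by rewrite gt_eqF.
  have dV : is_derive x (1:R) (fun x : R => x^-1) (- x ^- 2).
    have D : derivable (fun x : R => x^-1) x 1 by apply: derivableV.
    apply: DeriveDef => //; rewrite deriveV//.
    by rewrite derive_id scaleNr /GRing.scale/= mulr1.
  have dp : is_derive x (1:R) (fun x => p.[x^-1]) (p^`().[x^-1] * (- x ^- 2)).
    have [D1 E1] := derivable_comp1 (ex_derive (is_derive := dV))
      (ex_derive (is_derive := is_derive_poly p x^-1)).
    apply: DeriveDef; first exact D1.
    by have -> := E1; rewrite !derive_val.
  have de : is_derive x (1:R) (fun x => expR (- x^-1)) (expR (- x^-1) * x ^- 2).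
    have dN : is_derive x (1:R) (fun x : R => - x^-1) (x ^- 2).
      have := is_deriveN dV; rewrite opprK; exact.
    have [D1 E1] := derivable_comp1 (ex_derive (is_derive := dN))
      (ex_derive (is_derive := is_derive_expR (- x^-1))).
    apply: DeriveDef; first exact D1.
    by have -> := E1; rewrite !derive_val.
  rewrite (_ : _ * _ = p.[x^-1] *: (expR (- x^-1) * x ^- 2) +
     expR (- x^-1) *: (p^`().[x^-1] * (- x ^- 2))); first exact (is_deriveM dp de).
  rewrite /GRing.scale/= hornerM hornerXn hornerD hornerN -exprVn.
  ring.
- apply: (@near_eq_is_derive R R R (cst 0) (flat p)).
    near=> y; rewrite /flat ifF//; apply/negbTE; rewrite -leNgt.
    by apply: ltW; near: y; exact: lt_nbhsl.
  by rewrite /flat ifF ?(lt_gtF x0)//; exact: is_derive_cst.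
- have [B B0 HB] := flat_quadratic p.
  have -> : flat ('X^2 * (p - p^`())) 0 = 0 by rewrite /flat ltxx.
  have f0 : flat p 0 = 0 by rewrite /flat ltxx.
  suff H : (fun h => h^-1 *: ((flat p \o shift 0) (h *: 1) - flat p 0)) @ 0^' --> (0:R).
    by apply: DeriveDef; [exact: cvgP H|exact: cvg_lim H].
  apply/cvgr0Pnorm_lt => eps eps0; near=> h.
  rewrite f0 subr0 /= addr0 [h *: 1]mulr1 normrM normfV.
  have h0 : h != 0 by near: h; exact: nbhs_dnbhs_neq.
  rewrite mulrC ltr_pdivrMr ?normr_gt0//.
  apply: (le_lt_trans (HB h)).
  rewrite -real_normK ?num_real// expr2 mulrA ltr_pM2r ?normr_gt0//.
  apply: (@le_lt_trans _ _ ((B + 1) * `|h|)); first by rewrite ler_wpM2r// lerDl.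
  rewrite mulrC -ltr_pdivlMr ?ltr_wpDl//.
  near: h; apply: dnbhs0_lt; rewrite divr_gt0// ltr_wpDl//.
Unshelve. all: by end_near. Qed.

Lemma sm_flat p : sm dir1 (flat p).
Proof.
move=> n; elim: n p => [|n IH] p; split => //.
- move=> x; apply/differentiable_continuous/derivable1_diffP.
  exact: (ex_derive (is_derive := is_derive_flat p x)).
- move=> x; apply/differentiable_continuous/derivable1_diffP.
  exact: (ex_derive (is_derive := is_derive_flat p x)).
case; split=> [x|]; first exact: (ex_derive (is_derive := is_derive_flat p x)).
rewrite -/smoothN (_ : pd _ _ _ = flat ('X^2 * (p - p^`()))); first exact: IH.
apply/funext => x; rewrite /pd /dir1.
by have Dx := is_derive_flat p x; rewrite derive_val.
Qed.

Lemma sm_id : sm dir1 (@id R).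
Proof.
case=> [|n]; split => //; do ?[by move=> x; exact: cvg_id].
case; split=> [x|]; first exact: derivable_id.
rewrite (_ : pd _ _ _ = cst 1); first exact: smoothN_cst.
by apply/funext => x; rewrite /pd derive_id.
Qed.

Lemma flat1_gt0 (x : R) : 0 < x -> 0 < flat 1 x.
Proof. by move=> x0; rewrite /flat x0 hornerC mul1r expR_gt0. Qed.

Lemma flat1_ge0 (x : R) : 0 <= flat 1 x.
Proof. by rewrite /flat; case: ifP => // x0; rewrite hornerC mul1r expR_ge0. Qed.

Lemma flat_eq0 (x : R) p : x <= 0 -> flat p x = 0.
Proof. by move=> x0; rewrite /flat ltNge x0. Qed.

Definition step (t : R) := flat 1 t / (flat 1 t + flat 1 (1 - t)).

Lemma step_den_gt0 (t : R) : 0 < flat 1 t + flat 1 (1 - t).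
Proof.
have [t0|t0] := ltP 0 t.
  by apply: ltr_wpDr; [exact: flat1_ge0|exact: flat1_gt0].
by apply: ltr_wpDl; [exact: flat1_ge0|apply: flat1_gt0; rewrite subr_gt0 (le_lt_trans t0)].
Qed.

Lemma sm_step : sm dir1 step.
Proof.
apply: (smM (f := flat 1) (g := fun t => (flat 1 t + flat 1 (1 - t))^-1)).
  exact: sm_flat.
apply: smV; first by move=> t; rewrite gt_eqF// step_den_gt0.
apply: (smD (f := flat 1) (g := flat 1 \o (cst 1 - id))); first exact: sm_flat.
apply: sm_comp; first exact: sm_flat.
by apply: smB; [exact: sm_cst|exact: sm_id].
Qed.

Lemma step_eq0 (t : R) : t <= 0 -> step t = 0.
Proof. by move=> t0; rewrite /step flat_eq0// mul0r. Qed.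

Lemma step_eq1 (t : R) : 1 <= t -> step t = 1.
Proof.
move=> t1; rewrite /step (@flat_eq0 (1 - t)) ?subr_le0// addr0 divff//.
by rewrite gt_eqF// flat1_gt0// (lt_le_trans _ t1).
Qed.

Lemma step_ge0 (t : R) : 0 <= step t.
Proof. by rewrite divr_ge0 ?flat1_ge0// ltW// step_den_gt0. Qed.

Lemma step_le1 (t : R) : step t <= 1.
Proof. by rewrite ler_pdivrMr ?step_den_gt0// mul1r lerDl flat1_ge0. Qed.

(** Off the compact interval from [0] to [1] the step is locally constant. *)
Lemma Dseq_step_bounded n : exists2 B, 0 <= B & forall s t, (size s <= n)%N ->
  `|Dseq dir1 s step t| <= B.
Proof.
suff H s : exists2 B, 0 <= B & forall t, `|Dseq dir1 s step t| <= B.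
  have Es (s : seq unit) : s = nseq (size s) tt.
    by elim: s => //= -[] s <-.
  pose F k := sval (cid2 (H (nseq k tt))).
  exists (\sum_(k < n.+1) F k).
    by apply: sumr_ge0 => k _; rewrite /F; case: cid2.
  move=> s t sn; rewrite (Es s).
  apply: (@le_trans _ _ (F (size s))); first by rewrite /F; case: cid2 => B ? /= ->.
  have sn' : (size s < n.+1)%N by [].
  rewrite (bigD1 (Ordinal sn')) //= lerDl sumr_ge0// => k _.
  by rewrite /F; case: cid2.
have ss := sm_Dseq s sm_step.
case: s ss => [|i s] ss.
  by exists 1 => // t /=; rewrite ger0_norm ?step_ge0// step_le1.
set f := Dseq _ _ _ in ss *.
have fc : {within `[0, 1], continuous (fun t => `|f t|)}.
  apply: continuous_subspaceT => t; apply: continuous_comp; first exact: (sm_cont ss).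
  exact: norm_continuous.
have [c _ Hc] := EVT_max (@ler01 R) fc.
exists `|f c| => // t.
have [t01|t01] := boolP (t \in `[0, 1]); first exact: Hc.
suff -> : f t = 0 by rewrite normr0.
move: t01; rewrite in_itv/= negb_and -!ltNge => /orP[t0|t1].
  rewrite (_ : f t = Dseq dir1 (i :: s) (cst 0) t); first by rewrite Dseq_cst.
  apply: near_Dseq; near=> y; apply: step_eq0; apply: ltW; near: y; exact: lt_nbhsl.
rewrite (_ : f t = Dseq dir1 (i :: s) (cst 1) t); first by rewrite Dseq_cst.
apply: near_Dseq; near=> y; apply: step_eq1; apply: ltW; near: y; exact: lt_nbhsr.
Unshelve. all: by end_near. Qed.

End step.

(** * Boxes and Borel sets *)

Section boxes.
Context {R : realType} {n : nat}.
Local Notation E := 'rV[R]_n.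
Implicit Types (c x : E) (r : R) (U : set E).

Definition box c r : set E := [set x | forall i, `|x ord0 i - c ord0 i| < r].
Definition cbox c r : set E := [set x | forall i, `|x ord0 i - c ord0 i| <= r].

Lemma ball_rV x r : 0 < r -> ball x r = box x r.
Proof.
move=> r0; apply/seteqP; split => y.
  by move=> [_ H] i; have := H ord0 i; rewrite -ball_normE/= distrC.
move=> H; split => // i j; rewrite (ord1 i) -ball_normE/= distrC; exact: H.
Qed.

Lemma measurable_setI_ord (P : 'I_n -> set E) :
  (forall i, measurable (P i)) -> measurable [set x | forall i, P i x].
Proof.
move=> mP; rewrite (_ : [set x | _] = \bigcap_(i in setT) P i).
  by apply: fin_bigcap_measurable => //; exact: finite_finset.
by apply/seteqP; split => x /= H i //; exact: H.
Qed.

Lemma measurable_box c r : measurable (box c r).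
Proof.
apply: measurable_setI_ord => i.
have := @measurable_rV_coord R n i measurableT _
  (measurable_itv `]c ord0 i - r, c ord0 i + r[).
rewrite setTI; congr measurable; apply/seteqP; split => x /=;
  by rewrite /rV_coord in_itv/= ltr_distl.
Qed.

Lemma measurable_cbox c r : measurable (cbox c r).
Proof.
apply: measurable_setI_ord => i.
have := @measurable_rV_coord R n i measurableT _
  (measurable_itv `[c ord0 i - r, c ord0 i + r]).
rewrite setTI; congr measurable; apply/seteqP; split => x /=;
  by rewrite /rV_coord in_itv/= ler_distl.
Qed.

(** Boxes with rational centres and radii [1/n] suffice, so the union is countable:
    this makes open sets measurable for the product sigma-algebra and reduces
    local statements to boxes. *)
Lemma open_bigcup_boxes U : open U ->
  exists (P : set nat) (c : nat -> E) (r : nat -> R),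
    U = \bigcup_(k in P) box (c k) (r k) /\
    forall k, P k -> 0 < r k /\ cbox (c k) (r k) `<=` U.
Proof.
move=> oU.
pose dec (k : nat) : 'rV[rat]_n * nat := odflt (0, 0%N) (unpickle k).
pose c k : E := map_mx ratr (dec k).1.
pose r k : R := ((dec k).2.+1%:R)^-1.
have r0 k : 0 < r k by rewrite invr_gt0.
exists [set k | cbox (c k) (r k) `<=` U], c, r; split; last by move=> k.
apply/seteqP; split => [x Ux|x [k /= sub] xk]; last first.
  by apply: sub => i; exact/ltW/xk.
have /nbhs_ballP[eps /= eps0 sub] : nbhs x U by exact: open_nbhs_nbhs.
rewrite ball_rV// in sub.
have [N _ HN] := near_infty_natSinv_lt (PosNum (divr_gt0 eps0 (ltr0n _ 2))).
have {}HN : (N.+1%:R : R)^-1 < eps / 2 by exact: HN (leqnn _).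
have Q i : exists q : rat, `|x ord0 i - ratr q| < N.+1%:R^-1.
  have [q] : exists q : rat, ratr q \in `]x ord0 i - N.+1%:R^-1, x ord0 i + N.+1%:R^-1[.
    by apply: rat_in_itvoo; rewrite ltrBlDr -addrA ltrDl addr_gt0// invr_gt0.
  by rewrite in_itv/= => H; exists q; rewrite distrC ltr_distl; exact: H.
pose q : 'rV[rat]_n := \row_i sval (cid (Q i)).
have qE i : `|x ord0 i - ratr (q ord0 i)| < N.+1%:R^-1.
  by rewrite mxE; case: cid.
pose k := pickle (q, N).
have kE : dec k = (q, N) by rewrite /dec pickleK.
exists k; last by move=> i; rewrite /c /r kE/= mxE.
move=> y /= Hy; apply: sub => i.
have := Hy i; rewrite /c /r kE/= mxE => Hi.
rewrite (splitr eps); apply: (le_lt_trans (ler_distD (ratr (q ord0 i)) _ _)).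
apply: ltrD; first exact: le_lt_trans Hi HN.
by rewrite distrC (lt_trans (qE i)).
Qed.

Lemma open_measurable_rV U : open U -> measurable U.
Proof.
move=> /open_bigcup_boxes[P [c [r [-> _]]]].
by apply: bigcup_measurable => k _; exact: measurable_box.
Qed.

Lemma closed_measurable_rV U : closed U -> measurable U.
Proof.
by move=> cU; rewrite -[U]setCK; apply: measurableC; apply: open_measurable_rV; exact: closed_openC.
Qed.

Lemma compact_measurable_rV U : compact U -> measurable U.
Proof.
move=> cU; apply: closed_measurable_rV; exact: compact_closed.
Qed.

Lemma continuous_measurable_rV (f : E -> R) : continuous f ->
  measurable_fun setT f.
Proof.
move=> cf; apply: (measurability _ (RGenOpens.measurableE R)) => //.
move=> _ [_ [a [b ->] <-]]; rewrite setTI.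
apply: open_measurable_rV; apply: open_comp; last exact: interval_open.
by move=> x _; exact: cf.
Qed.

Lemma compact_sub_cbox (K : set E) : compact K -> exists r, 0 < r /\ K `<=` cbox 0 r.
Proof.
move=> /compact_bounded[M [_ HM]]; exists (`|M| + 1); split.
  by rewrite ltr_wpDl.
move=> x Kx i; have /= xM := HM (`|M| + 1) _ x Kx.
rewrite mxE subr0; apply: le_trans (xM _); last by rewrite ltr_pwDr// ler_norm.
have -> : `|x| = mx_norm x by [].
by rewrite mx_normrE; apply/bigmax_geP; right; exists (ord0, i).
Qed.

Lemma compact_cbox c r : compact (cbox c r).
Proof.
rewrite (_ : cbox c r =
  [set v : E | forall i, `[c ord0 i - r, c ord0 i + r]%classic (v ord0 i)]).
  by apply: (@rV_compact R n (fun i => `[c ord0 i - r, c ord0 i + r]%classic)) => i; exact: segment_compact.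
by apply/seteqP; split => x /= H i; have := H i; rewrite /= in_itv/= ler_distl.
Qed.

End boxes.

(** * Integrals of derivatives *)

Section cc.
Context {R : realType}.

Lemma leb_cbox_fin n (c : 'rV[R]_n) (r : R) : (leb R n (cbox c r) < +oo)%E.
Proof.
elim: n c => [|n IH] c.
  by rewrite /= diracE; case: (_ \in _); rewrite ltey.
rewrite /= /cons_measure /pushforward.
rewrite (_ : _ @^-1` _ = `[c ord0 ord0 - r, c ord0 ord0 + r]%classic `*` cbox (rV_behead c) r).
  rewrite product_measure1E//; last exact: measurable_cbox.
  rewrite lte_mul_pinfty//.
    by rewrite [X in X \is a _](_ : _ = lebesgue_measure `[c ord0 ord0 - r, c ord0 ord0 + r]) //
      lebesgue_measure_itv; case: ifP.
apply/seteqP; split => -[t y] /=.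
  move=> H; split => /=.
    by have := H ord0; rewrite mxE unlift_none /= in_itv/= ler_distl.
  by move=> j; have := H (lift ord0 j); rewrite !mxE liftK.
move=> [/= Ht Hy] i; rewrite mxE; case: (unliftP ord0 i) => [j ->|->].
  by have := Hy j; rewrite /= !mxE.
by move: Ht; rewrite in_itv/= ler_distl.
Qed.

(** Continuous functions of compact support. *)
Definition cc n (f : 'rV[R]_n -> R) := continuous f /\
  exists r, forall x, ~ cbox 0 r x -> f x = 0.

Lemma cc_supp n (f : 'rV[R]_n -> R) (K : set 'rV[R]_n) : continuous f -> compact K ->
  (forall x, ~ K x -> f x = 0) -> cc f.
Proof.
move=> cf /compact_sub_cbox[r [_ Kr]] fK; split => //; exists r => x xr.
by apply: fK => /Kr.
Qed.

Lemma cc_bounded n (f : 'rV[R]_n -> R) : cc f -> exists B, forall x, `|f x| <= B.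
Proof.
move=> [cf [r fr]].
have : compact (f @` cbox 0 r).
  by apply: continuous_compact; [exact: continuous_subspaceT|exact: compact_cbox].
move=> /compact_bounded[M [_ HM]]; exists (`|M| + 1) => x.
have [xr|/fr ->] := pselect (cbox 0 r x); last by rewrite normr0 addr_ge0.
by apply: (HM (`|M| + 1)) => /=; [rewrite ltr_pwDr// ler_norm|exists x].
Qed.

Lemma cc_measurable n (f : 'rV[R]_n -> R) : cc f -> measurable_fun setT f.
Proof. by move=> [cf _]; exact: continuous_measurable_rV. Qed.

Lemma cc_integrable n (f : 'rV[R]_n -> R) : cc f ->
  (leb R n).-integrable setT (EFin \o f).
Proof.
move=> ccf; have [cf [r fr]] := ccf; have [B HB] := cc_bounded ccf.
have -> : EFin \o f = (EFin \o f) \_ (cbox 0 r).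
  apply/funext => x; rewrite patchE; case: ifPn => //.
  by rewrite notin_setE => /fr /= ->.
apply: (integrable_mkcond _ (measurable_cbox _ _)).1.
apply: measurable_bounded_integrable; first exact: measurable_cbox.
- exact: leb_cbox_fin.
- by apply: measurable_funTS; exact: cc_measurable.
- exists B; split; first exact: num_real.
  by move=> M BM x _; exact: le_trans (HB x) (ltW BM).
Qed.

Lemma ccM n (f g : 'rV[R]_n -> R) : continuous f -> cc g -> cc (fun x => f x * g x).
Proof.
move=> cf [cg [r gr]]; split.
  by move=> x; exact: (continuousM (cf x) (cg x)).
by exists r => x /gr ->; rewrite mulr0.
Qed.

Lemma cbox_le n (r s : R) : r <= s -> cbox (0 : 'rV[R]_n) r `<=` cbox 0 s.
Proof. by move=> rs x H i; exact: le_trans (H i) rs. Qed.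

Lemma ccD n (f g : 'rV[R]_n -> R) : cc f -> cc g -> cc (fun x => f x + g x).
Proof.
move=> [cf [s fs]] [cg [r gr]]; split.
  by move=> x; exact: (continuousD (cf x) (cg x)).
exists (Num.max s r) => x xm; rewrite fs ?gr ?addr0// => H; apply: xm.
  by apply: cbox_le H; rewrite le_max lexx orbT.
by apply: cbox_le H; rewrite le_max lexx.
Qed.

Lemma cc_pd n (f : 'rV[R]_n -> R) s : sm dirs f -> cc f -> cc (Dseq dirs s f).
Proof.
move=> sf [cf [r fr]]; split; first exact: (sm_cont (sm_Dseq s sf)).
exists r => x xr; apply: (@Dseq_out _ _ _ _ _ _ (cbox 0 r)) => //.
by apply: compact_closed => //; exact: compact_cbox.
Qed.

Lemma integrable_cons n (f : 'rV[R]_n.+1 -> \bar R) :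
  (leb R n.+1).-integrable setT f ->
  (@lebesgue_measure R \x leb R n)%E.-integrable setT (f \o @rV_cons R n).
Proof.
move=> /integrableP[mf fi]; apply/integrableP; split.
  move=> _ Y mY; rewrite setTI comp_preimage -[X in measurable X]setTI.
  apply: measurable_rV_cons => //.
  by rewrite -[X in measurable X]setTI; exact: mf.
move: fi; rewrite /= /cons_measure ge0_integral_pushforward//=.
- exact: measurable_rV_cons.
- exact: measurableT_comp.
Qed.

Lemma integral_cons n (f : 'rV[R]_n.+1 -> \bar R) :
  (leb R n.+1).-integrable setT f ->
  (\int[leb R n.+1]_x f x = \int[@lebesgue_measure R \x leb R n]_p f (rV_cons p))%E.
Proof.
move=> fi; rewrite /= integral_pushforward//=.
- exact: measurable_rV_cons.
- by case/integrableP : fi.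
- exact: integrable_cons.
Qed.

Lemma rV_consD n (t h : R) (y z : 'rV[R]_n) :
  rV_cons (t, y) + rV_cons (h, z) = rV_cons (t + h, y + z).
Proof. by apply/rowP => i; rewrite !mxE; case: unlift => //= j; rewrite mxE. Qed.

Lemma dirs_ord0 n (h : R) : h *: dirs ord0 = rV_cons (h, 0 : 'rV[R]_n).
Proof.
apply/rowP => i; rewrite !mxE; case: (unliftP ord0 i) => [j ->|->] /=.
  by rewrite mxE mulr0.
by rewrite mulr1.
Qed.

Lemma dirs_lift n (h : R) (j : 'I_n) :
  h *: dirs (lift ord0 j) = rV_cons (0, h *: dirs j).
Proof.
apply/rowP => i; rewrite !mxE; case: (unliftP ord0 i) => [k ->|->] /=.
  by rewrite !mxE /= (inj_eq (@lift_inj _ _)).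
by rewrite /= mulr0.
Qed.

Lemma continuous_rV_cons n : continuous (@rV_cons R n).
Proof.
move=> [t y]; apply/cvgrPdist_lt => eps eps0.
suff : \forall p \near nbhs (t, y), box (rV_cons (t, y)) eps (rV_cons p).
  apply: filterS => p; rewrite -ball_rV// -ball_normE/= distrC; done.
have : nbhs (t, y) (ball t eps `*` ball y eps).
  exists (ball t eps, ball y eps) => //=; split; exact: nbhsx_ballx.
apply: filterS => -[h z] [/= H1]; rewrite ball_rV// => H2 i; rewrite !mxE.
case: (unliftP ord0 i) => [j _|_] /=; first exact: H2.
by move: H1; rewrite -ball_normE /= distrC.
Qed.

Lemma pairr_continuous n (t : R) : continuous (fun y : 'rV[R]_n => (t, y)).
Proof.
move=> y A [[B C] [/= tB yC] BC]; rewrite nbhs_simpl /=.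
by apply: filterS yC => z Cz; apply: BC; split => //=; exact: nbhs_singleton.
Qed.

Lemma pairl_continuous n (y : 'rV[R]_n) : continuous (fun t : R => (t, y)).
Proof.
move=> t A [[B C] [/= tB yC] BC]; rewrite nbhs_simpl /=.
by apply: filterS tB => z Cz; apply: BC; split => //=; exact: nbhs_singleton.
Qed.

Lemma cc_slice1 n (f : 'rV[R]_n.+1 -> R) t : cc f -> cc (fun y => f (rV_cons (t, y))).
Proof.
move=> [cf [r fr]]; split.
  move=> y; apply: (@continuous_comp _ _ _ (fun y => rV_cons (t, y)) f); last exact: cf.
  apply: (@continuous_comp _ _ _ (fun y => (t, y)) (@rV_cons R n)); last exact: continuous_rV_cons.
  exact: pairr_continuous.
exists r => y yr; apply: fr => H; apply: yr => i.
by have := H (lift ord0 i); rewrite !mxE liftK.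
Qed.

Lemma slice2_continuous n (f : 'rV[R]_n.+1 -> R) y : continuous f ->
  continuous (fun t => f (rV_cons (t, y))).
Proof.
move=> cf t; apply: (@continuous_comp _ _ _ (fun t => rV_cons (t, y)) f); last exact: cf.
apply: (@continuous_comp _ _ _ (fun t => (t, y)) (@rV_cons R n)); last exact: continuous_rV_cons.
exact: pairl_continuous.
Qed.

Lemma integral_derive_line (f g : R -> R) (r : R) :
  continuous g -> (forall t, is_derive t (1:R) f (g t)) ->
  (forall t, r < `|t| -> f t = 0) -> (forall t, r < `|t| -> g t = 0) ->
  (\int[@lebesgue_measure R]_t (g t)%:E = 0)%E.
Proof.
move=> cg df f0 g0.
pose s := `|r| + 1.
have s0 : 0 < s by rewrite ltr_wpDl.
have rs : r < s by rewrite ltr_pwDr// ler_norm.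
rewrite (_ : (fun t => _) = (EFin \o g) \_ `[- s, s]); last first.
  apply/funext => t; rewrite patchE; case: ifPn => // /negP H.
  rewrite g0// ltNge; apply/negP => tr; apply: H; rewrite inE/= in_itv/= -ler_norml.
  exact: le_trans tr (ltW rs).
rewrite -integral_mkcond.
have cf : continuous f.
  move=> t; apply/differentiable_continuous/derivable1_diffP.
  exact: (ex_derive (is_derive := df t)).
rewrite (@continuous_FTC2 _ g f).
- by rewrite !f0 ?subee// ?normrN ger0_norm// ltW.
- by rewrite gtrN.
- exact: continuous_subspaceT.
- split.
  + move=> t _; exact: (ex_derive (is_derive := df t)).
  + exact/cvg_at_right_filter/cf.
  + exact/cvg_at_left_filter/cf.
- by move=> t _; rewrite derive1E derive_val.
Qed.

(** By Fubini: for the first coordinate integrate along lines first and use the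
    fundamental theorem of calculus; for the others use induction on slices. *)
Lemma integral_pd0 n (i : 'I_n) (f : 'rV[R]_n -> R) :
  cc f -> cc (pd dirs i f) -> (forall x, derivable f x (dirs i)) ->
  (\int[leb R n]_x (pd dirs i f x)%:E = 0)%E.
Proof.
elim: n i f => [[]//|n IH] i f ccf ccg df.
have gi := cc_integrable ccg.
have gi' := integrable_cons gi.
rewrite (integral_cons gi).
case: (unliftP ord0 i) => [j|] ie.
  rewrite -(integral12_prod_meas1 gi') integral0_eq// => t _ /=.
  have gE : pd dirs j (fun y => f (rV_cons (t, y))) =
            fun y => pd dirs i f (rV_cons (t, y)).
    apply/funext => y; rewrite /pd /derive; set F := fun h => _; set G := fun h => _.
    suff -> : F = G by [].
    by apply/funext => h; rewrite /F /G /= ie dirs_lift rV_consD add0r.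
  have := IH j (fun y => f (rV_cons (t, y))).
  rewrite gE; apply; [exact: cc_slice1|exact: (cc_slice1 t ccg)|].
  move=> y; have := df (rV_cons (t, y)); rewrite /derivable.
  set F := fun h => _; set G := fun h => _.
  suff -> : F = G by [].
  by apply/funext => h; rewrite /F /G /= ie dirs_lift rV_consD add0r.
rewrite -(integral21_prod_meas1 gi') integral0_eq// => y _ /=.
have [cf [r fr]] := ccf; have [cg [s gs]] := ccg.
have out q (t : R) : q < `|t| -> ~ cbox 0 q (rV_cons (t, y)).
  move=> qt H; have := H ord0; rewrite !mxE unlift_none/= subr0.
  by rewrite leNgt qt.
have lineE (t h : R) : h *: dirs i + rV_cons (t, y) = rV_cons (h + t, y).
  by rewrite ie dirs_ord0 rV_consD add0r.
apply: (@integral_derive_line (fun t => f (rV_cons (t, y))) _ (Num.max r s)).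
- exact: slice2_continuous.
- move=> t.
  have D : derivable (fun t => f (rV_cons (t, y))) t 1.
    have := df (rV_cons (t, y)); rewrite /derivable.
    set F := fun h => _; set G := fun h => _.
    suff -> : F = G by [].
    by apply/funext => h; rewrite /F /G /= lineE [h *: 1]mulr1.
  apply: DeriveDef; first exact D.
  rewrite /pd /derive; set F := fun h => _; set G := fun h => _.
  suff -> : F = G by [].
  by apply/funext => h; rewrite /F /G /= lineE [h *: 1]mulr1.
- by move=> t; rewrite gt_max => /andP[tr _]; apply: fr; exact: out.
- by move=> t; rewrite gt_max => /andP[_ ts]; apply: gs; exact: out.
Qed.

End cc.

(** * Integration by parts *)

Section integration_by_parts.
Context {R : realType} {n : nat}.
Local Notation E := 'rV[R]_n.
Local Notation mu := (leb R n).

Lemma Rint_pd0 (i : 'I_n) (f : E -> R) : sm dirs f -> cc f ->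
  \int[mu]_x (pd dirs i f x) = 0.
Proof.
move=> sf cf; rewrite /Rintegral integral_pd0//.
  exact: (cc_pd [:: i]).
by move=> x; exact: sm_derivable.
Qed.

Lemma Rint_parts (i : 'I_n) (f g : E -> R) : sm dirs f -> sm dirs g -> cc g ->
  \int[mu]_x (pd dirs i f x * g x) = - \int[mu]_x (f x * pd dirs i g x).
Proof.
move=> sf sg cg; apply/eqP; rewrite -addr_eq0; apply/eqP.
have c1 : cc (fun x => pd dirs i f x * g x).
  by apply: ccM => //; exact/sm_cont/sm_pd.
have c2 : cc (fun x => f x * pd dirs i g x).
  by apply: ccM; [exact: sm_cont|exact: (cc_pd [:: i])].
rewrite -RintegralD//; [|exact: cc_integrable|exact: cc_integrable].
rewrite -[RHS](@Rint_pd0 i (f * g)); last 2 first.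
- exact: smM.
- by apply: ccM => //; exact: sm_cont.
apply: eq_Rintegral => x _.
by rewrite pdM// !fctE addrC [g x * _]mulrC.
Qed.

Lemma Rint_parts_seq s (f g : E -> R) : sm dirs f -> sm dirs g -> cc g ->
  \int[mu]_x (Dseq dirs s f x * g x) =
  (-1) ^+ size s * \int[mu]_x (f x * Dseq dirs (rev s) g x).
Proof.
move=> sf; elim: s g => [|i s IH] g sg cg; first by rewrite expr0 mul1r.
rewrite /= Rint_parts//; last exact: sm_Dseq.
rewrite IH; [|exact: sm_pd|exact: (cc_pd [:: i])].
by rewrite rev_cons Dseq_rcons exprS mulN1r mulNr.
Qed.

End integration_by_parts.

(** * The lemma of du Bois-Reymond *)

Section bumps.
Context {R : realType} {n : nat}.
Local Notation E := 'rV[R]_n.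

Lemma sm_prod {V : normedModType R} {I : Type} (e : I -> V) J (r : seq J) (P : pred J)
    (F : J -> V -> R) : (forall j, P j -> sm e (F j)) ->
  sm e (\prod_(j <- r | P j) F j).
Proof.
move=> sF; elim/big_rec : _ => [|j f Pj sf]; first exact: (sm_cst _ 1).
by apply: smM => //; exact: sF.
Qed.

(** Smooth functions that tend to the indicator of the open rectangle from [a] to
    [b] as [k] grows. *)
Definition bump (k : R) (a b : E) : E -> R :=
  \prod_i ((step \o (cst k * ((fun x : E => x ord0 i) - cst (a ord0 i)))) *
           (step \o (cst k * (cst (b ord0 i) - (fun x : E => x ord0 i))))).

Lemma bumpE k a b x : bump k a b x =
  \prod_i (step (k * (x ord0 i - a ord0 i)) * step (k * (b ord0 i - x ord0 i))).
Proof.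
rewrite /bump; elim/big_rec2 : _ => // i y f _ <-.
by [].
Qed.

Lemma sm_bump k a b : sm dirs (bump k a b).
Proof.
apply: sm_prod => i _; apply: smM; apply: sm_comp; do ?[exact: sm_step];
  apply: smM; do ?[exact: sm_cst]; apply: smB; do ?[exact: sm_cst]; exact: sm_coord.
Qed.

Definition rect (a b : E) : set E :=
  [set x | forall i, a ord0 i < x ord0 i < b ord0 i].

Lemma bump_ge0 k a b x : 0 <= bump k a b x.
Proof. by rewrite bumpE; apply: prodr_ge0 => i _; rewrite mulr_ge0// step_ge0. Qed.

Lemma bump_le1 k a b x : bump k a b x <= 1.
Proof.
rewrite bumpE; apply: prodr_ile1 => i _.
by rewrite mulr_ge0 ?step_ge0// mulr_ile1 ?step_ge0 ?step_le1.
Qed.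

Lemma bump_out k a b x : 0 <= k -> ~ rect a b x -> bump k a b x = 0.
Proof.
move=> k0 /existsNP[i /negP]; rewrite negb_and -!leNgt bumpE => xi.
rewrite (bigD1 i)//=; case/orP : xi => xi.
  by rewrite step_eq0 ?mul0r// mulr_ge0_le0// subr_le0.
by rewrite (@step_eq0 _ (k * (b ord0 i - _))) ?mulr0 ?mul0r// mulr_ge0_le0// subr_le0.
Qed.

Lemma bump_cvg a b x : bump k%:R a b x @[k --> \oo] --> (\1_(rect a b) x : R).
Proof.
rewrite indicE; have [/set_mem xab|/negP xab] := boolP (x \in rect a b); last first.
  rewrite (_ : (fun k => _) = cst 0); first exact: cvg_cst.
  by apply/funext => k; rewrite bump_out// => /mem_set.
apply: cvg_near_cst.
have H i : \forall k \near \oo, 1 <= k%:R * (x ord0 i - a ord0 i) /\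
    1 <= k%:R * (b ord0 i - x ord0 i).
  have /andP[H1 H2] := xab i.
  have aux (y : R) : 0 < y -> \forall k \near \oo, 1 <= k%:R * y.
    move=> y0; near=> k; rewrite -ler_pdivrMr// div1r.
    by near: k; exact: nbhs_infty_ger.
  by apply: filterI; apply: aux; rewrite subr_gt0.
have := @filter_forall _ _ _ _ eventually_filter H.
apply: filterS => k Hk; rewrite bumpE big1// => i _.
by have [H1 H2] := Hk i; rewrite !step_eq1// mul1r.
Unshelve. all: by end_near. Qed.

End bumps.

Section fundamental_lemma.
Context {R : realType} {n : nat}.
Local Notation E := 'rV[R]_n.
Local Notation mu := (leb R n).

Definition quadrant (a : E) : set E := [set x | forall i, a ord0 i < x ord0 i].

Lemma measurable_quadrant a : measurable (quadrant a).
Proof.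
apply: measurable_setI_ord => i.
have := @measurable_rV_coord R n i measurableT _
  (measurable_itv `]a ord0 i, +oo[).
rewrite setTI; congr measurable; apply/seteqP; split => x /=;
  by rewrite /rV_coord in_itv/= andbT.
Qed.

Lemma setI_quadrant : setI_closed [set A | exists a, A = quadrant a].
Proof.
move=> _ _ [a ->] [b ->]; exists (\row_i Num.max (a ord0 i) (b ord0 i)).
apply/seteqP; split => x /=.
  by move=> [H1 H2] i; rewrite mxE gt_max H1 H2.
by move=> H; split => i; have := H i; rewrite mxE gt_max => /andP[].
Qed.

(** Every half space bounding one coordinate is a countable union of quadrants. *)
Lemma quadrant_generates (A : set E) : measurable A ->
  <<s [set A | exists a : E, A = quadrant a] >> A.
Proof.
pose S := <<s [set A | exists a : E, A = quadrant a] >>.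
have sS : sigma_algebra setT S by exact: smallest_sigma_algebra.
have [S0 SC SU] := sS.
have SCT (B : set E) : S B -> S (~` B) by rewrite -setTD; exact: SC.
have Sray (i : 'I_n) (t : R) : S [set x | t < x ord0 i].
  pose F (k : nat) := quadrant (\row_j (if j == i then t else - k%:R)).
  have HU : S (\bigcup_k F k) by apply: SU => k; apply: sub_sigma_algebra; eexists.
  apply: (@eq_ind_r _ _ S HU).
  apply/seteqP; split => x /=; last first.
    by move=> [k _ /(_ i)]; rewrite mxE eqxx.
  move=> tx; have [K HK] : exists K : nat, forall j, - x ord0 j < K%:R.
    exists (\sum_j Num.bound `|x ord0 j|%R)%N => j.
    apply: (@lt_le_trans _ _ (Num.bound `|x ord0 j|)%:R).
      by apply: le_lt_trans (archi_boundP (normr_ge0 _)); rewrite -normrN ler_norm.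
    by rewrite ler_nat (bigD1 j)//= leq_addr.
  exists K => // j; rewrite mxE; case: eqVneq => [->//|_].
  by rewrite ltrNl.
have Scoord (i : 'I_n) (B : set R) : measurable B -> S (rV_coord i @^-1` B).
  move=> mB.
  have : <<s [set B : set R | exists t, B = `]t, +oo[%classic] >> B.
    suff : (@ocitv R).-sigma.-measurable B by rewrite RGenOInfty.measurableE.
    exact: mB.
  apply: (smallest_sub (C := sigma_algebra setT) (G := _) (X := [set B | S (rV_coord i @^-1` B)])).
  - split => /=.
    + by rewrite preimage_set0.
    + by move=> D SD; rewrite setTD preimage_setC; exact: SCT.
    + by move=> F SF; rewrite preimage_bigcup; exact: SU.
  - move=> _ [t ->]; apply: (@eq_ind_r _ _ S (Sray i t)).
    by apply/seteqP; split => x /=; rewrite in_itv/= andbT.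
apply: (smallest_sub sS).
rewrite -bigcup_seq => X /= [i _ [B mB <-]]; rewrite setTI; exact: Scoord.
Qed.

(** The sets over which [h] integrates to [0] form a Dynkin system, and quadrants
    are stable under intersection. *)
Lemma integral_quadrants0 (h : E -> R) (Q : set E) :
  measurable Q -> mu.-integrable Q (EFin \o h) ->
  (\int[mu]_(x in Q) (h x)%:E = 0)%E ->
  (forall a, \int[mu]_(x in quadrant a `&` Q) (h x)%:E = 0)%E ->
  forall A, measurable A -> (\int[mu]_(x in A `&` Q) (h x)%:E = 0)%E.
Proof.
move=> mQ hi h0 hq A mA.
pose H := [set A : set E | measurable A /\ (\int[mu]_(x in A `&` Q) (h x)%:E = 0)%E].
suff : H A by case.
have mh (B : set E) : measurable B -> measurable_fun (B `&` Q) (EFin \o h).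
  by move=> mB; apply: measurable_funS (measurable_int _ hi) => //; exact: subIsetr.
have := quadrant_generates mA; rewrite -(setI_closed_g_dynkin_g_sigma_algebra setI_quadrant).
apply: smallest_sub; last first.
  by move=> _ [a ->]; split; [exact: measurable_quadrant|exact: hq].
split.
- by split => //; rewrite setTI.
- move=> B [mB hB]; split; first exact: measurableC.
  have mBC : measurable (~` B) by exact: measurableC.
  have : (\int[mu]_(x in Q) (h x)%:E = \int[mu]_(x in B `&` Q) (h x)%:E +
     \int[mu]_(x in ~` B `&` Q) (h x)%:E)%E.
    have QE : Q = (B `&` Q) `|` (~` B `&` Q) by rewrite -setIUl setUv setTI.
    rewrite {1}QE integral_setU_EFin//.
    + exact: measurableI.
    + exact: measurableI.
    + by apply/measurable_EFinP; rewrite -QE; exact: (measurable_int _ hi).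
    + by apply/disj_setPS => x [[Bx _] [nBx _]].
  by rewrite h0 hB add0e.
- move=> F tF HF; split; first by apply: bigcup_measurable => k _; have [] := HF k.
  rewrite setI_bigcupl integral_bigcup.
  + by rewrite eseries0// => i _ _; have [] := HF i.
  + by apply: trivIset_setIr.
  + by move=> k; apply: measurableI => //; have [] := HF k.
  + apply: integrableS hi => //.
      by apply: bigcup_measurable => k _; apply: measurableI => //; have [] := HF k.
    by apply: bigcup_sub => k _; exact: subIsetr.
Qed.

End fundamental_lemma.

Section du_bois_reymond.
Context {R : realType} {n : nat}.
Local Notation E := 'rV[R]_n.
Local Notation mu := (leb R n).

Lemma sm_measurable (f : E -> R) D : sm dirs f -> measurable_fun D f.
Proof.
by move=> sf; apply: measurable_funTS; apply: continuous_measurable_rV; exact: sm_cont sf.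
Qed.

Definition locally_integrable (U : set E) (h : E -> R) :=
  measurable_fun U h /\
  forall K : set E, compact K -> K `<=` U -> mu.-integrable K (EFin \o h).

Definition supp_in (U : set E) (phi : E -> R) :=
  exists K : set E, [/\ compact K, K `<=` U & forall x, ~ K x -> phi x = 0].

(** Dominated convergence along the bump functions of the rectangle. *)
Lemma du_bois_reymond_rect (U : set E) (h : E -> R) (c : E) (r : R) (a b : E) :
  open U -> locally_integrable U h -> cbox c r `<=` U -> rect a b `<=` cbox c r ->
  (forall phi, sm dirs phi -> supp_in U phi -> \int[mu]_(x in U) (h x * phi x) = 0) ->
  (\int[mu]_(x in rect a b) (h x)%:E = 0)%E.
Proof.
move=> oU [mh ih] KU abK hphi; set K := cbox c r in KU abK *.
have mK : measurable K by exact: measurable_cbox.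
have cK : compact K by exact: compact_cbox.
have hK := ih K cK KU.
have mhK : measurable_fun K h by apply/measurable_EFinP; exact: (measurable_int _ hK).
have mrect : measurable (rect a b).
  rewrite (_ : rect a b = quadrant a `&` (-%R @^-1` quadrant (- b))); last first.
    apply/seteqP; split => x /=.
      by move=> H; split => i; have /andP[] := H i; rewrite ?mxE ?ltrN2.
    by move=> [H1 H2] i; rewrite H1/=; have := H2 i; rewrite !mxE ltrN2.
  apply: measurableI; first exact: measurable_quadrant.
  apply: measurable_setI_ord => i.
  have := @measurable_rV_coord R n i measurableT _ (measurable_itv `]-oo, b ord0 i[).
  rewrite setTI; congr measurable; apply/seteqP; split => x /=;
    by rewrite /rV_coord in_itv/= !mxE ltrN2.
pose f k (x : E) := (h x * bump k%:R a b x)%:E.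
have f0 k : (\int[mu]_(x in K) f k x = 0)%E.
  have ik : mu.-integrable K (f k).
    apply: (le_integrable mK _ _ hK).
      apply/measurable_EFinP; apply: measurable_funM => //.
      exact (@sm_measurable _ K (@sm_bump R n _ _ _)).
    move=> x Kx; rewrite lee_fin normrM ler_piMr// ger0_norm ?bump_ge0//.
    exact: bump_le1.
  have := hphi (bump k%:R a b) (@sm_bump R n _ _ _).
  rewrite (_ : \int[mu]_(x in U) _ = fine (\int[mu]_(x in K) f k x)%E).
    move=> H; have : fine (\int[mu]_(x in K) f k x)%E = 0.
      apply: H; exists K; split => // x Kx; apply: bump_out => //.
      by move=> /abK.
    move=> {}H; rewrite -[LHS]fineK ?H//.
    by apply: integrable_fin_num.
  rewrite /Rintegral; congr fine; rewrite integral_mkcond [RHS]integral_mkcond.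
  apply: eq_integral => x _; rewrite !patchE.
  have [xK|xK] := boolP (x \in K).
    by rewrite ifT//; apply/mem_set/KU/set_mem.
  case: ifP => // _; rewrite bump_out ?mulr0// => /abK/mem_set.
  exact/negP.
have [_ _ cv] : [/\ mu.-integrable K (fun x => (h x * \1_(rect a b) x)%:E),
    [sequence \int[mu]_(x in K) (`|f k x - (h x * \1_(rect a b) x)%:E|)]_k%E @ \oo --> 0%E &
    [sequence \int[mu]_(x in K) f k x]_k%E @ \oo -->
      (\int[mu]_(x in K) (h x * \1_(rect a b) x)%:E)%E].
  apply: (@dominated_convergence _ _ _ mu K mK f (fun x => (h x * \1_(rect a b) x)%:E) (fun x => `|h x|%:E)) => //.
  - move=> k; apply/measurable_EFinP; apply: measurable_funM => //.
    exact (@sm_measurable _ K (@sm_bump R n _ _ _)).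
  - by apply/measurable_EFinP; apply: measurable_funM.
  - apply: aeW => x Kx; apply: cvg_EFin; first by apply: nearW.
    by apply: cvgMr; exact: bump_cvg.
  - exact: integrable_norm hK.
  - apply: aeW => x k Kx; rewrite lee_fin normrM ler_piMr// ger0_norm ?bump_ge0//.
    exact: bump_le1.
have -> : (\int[mu]_(x in rect a b) (h x)%:E =
   \int[mu]_(x in K) (h x * \1_(rect a b) x)%:E)%E.
  rewrite integral_mkcond [RHS]integral_mkcond.
  apply: eq_integral => x _; rewrite !patchE indicE.
  have [xr|xr] := boolP (x \in rect a b).
    by rewrite ifT ?mulr1//; apply/mem_set/abK/set_mem.
  by case: ifP => //; rewrite mulr0.
have := cvg_unique _ cv; apply => //.
rewrite (_ : [sequence _]_k%E = cst 0%E); first exact: cvg_cst.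
by apply/funext => k /=; rewrite f0.
Qed.

Lemma du_bois_reymond (U : set E) (h : E -> R) :
  open U -> locally_integrable U h ->
  (forall phi, sm dirs phi -> supp_in U phi -> \int[mu]_(x in U) (h x * phi x) = 0) ->
  {ae mu, forall x, U x -> h x = 0}.
Proof.
move=> oU lh hphi.
have [P [c [r [UE H]]]] := open_bigcup_boxes oU.
suff HB k : {ae mu, forall x, P k -> box (c k) (r k) x -> h x = 0}.
  have := ae_foralln HB; apply: filterS => x Hx Ux.
  by move: Ux; rewrite UE => -[k Pk kx]; exact: Hx k Pk kx.
have [Pk|nPk] := pselect (P k); last by apply: aeW.
have [r0 KU] := H k Pk.
have mQ := measurable_box (c k) (r k); set Q := box _ _ in mQ *.
have QK : Q `<=` cbox (c k) (r k) by move=> x Qx i; exact/ltW/Qx.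
have hQ : mu.-integrable Q (EFin \o h).
  apply: (@integrableS _ _ _ _ (cbox (c k) (r k))) => //; first exact: measurable_cbox.
  by apply: lh.2 => //; exact: compact_cbox.
pose b : E := \row_i (c k ord0 i + r k).
have QE a : quadrant a `&` Q = rect (\row_i Num.max (a ord0 i) (c k ord0 i - r k)) b.
  apply/seteqP; split => x /=.
    move=> [ax Qx] i; rewrite !mxE gt_max ax/=.
    by have := Qx i; rewrite ltr_distl => /andP[-> ->].
  move=> Hx; split => i; have := Hx i; rewrite !mxE gt_max => /andP[/andP[]]//.
  by move=> _ x1 x2; rewrite ltr_distl x1 x2.
have Q0 a : (\int[mu]_(x in quadrant a `&` Q) (h x)%:E = 0)%E.
  rewrite QE; apply: (du_bois_reymond_rect oU lh KU) => //.
  by rewrite -QE => x [_ /QK].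
have h0 : (\int[mu]_(x in Q) (h x)%:E = 0)%E.
  rewrite (_ : Q = quadrant (\row_i (c k ord0 i - r k)) `&` Q) ?Q0//.
  apply/seteqP; split => x /= ; last by case.
  move=> Qx; split => // i; rewrite mxE.
  by have := Qx i; rewrite ltr_distl => /andP[].
have hae : ae_eq mu Q (EFin \o h) (cst 0%E).
  apply: integral_ae_eq => //.
  move=> A AQ mA; rewrite integral0 -(setIidl AQ).
  exact: (integral_quadrants0 mQ hQ h0 Q0 mA).
by apply: filterS hae => x Hx _ Qx; have [] := Hx Qx.
Qed.

End du_bois_reymond.

(** * Orders of vanishing under products, powers and compositions *)

Section order_calculus.
Context {R : realType} {V : normedModType R} {I : eqType} (e : I -> V).
Implicit Types (f g : V -> R) (s : seq I) (b sig C : R).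

Lemma DseqZ s c f : sm e f -> Dseq e s (cst c * f) = cst c * Dseq e s f.
Proof.
move=> sf; elim: s => // i s IH; rewrite [LHS]/= IH pdM; [|exact: sm_cst|exact: sm_Dseq].
by rewrite pd_cst; apply/funext => x; rewrite !fctE /cst/= mulr0 addr0.
Qed.

Lemma Dseq_onem s f x : (0 < size s)%N -> sm e f ->
  Dseq e s (cst 1 - f) x = - Dseq e s f x.
Proof.
move=> s0 sf; rewrite (_ : cst 1 - f = cst 1 + cst (-1) * f); last first.
  by apply/funext => y; rewrite !fctE /cst/= mulN1r.
rewrite DseqD; [|exact: sm_cst|by apply: smM => //; exact: sm_cst].
by rewrite Dseq_cst// DseqZ// !fctE /cst/= add0r mulN1r.
Qed.

(** [f] behaves at [x] like a function vanishing to order [p] at distance [sig/b]: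
    each derivative costs a factor [b] and a power of [sig].  The natural
    subtraction stops the loss once [p] derivatives have been taken. *)
Definition ordb (x : V) b sig (n p : nat) C f := forall s, (size s <= n)%N ->
  `|Dseq e s f x| <= C * b ^+ size s * sig ^+ (p - size s).

Lemma splits_size s q : q \in splits s -> (size q.1 + size q.2 = size s)%N.
Proof.
elim: s q => [|i s IH] q /=; first by rewrite inE => /eqP ->.
rewrite mem_cat => /orP[] /mapP[q' /IH H ->] /=; by rewrite ?addSn ?addnS H.
Qed.

Lemma sum_const_seq T (r : seq T) (c : R) : \sum_(i <- r) c = c *+ size r.
Proof. by rewrite big_const_seq count_predT iter_addr_0. Qed.

Lemma ordbM x b sig n p q C C' f g : 0 <= b -> 0 <= sig <= 1 -> 0 <= C -> 0 <= C' ->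
  sm e f -> sm e g -> ordb x b sig n p C f -> ordb x b sig n q C' g ->
  ordb x b sig n (p + q) (2 ^+ n * C * C') (f * g).
Proof.
move=> b0 /andP[s0 s1] C0 C0' sf sg of_ og s sn; rewrite DseqM//.
apply: (le_trans (ler_norm_sum _ _ _)).
apply: (@le_trans _ _ (\sum_(i <- splits s)
   (C * C' * b ^+ size s * sig ^+ (p + q - size s)))).
  rewrite big_seq [leRHS]big_seq; apply: ler_sum => t /splits_size ts.
  rewrite normrM.
  have s1n : (size t.1 <= n)%N by rewrite (leq_trans _ sn)// -ts leq_addr.
  have s2n : (size t.2 <= n)%N by rewrite (leq_trans _ sn)// -ts leq_addl.
  apply: (le_trans (ler_pM (normr_ge0 _) (normr_ge0 _) (of_ _ s1n) (og _ s2n))).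
  rewrite [leLHS](_ : _ = C * C' * b ^+ size s *
     sig ^+ ((p - size t.1) + (q - size t.2))); last first.
    by rewrite exprD -ts exprD; ring.
  apply: ler_wpM2l; first by rewrite !mulr_ge0 ?exprn_ge0.
  by apply: ler_wiXn2l => //; lia.
rewrite sum_const_seq size_splits -[leLHS]mulr_natl natrX.
rewrite [leRHS](_ : _ = 2 ^+ n * (C * C' * b ^+ size s * sig ^+ (p + q - size s))); last ring.
apply: ler_wpM2r; first by rewrite !mulr_ge0 ?exprn_ge0.
by apply: ler_weXn2l => //; rewrite ler1n.
Qed.

Lemma ordb_cst x b sig n c : 0 <= b -> 0 <= sig -> ordb x b sig n 0 `|c| (cst c).
Proof.
move=> b0 s0 [|i s] sn; first by rewrite /= expr0 !mulr1.
by rewrite Dseq_cst// normr0 !mulr_ge0 ?exprn_ge0.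
Qed.

Lemma ordb_onem x b sig n C f : 0 <= b -> 0 <= C -> sm e f ->
  ordb x b sig n 0 C f -> ordb x b sig n 0 (1 + C) (cst 1 - f).
Proof.
move=> b0 C0 sf of_ [|i s] sn; last first.
  rewrite Dseq_onem// normrN; apply: (le_trans (of_ _ sn)).
  by rewrite sub0n expr0 !mulr1 ler_wpM2r ?exprn_ge0// lerDr.
rewrite /= expr0 !mulr1 fctE /cst/=; apply: (le_trans (ler_normB _ _)).
by rewrite normr1 lerD2l; have := of_ [::] sn; rewrite /= expr0 !mulr1.
Qed.

Lemma ordbX x b sig n p C f k : 0 <= b -> 0 <= sig <= 1 -> 0 <= C -> sm e f ->
  ordb x b sig n p C f -> ordb x b sig n (k * p) ((2 ^+ n * C) ^+ k) (f ^+ k).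
Proof.
move=> b0 s01 C0 sf of_; elim: k => [|k IH].
  rewrite !expr0 mul0n.
  by have := @ordb_cst x b sig n 1 b0 (andP s01).1; rewrite normr1.
rewrite exprS mulSn exprS.
by apply: ordbM => //; [rewrite exprn_ge0// mulr_ge0// exprn_ge0|exact: smX].
Qed.

Lemma ordb_sum x b sig n p J (r : seq J) (C : J -> R) (F : J -> V -> R) :
  (forall j, sm e (F j)) -> (forall j, ordb x b sig n p (C j) (F j)) ->
  ordb x b sig n p (\sum_(j <- r) C j) (\sum_(j <- r) F j).
Proof.
move=> sF oF s sn; rewrite Dseq_sum// fct_sumE.
apply: (le_trans (ler_norm_sum _ _ _)); rewrite !mulr_suml.
by apply: ler_sum => j _; exact: oF.
Qed.

(** The constant that the chain rule gives for [n] derivatives of a composition. *)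
Fixpoint comp_const (n : nat) (C M : R) : R :=
  if n is n'.+1 then M + 2 ^+ n' * comp_const n' C M * C else M.

Lemma comp_const_ge0 n C M : 0 <= C -> 0 <= M -> 0 <= comp_const n C M.
Proof.
move=> C0 M0; elim: n => //= n IH.
by rewrite addr_ge0// !mulr_ge0// exprn_ge0.
Qed.

Lemma comp_const_ge n C M : 0 <= C -> 0 <= M -> M <= comp_const n C M.
Proof.
move=> C0 M0; case: n => //= n.
by rewrite lerDl !mulr_ge0 ?exprn_ge0// comp_const_ge0.
Qed.

(** Induction on [n]: by the chain rule the first derivative of the composition
    is a product to which the induction hypothesis and [ordbM] apply. *)
Lemma ordb_comp x b sig n C M (chi : R -> R) f : 0 <= b -> 0 <= sig <= 1 -> 0 <= C -> 0 <= M ->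
  sm dir1 chi -> sm e f ->
  (forall t : seq unit, (size t <= n)%N -> `|Dseq dir1 t chi (f x)| <= M) ->
  (forall s, (0 < size s <= n)%N -> `|Dseq e s f x| <= C * b ^+ size s) ->
  ordb x b sig n 0 (comp_const n C M) (chi \o f).
Proof.
move=> b0 s01 C0 M0; elim: n chi => [|n IH] chi schi sf Hchi Hf.
  move=> s; rewrite leqn0 size_eq0 => /eqP -> /=.
  by rewrite expr0 !mulr1; exact: (Hchi [::]).
move=> s; case/lastP: s => [|s i].
  move=> _ /=; rewrite sub0n !expr0 !mulr1.
  exact (le_trans (Hchi [::] isT) (comp_const_ge n.+1 C0 M0)).
rewrite size_rcons ltnS sub0n expr0 mulr1 => sn; rewrite Dseq_rcons pd_comp//.
have H1 : ordb x b sig n 0 (comp_const n C M) (pd dir1 tt chi \o f).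
  apply: IH => //; first exact: sm_pd.
    by move=> t tn; rewrite -Dseq_rcons; apply: Hchi; rewrite size_rcons.
  by move=> t /andP[t0 tn]; apply: Hf; rewrite t0 ltnW// ltnS.
have H2 : ordb x b sig n 0 (C * b) (pd e i f).
  move=> t tn; rewrite -Dseq_rcons sub0n expr0 mulr1.
  apply: (le_trans (Hf _ _)); first by rewrite size_rcons.
  by rewrite size_rcons exprS mulrA.
have := @ordbM x b sig n 0 0 _ _ _ _ b0 s01 (comp_const_ge0 n C0 M0) (mulr_ge0 C0 b0)
   (sm_comp (sm_pd tt schi) sf) (sm_pd i sf) H1 H2 s sn.
rewrite addn0 sub0n expr0 mulr1 => /le_trans; apply.
rewrite /= exprS mulrDl ler_wpDl ?mulr_ge0 ?exprn_ge0//.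
by rewrite !mulrA.
Qed.

End order_calculus.

(** * Radial cutoffs *)

Section cutoff.
Context {R : realType} {d : nat}.
Local Notation E := 'rV[R]_d.
Implicit Types (x : E) (r rho : R) (i j : 'I_d).

Definition sqdist x0 x : R := \sum_(i < d) (x ord0 i - x0 ord0 i) ^+ 2.

Let c x0 i : E -> R := (fun x : E => x ord0 i) - cst (x0 ord0 i).

Let sm_c x0 i : sm dirs (c x0 i).
Proof. by apply: smB; [exact: sm_coord|exact: sm_cst]. Qed.

Let pd_c x0 i j : pd dirs i (c x0 j) = cst (i == j)%:R.
Proof.
rewrite /c; have -> : (fun x : E => x ord0 j) - cst (x0 ord0 j) =
    (fun x : E => x ord0 j) + cst (- x0 ord0 j).
  by apply/funext => x; rewrite !fctE.
rewrite pdD; [|exact: sm_coord|exact: sm_cst].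
by rewrite pd_coord pd_cst; apply/funext => x; rewrite !fctE addr0.
Qed.

Lemma sqdistE x0 : sqdist x0 = \sum_i (c x0 i * c x0 i).
Proof. by apply/funext => x; rewrite fct_sumE. Qed.

Lemma sm_sqdist x0 : sm dirs (sqdist x0).
Proof. by rewrite sqdistE; apply: sm_sum => i _; exact: smM. Qed.

Lemma pd_sqdist x0 i : pd dirs i (sqdist x0) = cst 2 * c x0 i.
Proof.
rewrite sqdistE.
have -> : pd dirs i (\sum_j (c x0 j * c x0 j)) = \sum_j pd dirs i (c x0 j * c x0 j).
  by apply: (@Dseq_sum _ _ _ dirs [:: i]) => j _; exact: smM.
apply/funext => x; rewrite fct_sumE (bigD1 i)//= big1 ?addr0.
  by rewrite pdM// pd_c eqxx !fctE /cst/=; ring.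
move=> j ji; rewrite pdM// pd_c eq_sym (negbTE ji) !fctE /cst/=; ring.
Qed.

Lemma Dseq_sqdist x0 s x (rho : R) : 0 <= rho -> sqdist x0 x <= rho ^+ 2 ->
  (0 < size s)%N ->
  `|Dseq dirs s (sqdist x0) x| <= if size s is 1%N then 2 * rho else
    if size s is 2%N then 2 else 0.
Proof.
move=> rho0 xr; case/lastP: s => // s i _; rewrite Dseq_rcons pd_sqdist.
have ci : `|c x0 i x| <= rho.
  rewrite -[leRHS]ger0_norm// -ler_sqr ?nnegrE// !real_normK ?num_real//.
  apply: le_trans xr; rewrite /sqdist (bigD1 i)//=.
  by rewrite lerDl sumr_ge0// => k _; exact: sqr_ge0.
case/lastP: s => [|s j] /=.
  rewrite !fctE /cst/= normrM ger0_norm//.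
  by rewrite ler_pM2l.
rewrite Dseq_rcons pdM//; last exact: sm_cst.
rewrite pd_c pd_cst !size_rcons.
rewrite (_ : _ + _ = cst (2 * (j == i)%:R)); last first.
  by apply/funext => y; rewrite !fctE /cst/= mulr0 addr0.
case: s => [|k s] /=; last by rewrite -[pd dirs k _]/(Dseq dirs (k :: s) (cst (2 * (j == i)%:R))) Dseq_cst// /cst normr0.
by rewrite ger0_norm ?mulr_ge0// ler_piMr//; case: (_ == _).
Qed.

Lemma compact_sqdist x0 (A : R) : compact [set x | sqdist x0 x <= A].
Proof.
apply: (@subclosed_compact _ _ (cbox x0 (1 + A))).
- rewrite (_ : [set x | _] = sqdist x0 @^-1` [set t | t <= A]).
    apply: closed_comp; last exact: closed_le.
    by move=> x _; exact: (sm_cont (sm_sqdist x0)).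
  by [].
- exact: compact_cbox.
- move=> x /= xA i.
  have : (x ord0 i - x0 ord0 i) ^+ 2 <= A.
    apply: le_trans xA; rewrite /sqdist (bigD1 i)//=.
    by rewrite lerDl sumr_ge0// => k _; exact: sqr_ge0.
  rewrite -real_normK ?num_real//; set t := `|_|.
  have t0 : 0 <= t by exact: normr_ge0.
  by have := sqr_ge0 (t - 1); nra.
Qed.

(** The step is composed with an affine function of the squared distance that is [1]
    at distance [r] and [-1] at distance [rho], so that [theta] vanishes already
    before the sphere of radius [rho] is reached. *)
Definition theta x0 r rho : E -> R :=
  step \o (cst ((rho ^+ 2 *+ 2) / (rho ^+ 2 - r ^+ 2) - 1) -
           cst (2 / (rho ^+ 2 - r ^+ 2)) * sqdist x0).

Lemma sm_theta x0 r rho : sm dirs (theta x0 r rho).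
Proof.
apply: sm_comp; first exact: sm_step.
apply: smB; first exact: sm_cst.
by apply: smM; [exact: sm_cst|exact: sm_sqdist].
Qed.

Lemma thetaE x0 r rho x : theta x0 r rho x =
  step ((rho ^+ 2 *+ 2) / (rho ^+ 2 - r ^+ 2) - 1 -
           2 / (rho ^+ 2 - r ^+ 2) * sqdist x0 x).
Proof. by []. Qed.

Section bounds.
Variables (x0 : E) (r rho : R).
Hypotheses (r0 : 0 < r) (rrho : r < rho).

Let den_gt0 : 0 < rho ^+ 2 - r ^+ 2.
Proof. by rewrite subr_gt0 ltr_pXn2r ?nnegrE ?(ltW r0)// (ltW (lt_trans r0 rrho)). Qed.

Lemma theta_eq1 x : sqdist x0 x <= r ^+ 2 -> theta x0 r rho x = 1.
Proof.
move=> xr; rewrite thetaE; apply: step_eq1.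
rewrite [leRHS](_ : _ = (rho ^+ 2 - sqdist x0 x) * 2 / (rho ^+ 2 - r ^+ 2) - 1); last first.
  by rewrite mulr2n; ring.
rewrite lerBrDr ler_pdivlMr//; lra.
Qed.

Lemma theta_eq0 x : (rho ^+ 2 + r ^+ 2) / 2 <= sqdist x0 x -> theta x0 r rho x = 0.
Proof.
move=> xr; rewrite thetaE; apply: step_eq0.
rewrite [leLHS](_ : _ = (rho ^+ 2 - sqdist x0 x) * 2 / (rho ^+ 2 - r ^+ 2) - 1); last first.
  by rewrite mulr2n; ring.
rewrite subr_le0 ler_pdivrMr//; move: xr; rewrite ler_pdivrMr//; lra.
Qed.

Definition theta_supp : set E := [set x | sqdist x0 x <= (rho ^+ 2 + r ^+ 2) / 2].

Lemma theta_supp_compact : compact theta_supp.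
Proof. exact: compact_sqdist. Qed.

Lemma theta_supp_sub : theta_supp `<=` eball x0 rho.
Proof.
move=> x /= xr; rewrite /eball/=; apply: (le_lt_trans xr).
rewrite ltr_pdivrMr//; move: den_gt0; lra.
Qed.

Lemma theta_out x : ~ theta_supp x -> theta x0 r rho x = 0.
Proof. by move=> /negP; rewrite -ltNge => /ltW; exact: theta_eq0. Qed.

Lemma theta_ge0 x : 0 <= theta x0 r rho x. Proof. exact: step_ge0. Qed.
Lemma theta_le1 x : theta x0 r rho x <= 1. Proof. exact: step_le1. Qed.

(** Only the first two derivatives of the squared distance are nonzero; on the
    ball of radius [rho], divided by [rho^2 - r^2 = (rho - r)(rho + r)], they are
    [O(b)] and [O(b^2)]. *)
Lemma theta_ordb m M x sig : 0 <= M -> 0 <= sig <= 1 ->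
  (forall (t : seq unit) y, (size t <= m)%N -> `|Dseq dir1 t step y| <= M) ->
  ordb dirs x ((rho - r)^-1) sig m 0 (comp_const m 4 M) (theta x0 r rho).
Proof.
move=> M0 s01 HM.
have b0 : 0 <= (rho - r)^-1 by rewrite invr_ge0 subr_ge0 ltW.
have [xK|xK] := pselect (theta_supp x); last first.
  move=> s sn; have cT : closed theta_supp by apply: compact_closed => //; exact: theta_supp_compact.
  rewrite (Dseq_out dirs s cT theta_out xK) normr0.
  have s0 : 0 <= sig by case/andP : s01.
  by rewrite !mulr_ge0 ?exprn_ge0// comp_const_ge0.
apply: ordb_comp => //.
- exact: sm_step.
- apply: smB; first exact: sm_cst.
  by apply: smM; [exact: sm_cst|exact: sm_sqdist].
- by move=> t tm; exact: HM.
move=> s /andP[s0 sn].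
set B := 2 / _; set A := _ - 1.
have B0 : 0 < B by rewrite divr_gt0.
have -> : Dseq dirs s (cst A - cst B * sqdist x0) x = - (B * Dseq dirs s (sqdist x0) x).
  have -> : cst A - cst B * sqdist x0 = cst A + cst (- B) * sqdist x0.
    by apply/funext => y; rewrite !fctE /cst/= mulNr.
  rewrite DseqD; [|exact: sm_cst|by apply: smM; [exact: sm_cst|exact: sm_sqdist]].
  rewrite Dseq_cst// fctE /cst/= add0r.
  elim: {s0 sn} s x {xK} => [|i s IH] x /=.
    by rewrite fctE mulNr.
  rewrite /pd.
  have -> : Dseq dirs s (cst (- B) * sqdist x0) = cst (- B) * Dseq dirs s (sqdist x0).
    by apply/funext => y; rewrite IH fctE /cst/= mulNr.
  rewrite deriveM; [|exact: derivable_cst|].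
    by rewrite derive_cst scaler0 addr0 /GRing.scale/= mulNr.
  by apply: sm_derivable; apply: sm_Dseq; exact: sm_sqdist.
rewrite normrN normrM gtr0_norm//.
have rho0 : 0 < rho by exact: lt_trans rrho.
have xrho : sqdist x0 x <= rho ^+ 2 by exact/ltW/(theta_supp_sub xK).
have D0 : 0 < rho - r by rewrite subr_gt0.
have rr : rho ^+ 2 - r ^+ 2 = (rho - r) * (rho + r) by rewrite -subr_sqr.
apply: (le_trans (ler_wpM2l (ltW B0) (Dseq_sqdist (ltW rho0) xrho s0))).
have S0 : 0 < rho + r by rewrite addr_gt0.
have Dn0 : rho - r != 0 by rewrite gt_eqF.
have Sn0 : rho + r != 0 by rewrite gt_eqF.
case: (size s) s0 => [//|[|[|k]]] _.
- rewrite /B rr [leLHS](_ : _ = 4 * (rho - r)^-1 ^+ 1 * (rho / (rho + r))).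
    by rewrite ler_piMr ?mulr_ge0 ?exprn_ge0// ler_pdivrMr// mul1r lerDl ltW.
  by rewrite invfM expr1; ring.
- rewrite /B rr [leLHS](_ : _ = 4 * (rho - r)^-1 ^+ 2 * ((rho - r) / (rho + r))).
    have h2 : (rho - r) / (rho + r) <= 1.
      by rewrite ler_pdivrMr// mul1r lerD2l (@le_trans _ _ 0)// ?oppr_le0 ltW.
    by rewrite ler_piMr ?mulr_ge0 ?exprn_ge0.
  by field; rewrite Dn0 Sn0.
- by rewrite mulr0 mulr_ge0// exprn_ge0.
Qed.

End bounds.

End cutoff.

(** * Flat cutoffs and Leibniz remainders *)

Lemma flat_exponents m a b : (a + b <= m)%N ->
  ((m.+1 - a) + (m.+1 - b) = m.+1 + (m.+1 - (a + b)))%N.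
Proof. by lia. Qed.

Section flattened_cutoff.
Context {R : realType} {V : normedModType R} {I : eqType} (e : I -> V).
Variables (m : nat) (th : V -> R).
Hypotheses (sth : sm e th) (th01 : forall x, 0 <= th x <= 1).

(** Flat to order [m] at both ends: a multiple of [theta^(m+1)] near [theta = 0],
    and [1] minus a multiple of [(1 - theta)^(m+1)] near [theta = 1]. *)
Definition psi : V -> R := cst 1 - (cst 1 - th ^+ m.+1) ^+ m.+1.
Definition zeta : V -> R := th * (cst 1 - th).

Lemma sm_psi : sm e psi.
Proof.
apply: smB; first exact: sm_cst.
by apply: smX; apply: smB; [exact: sm_cst|exact: smX].
Qed.

Lemma sm_zeta : sm e zeta.
Proof. by apply: smM => //; apply: smB => //; exact: sm_cst. Qed.

Lemma psiE x : psi x = 1 - (1 - th x ^+ m.+1) ^+ m.+1.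
Proof. by rewrite /psi !(fctE, exprfctE). Qed.

Lemma zetaE x : zeta x = th x * (1 - th x). Proof. by []. Qed.

Lemma thX01 k x : 0 <= th x ^+ k <= 1.
Proof. by have /andP[t0 t1] := th01 x; rewrite exprn_ge0//= exprn_ile1. Qed.

Lemma psi01 x : 0 <= psi x <= 1.
Proof.
have /andP[t0 t1] := thX01 m.+1 x; rewrite psiE.
have : 0 <= (1 - th x ^+ m.+1) ^+ m.+1 <= 1.
  by rewrite exprn_ge0 ?subr_ge0//= exprn_ile1 ?subr_ge0// gerBl.
by move=> /andP[? ?]; rewrite subr_ge0 gerBl; apply/andP.
Qed.

Lemma zeta01 x : 0 <= zeta x <= 1.
Proof.
have /andP[t0 t1] := th01 x; rewrite zetaE mulr_ge0 ?subr_ge0//=.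
by rewrite mulr_ile1 ?subr_ge0// gerBl.
Qed.

Lemma psi_ge x : th x ^+ m.+1 <= psi x.
Proof.
have /andP[t0 t1] := thX01 m.+1 x; rewrite psiE lerBrDr -lerBrDl.
by rewrite exprS ler_piMr ?subr_ge0// exprn_ile1 ?subr_ge0// gerBl.
Qed.

Lemma zeta_le x : zeta x <= th x.
Proof.
by have /andP[t0 t1] := th01 x; rewrite zetaE ler_piMr// gerBl.
Qed.

Lemma psi_eq1 x : th x = 1 -> psi x = 1.
Proof. by move=> t1; rewrite psiE t1 expr1n subrr expr0n subr0. Qed.

Lemma psi_eq0 x : th x = 0 -> psi x = 0.
Proof. by move=> t0; rewrite psiE t0 expr0n subr0 expr1n subrr. Qed.

(** The sum of the constants of the two estimates of [psi] below, one from each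
    end. *)
Definition flat_const (C : R) :=
  (2 ^+ m * (2 ^+ m * (1 + C) * \sum_(i < m.+1) (2 ^+ m * C) ^+ i)) ^+ m.+1 +
  2 ^+ m * (2 ^+ m * (1 + C)) ^+ m.+1 *
     \sum_(i < m.+1) (2 ^+ m * (1 + (2 ^+ m * C) ^+ m.+1)) ^+ i.

Section at_a_point.
Variables (x : V) (b C : R).
Hypotheses (b0 : 0 <= b) (C0 : 0 <= C)
  (oth : forall s, (size s <= m)%N -> `|Dseq e s th x| <= C * b ^+ size s).

Let t0 : 0 <= th x. Proof. by case/andP : (th01 x). Qed.
Let t1 : th x <= 1. Proof. by case/andP : (th01 x). Qed.

Let oth0 sig : ordb e x b sig m 0 C th.
Proof. by move=> s sn; rewrite sub0n expr0 mulr1 oth. Qed.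

Let oth1 : ordb e x b (th x) m 1 (1 + C) th.
Proof.
move=> [|i s] sn.
  by rewrite /= expr0 expr1 mulr1 ger0_norm// ler_peMl// lerDl.
rewrite (_ : (1 - size (i :: s))%N = 0%N)// expr0 mulr1.
apply: (le_trans (oth sn)); by rewrite ler_wpM2r ?exprn_ge0// lerDr.
Qed.

Let oth1' : ordb e x b (1 - th x) m 1 (1 + C) (cst 1 - th).
Proof.
have t10 : 0 <= 1 - th x by rewrite subr_ge0.
move=> [|i s] sn.
  by rewrite /= expr0 expr1 mulr1 !fctE /cst/= ger0_norm// ler_peMl// lerDl.
rewrite (_ : (1 - size (i :: s))%N = 0%N)// expr0 mulr1.
rewrite Dseq_onem// normrN.
apply: (le_trans (oth sn)); by rewrite ler_wpM2r ?exprn_ge0// lerDr.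
Qed.

Let s01 : 0 <= th x <= 1 := th01 x.
Let s01' : 0 <= 1 - th x <= 1.
Proof. by rewrite subr_ge0 t1/= gerBl. Qed.
Let C1 : 0 <= 1 + C. Proof. by rewrite addr_ge0. Qed.
Let two_m : 0 <= 2 ^+ m :> R. Proof. by rewrite exprn_ge0. Qed.

Let geom (f : V -> R) : cst 1 - f ^+ m.+1 = (cst 1 - f) * \sum_(i < m.+1) f ^+ i.
Proof.
apply/funext => y; rewrite !(fctE, exprfctE, fct_sumE) /cst/=.
under [X in _ = _ * X]eq_bigr do rewrite exprfctE.
by rewrite -opprB subrX1 -mulNr opprB.
Qed.

Let opsi_th : ordb e x b (th x) m m.+1
  (2 ^+ m * (2 ^+ m * (1 + C)) ^+ m.+1 *
     \sum_(i < m.+1) (2 ^+ m * (1 + (2 ^+ m * C) ^+ m.+1)) ^+ i) psi.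
Proof.
have -> : psi = th ^+ m.+1 * \sum_(i < m.+1) (cst 1 - th ^+ m.+1) ^+ i.
  rewrite /psi geom; congr (_ * _).
  by apply/funext => y; rewrite !(fctE, exprfctE) /cst/= opprB addrC subrK.
have sX : sm e (th ^+ m.+1) by exact: smX.
have s1X : sm e (cst 1 - th ^+ m.+1) by apply: smB => //; exact: sm_cst.
have Xge0 : 0 <= (2 ^+ m * C) ^+ m.+1 by rewrite exprn_ge0// mulr_ge0.
have o1X : ordb e x b (th x) m 0 (1 + (2 ^+ m * C) ^+ m.+1) (cst 1 - th ^+ m.+1).
  apply: ordb_onem => //.
  by have := ordbX m.+1 b0 s01 C0 sth (oth0 (th x)); rewrite muln0.
have := @ordbM _ _ _ e x b (th x) m m.+1 0 _ _ _ _ b0 s01 _ _ sX _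
  _ (@ordb_sum _ _ _ e x b (th x) m 0 _ (index_enum 'I_m.+1) _ (fun i => (cst 1 - th ^+ m.+1) ^+ i) _ _).
rewrite addn0; apply.
- by rewrite exprn_ge0// mulr_ge0.
- by rewrite sumr_ge0// => i _; rewrite exprn_ge0// mulr_ge0// addr_ge0.
- by apply: sm_sum => i _; exact: smX.
- by have := ordbX m.+1 b0 s01 C1 sth oth1; rewrite muln1.
- by move=> i; exact: smX.
- move=> i; have := ordbX i b0 s01 (addr_ge0 ler01 Xge0) s1X o1X.
  by rewrite muln0.
Qed.

Let opsi_1th s : (0 < size s <= m)%N -> `|Dseq e s psi x| <=
  (2 ^+ m * (2 ^+ m * (1 + C) * \sum_(i < m.+1) (2 ^+ m * C) ^+ i)) ^+ m.+1 *
  b ^+ size s * (1 - th x) ^+ (m.+1 - size s).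
Proof.
move=> /andP[s0 sn].
pose g := (cst 1 - th) * \sum_(i < m.+1) th ^+ i.
have ss : sm e (\sum_(i < m.+1) th ^+ i) by apply: sm_sum => i _; exact: smX.
have s1 : sm e (cst 1 - th) by apply: smB => //; exact: sm_cst.
have sg : sm e g by exact: smM.
have Sge0 : 0 <= \sum_(i < m.+1) (2 ^+ m * C) ^+ i.
  by rewrite sumr_ge0// => i _; rewrite exprn_ge0// mulr_ge0.
have og : ordb e x b (1 - th x) m 1 (2 ^+ m * (1 + C) * \sum_(i < m.+1) (2 ^+ m * C) ^+ i) g.
  have := @ordbM _ _ _ e x b (1 - th x) m 1 0 _ _ _ _ b0 s01' C1 Sge0 s1 ss oth1'.
  rewrite addn0; apply; apply: ordb_sum => i; first exact: smX.
  by have := ordbX i b0 s01' C0 sth (oth0 (1 - th x)); rewrite muln0.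
have K0 : 0 <= 2 ^+ m * (1 + C) * \sum_(i < m.+1) (2 ^+ m * C) ^+ i by rewrite !mulr_ge0.
have := ordbX m.+1 b0 s01' K0 sg og sn; rewrite muln1 => H.
apply: le_trans H; rewrite /psi [cst 1 - th ^+ _]geom -/g.
by rewrite Dseq_onem ?normrN//; exact: smX.
Qed.

Let flat_const_parts : 0 <= (2 ^+ m * (2 ^+ m * (1 + C) * \sum_(i < m.+1) (2 ^+ m * C) ^+ i)) ^+ m.+1
  /\ 0 <= 2 ^+ m * (2 ^+ m * (1 + C)) ^+ m.+1 *
     \sum_(i < m.+1) (2 ^+ m * (1 + (2 ^+ m * C) ^+ m.+1)) ^+ i.
Proof.
have S0 (a : R) : 0 <= a -> 0 <= \sum_(i < m.+1) a ^+ i.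
  by move=> a0; rewrite sumr_ge0// => i _; rewrite exprn_ge0.
have two_C : 0 <= 2 ^+ m * C by rewrite mulr_ge0.
split; first by rewrite exprn_ge0// !mulr_ge0// S0.
rewrite !mulr_ge0//; first by rewrite exprn_ge0// mulr_ge0.
by rewrite S0// mulr_ge0// addr_ge0// exprn_ge0.
Qed.

Lemma flat_const_ge0 : 0 <= flat_const C.
Proof. by have [? ?] := flat_const_parts; rewrite addr_ge0. Qed.

(** Vanishing to order [m+1] in [theta] is used where [theta <= 1/2], vanishing in
    [1 - theta] where [theta >= 1/2]; on either side the vanishing quantity is at
    most twice [zeta]. *)
Lemma psi_deriv s : (0 < size s <= m)%N -> `|Dseq e s psi x| <=
  (flat_const C * 2 ^+ m.+1) * b ^+ size s * zeta x ^+ (m.+1 - size s).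
Proof.
move=> sm1; have /andP[s0 sn] := sm1.
have [K1 K2] := flat_const_parts.
have z0 : 0 <= zeta x by have /andP[] := zeta01 x.
set k := (m.+1 - size s)%N.
have two_k : 2 ^+ k <= 2 ^+ m.+1 :> R by rewrite ler_weXn2l ?ler1n// /k leq_subr.
have concl (K t : R) : 0 <= K -> K <= flat_const C -> 0 <= t -> t <= 2 * zeta x ->
    K * b ^+ size s * t ^+ k <= (flat_const C * 2 ^+ m.+1) * b ^+ size s * zeta x ^+ k.
  move=> K0 KC t0' tz.
  apply: (@le_trans _ _ (flat_const C * b ^+ size s * (2 * zeta x) ^+ k)).
    apply: ler_pM; rewrite ?mulr_ge0 ?exprn_ge0//.
      by rewrite ler_wpM2r ?exprn_ge0.
    have z2 : 0 <= 2 * zeta x by exact: mulr_ge0 _ z0.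
    by apply: lerXn2r; rewrite ?nnegrE.
  rewrite exprMn [leRHS](_ : _ = flat_const C * b ^+ size s * (2 ^+ m.+1 * zeta x ^+ k)); last by ring.
  rewrite ler_wpM2l ?mulr_ge0 ?exprn_ge0 ?flat_const_ge0//.
  by rewrite ler_wpM2r ?exprn_ge0.
have [th12|th12] := leP (th x) (1 / 2).
- apply: (le_trans (opsi_th sn)); apply: concl => //; first by rewrite lerDr.
  have h : 0 <= th x * (1 - 2 * th x) by rewrite mulr_ge0//; move: th12; lra.
  rewrite zetaE; move: h; lra.
- apply: (le_trans (opsi_1th sm1)); apply: concl => //; first by rewrite lerDl.
    by rewrite subr_ge0.
  have h : 0 <= (1 - th x) * (2 * th x - 1).
    by rewrite mulr_ge0 ?subr_ge0//; move: th12; lra.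
  rewrite zetaE; move: h; lra.
Qed.

(** In the Leibniz sum, either one factor [psi] is not differentiated, or the two
    powers of [zeta] multiply to [zeta^(m+1)] times the claimed power, and
    [zeta^(m+1) <= psi]. *)
Lemma psi2_deriv s : (0 < size s <= m)%N -> `|Dseq e s (psi * psi) x| <=
  (2 ^+ m * (flat_const C * 2 ^+ m.+1 + (flat_const C * 2 ^+ m.+1) ^+ 2) * psi x) *
  b ^+ size s * zeta x ^+ (m.+1 - size s).
Proof.
set K := flat_const C * 2 ^+ m.+1; move=> /andP[s0 sn].
have K0 : 0 <= K by rewrite mulr_ge0 ?exprn_ge0// flat_const_ge0.
have /andP[p0 p1] := psi01 x; have /andP[z0 z1] := zeta01 x.
have zp : zeta x ^+ m.+1 <= psi x.
  by apply: le_trans (psi_ge x); apply: lerXn2r; rewrite ?nnegrE ?zeta_le//.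
have sp := sm_psi.
rewrite DseqM//; apply: (le_trans (ler_norm_sum _ _ _)).
set z := zeta x ^+ _.
have z'0 : 0 <= z by rewrite exprn_ge0.
have bs0 k : 0 <= b ^+ k by rewrite exprn_ge0.
apply: (@le_trans _ _ (\sum_(i <- splits s) (K + K ^+ 2) * psi x * b ^+ size s * z)).
  rewrite big_seq [leRHS]big_seq; apply: ler_sum => -[q1 q2] /splits_size /= qs.
  rewrite normrM; case: q1 qs => [|i1 q1] qs.
    have E2 : size q2 = size s by rewrite -qs.
    rewrite [`|Dseq e [::] _ _|]ger0_norm//=.
    have := @psi_deriv q2; rewrite E2 s0 sn => /(_ isT); rewrite -/K -/z => H.
    apply: (le_trans (ler_wpM2l p0 H)).
    rewrite [leLHS](_ : _ = K * psi x * b ^+ size s * z); last by ring.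
    by rewrite ler_wpM2r// ler_wpM2r// ler_wpM2r// lerDl sqr_ge0.
  case: q2 qs => [|i2 q2] qs.
    have E1 : size (i1 :: q1) = size s by rewrite -qs addn0.
    rewrite [X in _ * X]ger0_norm//=.
    have := @psi_deriv (i1 :: q1); rewrite E1 s0 sn => /(_ isT); rewrite -/K -/z => H.
    apply: (le_trans (ler_wpM2r p0 H)).
    rewrite [leLHS](_ : _ = K * psi x * b ^+ size s * z); last by ring.
    by rewrite ler_wpM2r// ler_wpM2r// ler_wpM2r// lerDl sqr_ge0.
  have h1 : (0 < size (i1 :: q1) <= m)%N by rewrite /= (leq_trans _ sn)// -qs leq_addr.
  have h2 : (0 < size (i2 :: q2) <= m)%N by rewrite /= (leq_trans _ sn)// -qs leq_addl.
  have := ler_pM (normr_ge0 _) (normr_ge0 _) (psi_deriv h1) (psi_deriv h2).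
  rewrite -/K => /le_trans; apply.
  rewrite [leLHS](_ : _ = K ^+ 2 * b ^+ size s *
     (zeta x ^+ (m.+1 - size (i1 :: q1)) * zeta x ^+ (m.+1 - size (i2 :: q2)))); last first.
    by rewrite -qs exprD; ring.
  have E : (zeta x ^+ (m.+1 - size (i1 :: q1)) * zeta x ^+ (m.+1 - size (i2 :: q2))) =
      zeta x ^+ m.+1 * z.
    have E2 : ((m.+1 - size (i1 :: q1)) + (m.+1 - size (i2 :: q2)) =
       m.+1 + (m.+1 - size s))%N.
      by move: sn; rewrite -qs; exact: flat_exponents.
    by rewrite /z -[LHS]exprD -[RHS]exprD E2.
  rewrite E.
  rewrite [leRHS](_ : _ = (K + K ^+ 2) * b ^+ size s * (psi x * z)); last by ring.
  have Kb0 : 0 <= K ^+ 2 * b ^+ size s by rewrite mulr_ge0 ?sqr_ge0.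
  have zz0 : 0 <= zeta x ^+ m.+1 * z by exact: mulr_ge0 (exprn_ge0 _ z0) z'0.
  have i1' : K ^+ 2 * b ^+ size s <= (K + K ^+ 2) * b ^+ size s by rewrite ler_wpM2r// lerDr.
  have i2' : zeta x ^+ m.+1 * z <= psi x * z by exact: ler_wpM2r.
  exact: ler_pM Kb0 zz0 i1' i2'.
rewrite sum_const_seq size_splits -[leLHS]mulr_natl natrX !mulrA.
do 3 (rewrite ler_wpM2r//).
rewrite ler_wpM2r// ?addr_ge0 ?sqr_ge0//.
by rewrite ler_weXn2l ?ler1n.
Qed.

End at_a_point.
End flattened_cutoff.

Section leibniz_remainder.
Context {R : realType} {V : normedModType R} {I : finType} (e : I -> V).

Definition gradsq k (f : V -> R) (x : V) : R :=
  \sum_(t : k.-tuple I) (Dseq e t f x) ^+ 2.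

(** The weights are those that [weighted_interpolation] handles. *)
Definition lower_order m (b z : R) (f : V -> R) (x : V) : R :=
  \sum_(k < m) b ^+ (2 * (m - k)) * z ^+ (2 * k.+1) * gradsq k f x.

Lemma gradsq_ge0 k f x : 0 <= gradsq k f x.
Proof. by apply: sumr_ge0 => t _; exact: sqr_ge0. Qed.

Lemma lower_order_ge0 m b z f x : 0 <= b -> 0 <= z -> 0 <= lower_order m b z f x.
Proof.
move=> b0 z0; apply: sumr_ge0 => k _.
by rewrite !mulr_ge0 ?exprn_ge0// gradsq_ge0.
Qed.

Lemma le_gradsq s f x : Dseq e s f x ^+ 2 <= gradsq (size s) f x.
Proof.
rewrite /gradsq (bigD1 (in_tuple s))//= lerDl.
by apply: sumr_ge0 => t _; exact: sqr_ge0.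
Qed.

Lemma sum_splits_nil s (F : seq I * seq I -> R) :
  \sum_(q <- splits s | size q.1 == 0%N) F q = F ([::], s).
Proof.
elim: s F => [|i s IH] F /=; first by rewrite big_cons big_nil /= addr0.
by rewrite big_cat !big_map /= big_pred0// add0r (IH (fun q => F (q.1, i :: q.2))).
Qed.

(** Each term of the remainder has at least one derivative on [g], so at most [m - 1]
    on [f]. *)
Lemma leibniz_remainder m (g f : V -> R) x (b z K : R) s :
  0 <= b -> 0 <= z -> 0 <= K -> sm e g -> sm e f -> size s = m ->
  (forall t, (0 < size t <= m)%N ->
    `|Dseq e t g x| <= K * b ^+ size t * z ^+ (m.+1 - size t)) ->
  (Dseq e s (g * f) x - g x * Dseq e s f x) ^+ 2 <=
    (2 ^+ m * K) ^+ 2 * lower_order m b z f x.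
Proof.
move=> b0 z0 K0 sg sf sm_ Hg.
have W0 := lower_order_ge0 m f x b0 z0; set W := lower_order _ _ _ _ _ in W0 *.
have -> : Dseq e s (g * f) x - g x * Dseq e s f x =
   \sum_(q <- splits s | (size q.1 != 0)%N) Dseq e q.1 g x * Dseq e q.2 f x.
  rewrite DseqM// (bigID (fun q => (size q.1 == 0)%N))/=.
  by rewrite (sum_splits_nil s (fun q => Dseq e q.1 g x * Dseq e q.2 f x)) /= addrAC subrr add0r.
rewrite -[leLHS]real_normK ?num_real// -[W in leRHS]sqr_sqrtr// -exprMn.
have sW0 : 0 <= Num.sqrt W by exact: sqrtr_ge0.
apply: lerXn2r; rewrite ?nnegrE ?mulr_ge0 ?exprn_ge0//.
apply: (le_trans (ler_norm_sum _ _ _)).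
apply: (@le_trans _ _ (\sum_(q <- splits s) K * Num.sqrt W)); last first.
  by rewrite sum_const_seq size_splits -[leLHS]mulr_natl natrX sm_ mulrA.
rewrite big_mkcond big_seq [leRHS]big_seq; apply: ler_sum => q /splits_size qs.
case: ifPn => [q1|_]; last by rewrite mulr_ge0.
have q1m : (0 < size q.1 <= m)%N by rewrite lt0n q1 -sm_ -qs leq_addr.
have q2m : (size q.2 < m)%N by move: q1m; rewrite -sm_ -qs; lia.
rewrite normrM; apply: (le_trans (ler_wpM2r (normr_ge0 _) (Hg _ q1m))).
rewrite -!mulrA; apply: ler_wpM2l => //.
rewrite -[leLHS]ger0_norm; last by rewrite !mulr_ge0 ?exprn_ge0.
rewrite -sqrtr_sqr; apply: ler_wsqrtr.
rewrite !exprMn real_normK ?num_real// -!exprM.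
rewrite /W /lower_order (bigD1 (Ordinal q2m))//=.
apply: ler_wpDr.
  by apply: sumr_ge0 => k _; rewrite !mulr_ge0 ?exprn_ge0// gradsq_ge0.
rewrite [(size q.1 * 2)%N](_ : _ = 2 * (m - size q.2))%N; last by rewrite -sm_ -qs addnK mulnC.
rewrite [((m.+1 - _) * 2)%N](_ : _ = 2 * (size q.2).+1)%N; last by rewrite -sm_ -qs -addnS addKn mulnC.
by rewrite mulrA ler_wpM2l ?le_gradsq// mulr_ge0 ?exprn_ge0.
Qed.

End leibniz_remainder.

(** * Dominated convergence and integrability *)

Lemma cvg_sum_seq (R : realType) J (r : seq J) (F : J -> nat -> R) (l : J -> R) :
  (forall j, F j @ \oo --> l j) ->
  (fun n => \sum_(j <- r) F j n) @ \oo --> \sum_(j <- r) l j.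
Proof.
move=> Fl; elim: r => [|j r IH].
  by rewrite big_nil; under eq_fun do rewrite big_nil; exact: cvg_cst.
rewrite big_cons; under eq_fun do rewrite big_cons.
exact: cvgD (Fl j) IH.
Qed.

Section dominated.
Context d (T : measurableType d) (R : realType) (mu : {measure set T -> \bar R}).

Lemma Rint_dominated (D : set T) (f_ : nat -> T -> R) (f g : T -> R) :
  measurable D -> (forall n, measurable_fun D (f_ n)) -> measurable_fun D f ->
  mu.-integrable D (EFin \o g) ->
  {ae mu, forall x, D x -> f_ ^~ x @ \oo --> f x} ->
  (forall n x, D x -> `|f_ n x| <= g x) ->
  (fun n => \int[mu]_(x in D) f_ n x) @ \oo --> \int[mu]_(x in D) f x.
Proof.
move=> mD mf_ mf ig cv fg.
have ifn n : mu.-integrable D (EFin \o f_ n).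
  apply: (le_integrable mD _ _ ig); first exact/measurable_EFinP.
  move=> x Dx; rewrite lee_fin; apply: (le_trans (fg n x Dx)); exact: ler_norm.
have [fi _ H] : [/\ mu.-integrable D (EFin \o f),
    [sequence \int[mu]_(x in D) (`|(EFin \o f_ n) x - (EFin \o f) x|)]_n%E @ \oo --> 0%E &
    [sequence \int[mu]_(x in D) (EFin \o f_ n) x]_n%E @ \oo -->
      (\int[mu]_(x in D) (EFin \o f) x)%E].
  apply: (@dominated_convergence _ _ _ mu D mD (fun n => EFin \o f_ n) (EFin \o f) (EFin \o g)).
  - by move=> n; exact/measurable_EFinP.
  - exact/measurable_EFinP.
  - apply: filterS cv => x Hx Dx; apply: cvg_EFin; first by apply: nearW.
    exact: Hx.
  - exact: ig.
  - by apply: aeW => x n Dx; rewrite lee_fin; exact: fg.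
rewrite /Rintegral; apply: fine_cvg; rewrite fineK; last exact: integrable_fin_num.
exact: H.
Qed.

Lemma integrable_cstM (D : set T) (k : R) (f : T -> R) : measurable D ->
  mu.-integrable D (EFin \o f) -> mu.-integrable D (EFin \o (fun x => k * f x)).
Proof. by move=> mD fi; exact (integrableZl mD k fi). Qed.

Lemma integrable_add (D : set T) (f g : T -> R) : measurable D ->
  mu.-integrable D (EFin \o f) -> mu.-integrable D (EFin \o g) ->
  mu.-integrable D (EFin \o (fun x => f x + g x)).
Proof. by move=> mD fi gi; exact (integrableD mD fi gi). Qed.

Lemma integrable_sub (D : set T) (f g : T -> R) : measurable D ->
  mu.-integrable D (EFin \o f) -> mu.-integrable D (EFin \o g) ->
  mu.-integrable D (EFin \o (fun x => f x - g x)).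
Proof. by move=> mD fi gi; exact (integrableB mD fi gi). Qed.

Lemma integrable_indic_fin (A : set T) : measurable A -> (mu A < +oo)%E ->
  mu.-integrable setT (EFin \o (\1_A : T -> R)).
Proof.
move=> mA Afin; apply/integrableP; split; first by apply/measurable_EFinP; exact (measurable_indic mA).
rewrite (eq_integral (fun x => (\1_A x)%:E)).
  by rewrite integral_indic// setIT.
by move=> x _ /=; rewrite ger0_norm// indicE.
Qed.

End dominated.

(** * Truncation of functions vanishing to order m off a set *)

Section truncation.
Context {R : realType} {d : nat}.
Local Notation E := 'rV[R]_d.
Local Notation mu := (leb R d).
Local Notation Ds := (Dseq (@dirs R d)).
Variables (m : nat) (Omega : set E) (w : E -> R).
Hypotheses (m0 : (0 < m)%N) (sw : sm dirs w) (ccw : cc w)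
  (w0 : forall s x, (size s < m)%N -> ~ Omega x -> Ds s w x = 0).

Definition weight : nat := (2 * m`!)%N.
(** The exponent is even, and it makes [power k * (m - k)] the same for all
    [k < m]. *)
Definition power (k : nat) : nat := (2 * (m`! %/ (m - k)))%N.

Lemma power_weight k : (k < m)%N -> (power k * (m - k) = weight)%N.
Proof.
move=> km; rewrite /power /weight -mulnA divnK//.
by apply: dvdn_fact; rewrite subn_gt0 km leq_subr.
Qed.

Lemma power_gt0 k : (k < m)%N -> (0 < power k)%N.
Proof.
move=> km; have := power_weight km; case: (power k) => //.
by rewrite mul0n /weight => /esym/eqP; rewrite muln_eq0/= eqn0Ngt fact_gt0.
Qed.

Lemma m_le_weight : (m <= weight)%N.
Proof.
rewrite /weight; apply: (@leq_trans m`!); last by rewrite leq_pmull.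
by case: m m0 => // n _; rewrite factS leq_pmulr// fact_gt0.
Qed.

(** Vanishes exactly where all the derivatives of [w] of order less than [m] do; with
    a derivative of order [k] counted of degree [m - k], it is homogeneous of degree
    [weight]. *)
Definition gauge : E -> R :=
  \sum_(k < m) \sum_(t : k.-tuple 'I_d) (Ds t w) ^+ power k.

Lemma gaugeE x : gauge x = \sum_(k < m) \sum_(t : k.-tuple 'I_d) (Ds t w x) ^+ power k.
Proof.
rewrite /gauge fct_sumE; apply: eq_bigr => k _; rewrite fct_sumE.
by apply: eq_bigr => t _; rewrite exprfctE.
Qed.

Lemma sm_gauge : sm dirs gauge.
Proof. by apply: sm_sum => k _; apply: sm_sum => t _; apply: smX; exact: sm_Dseq. Qed.

Lemma even_power_ge0 (a : R) k : 0 <= a ^+ power k.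
Proof. by rewrite /power exprM exprn_ge0// sqr_ge0. Qed.

Lemma gauge_ge0 x : 0 <= gauge x.
Proof.
by rewrite gaugeE; apply: sumr_ge0 => k _; apply: sumr_ge0 => t _; exact: even_power_ge0.
Qed.

Lemma le_gauge s x : (size s < m)%N -> Ds s w x ^+ power (size s) <= gauge x.
Proof.
move=> sm_; rewrite gaugeE (bigD1 (Ordinal sm_))//= (bigD1 (in_tuple s))//=.
rewrite -addrA lerDl addr_ge0//; last first.
  by apply: sumr_ge0 => k _; apply: sumr_ge0 => t _; exact: even_power_ge0.
by apply: sumr_ge0 => t _; exact: even_power_ge0.
Qed.

(** The weak form of homogeneity that the truncation needs. *)
Lemma gauge_scale s x (tau : R) : (size s < m)%N -> 0 <= tau -> gauge x <= tau ^+ weight ->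
  `|Ds s w x| <= tau ^+ (m - size s).
Proof.
move=> sm_ tau0 Tx.
rewrite -(@ler_pXn2r _ (power (size s))) ?nnegrE ?exprn_ge0// ?power_gt0//.
rewrite -exprM mulnC power_weight//; apply: le_trans Tx.
apply: le_trans (le_gauge x sm_); rewrite /power !exprM.
by rewrite real_normK ?num_real.
Qed.

Lemma gauge_eq0 s x : (size s < m)%N -> gauge x = 0 -> Ds s w x = 0.
Proof.
move=> sm_ T0; apply/eqP; rewrite -normr_le0.
have := @gauge_scale s x 0 sm_ (lexx _).
by rewrite T0 !expr0n subn_eq0 leqNgt sm_ /=; apply; case: eqP.
Qed.

Lemma gauge_out x : ~ Omega x -> gauge x = 0.
Proof.
move=> xO; rewrite gaugeE big1// => k _; rewrite big1// => t _.
rewrite w0 ?size_tuple// expr0n.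
by rewrite eqn0Ngt power_gt0.
Qed.

Lemma Dseq_bound n : exists2 B, 0 <= B & forall s x, (size s <= n)%N -> `|Ds s w x| <= B.
Proof.
have H (k : nat) : exists2 B, 0 <= B & forall s x, size s = k -> `|Ds s w x| <= B.
  have B1 (t : k.-tuple 'I_d) : exists B, forall x, `|Ds t w x| <= B.
    by apply: cc_bounded; exact: cc_pd.
  exists (\sum_(t : k.-tuple 'I_d) sval (cid (B1 t))).
    by apply: sumr_ge0 => t _; case: cid => B /= HB; exact: le_trans (HB 0).
  move=> s x sk.
  have sk' : size s == k by apply/eqP.
  apply: (@le_trans _ _ (sval (cid (B1 (Tuple sk'))))); first by case: cid => B /=; apply.
  rewrite [leRHS](bigD1 (Tuple sk'))//= lerDl.
  by apply: sumr_ge0 => t _; case: cid => B /= HB; exact: le_trans (HB 0).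
pose F k := sval (cid2 (H k)).
have F0 k : 0 <= F k by rewrite /F; case: cid2.
exists (\sum_(k < n.+1) F k); first by apply: sumr_ge0.
move=> s x sn; apply: (@le_trans _ _ (F (size s))); first by rewrite /F; case: cid2 => B ? /= ->.
have sn' : (size s < n.+1)%N by [].
by rewrite (bigD1 (Ordinal sn'))//= lerDl sumr_ge0.
Qed.

(** Vanishes where the gauge is at most [sig^weight], and is [w] where it is at
    least twice that. *)
Definition cut (sig : R) : E -> R :=
  (step \o (cst (sig ^- weight) * gauge - cst 1)) * w.

Lemma cutE sig x : cut sig x = step (sig ^- weight * gauge x - 1) * w x.
Proof. by []. Qed.

Lemma sm_cut sig : sm dirs (cut sig).
Proof.
apply: smM => //; apply: sm_comp; first exact: sm_step.
by apply: smB; [apply: smM; [exact: sm_cst|exact: sm_gauge]|exact: sm_cst].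
Qed.

Lemma cut_supp sig : 0 < sig -> supp_in Omega (cut sig).
Proof.
move=> sig0; have [_ [r wr]] := ccw.
exists (cbox 0 r `&` [set x | sig ^+ weight <= gauge x]); split.
- apply: (@subclosed_compact _ _ (cbox 0 r)) => //.
  + apply: closedI; first by apply: compact_closed => //; exact: compact_cbox.
    rewrite (_ : [set x | _] = gauge @^-1` [set t | sig ^+ weight <= t])//.
    apply: closed_comp; last exact: closed_ge.
    by move=> x _; exact: (sm_cont sm_gauge).
  + exact: compact_cbox.
- move=> x [_ /= xT]; apply: contrapT => /gauge_out xO.
  by move: xT; rewrite xO leNgt exprn_gt0.
- move=> x /not_andP[xr|/negP]; first by rewrite cutE wr ?mulr0.
  rewrite -ltNge => xT; rewrite cutE step_eq0 ?mul0r//.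
  by rewrite subr_le0 mulrC ler_pdivrMr ?exprn_gt0// mul1r ltW.
Qed.

Lemma cut_near sig s x : 0 < sig -> 2 * sig ^+ weight < gauge x ->
  Ds s (cut sig) x = Ds s w x.
Proof.
move=> sig0 Tx; apply: near_Dseq.
have : \forall y \near x, 2 * sig ^+ weight < gauge y.
  have cT : {for x, continuous gauge} by exact: (sm_cont sm_gauge).
  exact: (cvgr_gt _ cT).
apply: filterS => y Ty; rewrite cutE step_eq1 ?mul1r//.
by rewrite lerBrDr mulrC ler_pdivlMr ?exprn_gt0// ltW// (le_lt_trans _ Ty).
Qed.

Lemma cut_near0 sig s x : 0 < sig -> gauge x < sig ^+ weight ->
  Ds s (cut sig) x = 0.
Proof.
move=> sig0 Tx.
rewrite (_ : 0 = Ds s (cst 0) x); last by case: s => [|i s]//; rewrite Dseq_cst.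
apply: near_Dseq.
have : \forall y \near x, gauge y < sig ^+ weight.
  have cT : {for x, continuous gauge} by exact: (sm_cont sm_gauge).
  exact: (cvgr_lt _ cT).
apply: filterS => y Ty; rewrite cutE step_eq0 ?mul0r//.
by rewrite subr_le0 mulrC ler_pdivrMr ?exprn_gt0// mul1r ltW.
Qed.

(** Where the truncation acts, the derivatives of [w] of order [k] are
    [O(sig^(m-k))], and those of the step factor of order [k] are [O(sig^-k)] by
    homogeneity of the gauge; in a derivative of order [m] of the product the
    powers of [sig] cancel. *)
Lemma cut_bounded : exists C, forall sig s x, 0 < sig -> sig <= 1 -> size s = m ->
  `|Ds s (cut sig) x| <= C.
Proof.
have [B B0 HB] := Dseq_bound (m + m).
have [M M0 HM] := @Dseq_step_bounded R m.
pose C1 := 2 ^+ m + B.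
have C10 : 0 <= C1 by rewrite addr_ge0// exprn_ge0.
pose CT := \sum_(k < m) \sum_(t : k.-tuple 'I_d) (2 ^+ m * C1) ^+ power k.
have CT0 : 0 <= CT.
  by apply: sumr_ge0 => k _; apply: sumr_ge0 => t _; rewrite exprn_ge0// mulr_ge0// exprn_ge0.
exists (B + 2 ^+ m * comp_const m CT M * C1) => sig s x sig0 sig1 sm_.
have Cc0 := comp_const_ge0 m CT0 M0.
have [Tx|Tx] := ltP (2 * sig ^+ weight) (gauge x).
  rewrite cut_near//; apply: (@le_trans _ _ B); first by apply: HB; rewrite sm_ leq_addr.
  by rewrite lerDl !mulr_ge0// exprn_ge0.
have s01 : 0 <= sig <= 1 by rewrite ltW.
have Tx2 : gauge x <= (2 * sig) ^+ weight.
  apply: (le_trans Tx); rewrite exprMn ler_wpM2r ?exprn_ge0 ?(ltW sig0)//.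
  by rewrite -[leLHS]expr1 ler_weXn2l ?ler1n// (leq_trans m0 m_le_weight).
have D1 t : (size t <= m + m)%N -> `|Ds t w x| <= C1 * sig ^+ (m - size t).
  move=> tm; have [tm'|tm'] := ltnP (size t) m.
    apply: (le_trans (gauge_scale tm' _ Tx2)); first by rewrite mulr_ge0// ltW.
    rewrite exprMn ler_wpM2r ?exprn_ge0 ?(ltW sig0)//.
    apply: (@le_trans _ _ (2 ^+ m)); last by rewrite lerDl.
    by rewrite ler_weXn2l ?ler1n// leq_subr.
  rewrite (eqP (_ : m - size t == 0)%N); last by rewrite subn_eq0.
  by rewrite expr0 mulr1 (le_trans (HB _ _ tm))// lerDr exprn_ge0.
have oD t : (size t < m)%N -> ordb dirs x 1 sig m (m - size t) C1 (Ds t w).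
  move=> tm s' s'm; rewrite -Dseq_cat expr1n mulr1 -subnDA addnC -size_cat.
  by apply: D1; rewrite size_cat leq_add// ltnW.
have oT : ordb dirs x 1 sig m weight CT gauge.
  apply: ordb_sum => k; first by apply: sm_sum => t _; apply: smX; exact: sm_Dseq.
  apply: ordb_sum => t; first by apply: smX; exact: sm_Dseq.
  have tk : (size t < m)%N by rewrite size_tuple.
  have := ordbX (power k) ler01 s01 C10 (sm_Dseq t sw) (oD t tk).
  by rewrite size_tuple power_weight.
have sV0 : 0 <= sig^-1 by rewrite invr_ge0 ltW.
have expsub k n : (k <= n)%N -> sig ^+ (n - k) = sig ^+ n * sig^-1 ^+ k.
  move=> kn; rewrite -[in RHS](subnK kn) exprD -mulrA -exprMn divff ?gt_eqF//.
  by rewrite expr1n mulr1.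
have on01 : 0 <= (1 : R) <= 1 by rewrite ler01 lexx.
have sg : sm dirs (cst (sig ^- weight) * gauge - cst 1).
  by apply: smB; [apply: smM; [exact: sm_cst|exact: sm_gauge]|exact: sm_cst].
have o1 : ordb dirs x sig^-1 1 m 0 (comp_const m CT M)
    (step \o (cst (sig ^- weight) * gauge - cst 1)).
  apply: ordb_comp => //; first exact: sm_step.
    by move=> t tm; exact: HM.
  move=> t /andP[t0 tm].
  have -> : Ds t (cst (sig ^- weight) * gauge - cst 1) x = sig ^- weight * Ds t gauge x.
    rewrite (_ : _ - cst 1 = cst (sig ^- weight) * gauge + cst (-1)); last first.
      by apply/funext => y; rewrite !fctE.
    rewrite DseqD; [|by apply: smM; [exact: sm_cst|exact: sm_gauge]|exact: sm_cst].
    rewrite Dseq_cst// DseqZ; last exact: sm_gauge.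
    by rewrite !fctE /cst/= addr0.
  rewrite normrM normfV [`|sig ^+ _|]ger0_norm ?exprn_ge0 ?(ltW sig0)//.
  rewrite mulrC ler_pdivrMr ?exprn_gt0//.
  apply: (le_trans (oT _ tm)); rewrite expr1n mulr1 -mulrA ler_wpM2l//.
  by rewrite expsub 1?mulrC// (leq_trans tm m_le_weight).
have o2 : ordb dirs x sig^-1 1 m 0 (C1 * sig ^+ m) w.
  move=> t tm; rewrite expr1n mulr1; apply: (le_trans (D1 t (leq_trans tm (leq_addr _ _)))).
  by rewrite -mulrA ler_wpM2l// expsub.
have C1s : 0 <= C1 * sig ^+ m by rewrite mulr_ge0 ?exprn_ge0 ?(ltW sig0).
have smm : (size s <= m)%N by rewrite sm_.
have := ordbM sV0 on01 Cc0 C1s (sm_comp sm_step sg) sw o1 o2 smm.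
rewrite -/(cut sig) => /le_trans; apply.
rewrite expr1n mulr1 sm_ exprVn !mulrA mulfK ?expf_neq0 ?gt_eqF//.
by rewrite lerDr.
Qed.

Let sig_ (n : nat) : R := (n.+1%:R)^-1.
Let sig_gt0 n : 0 < sig_ n. Proof. by rewrite invr_gt0. Qed.
Let sig_le1 n : sig_ n <= 1. Proof. by rewrite invf_le1 ?ler1n. Qed.

Lemma cut_cvg s x :
  Ds s (cut (sig_ n)) x @[n --> \oo] --> Ds s w x * (0 < gauge x)%R%:R.
Proof.
have [Tx|Tx] := ltP 0 (gauge x); last first.
  rewrite mulr0; apply: cvg_near_cst; apply: nearW => n.
  by rewrite cut_near0// (le_lt_trans Tx)// exprn_gt0.
rewrite mulr1; apply: cvg_near_cst.
have eps0 : 0 < Num.min 1 (gauge x / 2) by rewrite lt_min ltr01 divr_gt0.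
have := near_infty_natSinv_lt (PosNum eps0).
apply: filterS => n /=; rewrite lt_min => /andP[_ nT].
rewrite cut_near// mulrC -ltr_pdivlMr//; apply: le_lt_trans nT.
rewrite -[leRHS]expr1; apply: ler_wiXn2l; first exact: ltW.
  exact: sig_le1.
exact: leq_trans m0 m_le_weight.
Qed.

Let cc_cut n : cc (cut (sig_ n)).
Proof. by apply: ccM => //; apply: sm_cont; apply: sm_comp; [exact: sm_step|
  apply: smB; [apply: smM; [exact: sm_cst|exact: sm_gauge]|exact: sm_cst]]. Qed.

Let mgauge : measurable_fun setT (fun x => (0 < gauge x)%R%:R : R).
Proof.
have mg : measurable_fun setT gauge by exact (@sm_measurable R d _ setT sm_gauge).
have mP : measurable [set x | 0 < gauge x].
  rewrite (_ : [set x | _] = setT `&` gauge @^-1` `]0, +oo[%classic).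
    exact: mg.
  by apply/seteqP; split => x /=; rewrite in_itv/= andbT; [move=> ?; split|case].
rewrite (_ : (fun x => _) = \1_[set x | 0 < gauge x]); first exact (measurable_indic mP).
apply/funext => x; rewrite indicE.
suff -> : (x \in [set x | 0 < gauge x]) = (0 < gauge x) by [].
by apply/idP/idP => [/set_mem//|H]; exact/mem_set.
Qed.

(** The bound is uniform and the supports lie in a fixed box. *)
Lemma cut_dominated : exists2 g, mu.-integrable setT (EFin \o g) &
  forall n s x, size s = m -> `|Ds s (cut (sig_ n)) x| <= g x.
Proof.
have [C HC] := cut_bounded; have [_ [r wr]] := ccw.
exists (fun x => `|C| * \1_(cbox (0 : E) r) x).
  apply: integrable_cstM => //.
  by apply: integrable_indic_fin; [exact: measurable_cbox|exact: leb_cbox_fin].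
move=> n s x sm_; rewrite indicE; have [xr|xr] := boolP (x \in cbox 0 r).
  by rewrite mulr1; apply: le_trans (ler_norm C); exact: HC.
rewrite mulr0 (@Dseq_out _ _ _ _ s _ (cbox 0 r)) ?normr0//.
- by apply: compact_closed => //; exact: compact_cbox.
- by move=> y yr; rewrite cutE wr ?mulr0.
- by move/mem_set; exact/negP.
Qed.

(** With [g] the derivative of [w] along [s], the integral of [D^s (cut sig) * g]
    tends to that of [g^2] after integration by parts, since [cut sig] tends to
    [w], and to the integral of [g^2] over [gauge > 0] by dominated convergence.
    So [g^2] has integral [0] over [gauge = 0]. *)
Lemma gauge0_Dseq_ae s : size s = m ->
  {ae mu, forall x, Ds s w x = Ds s w x * (0 < gauge x)%R%:R}.
Proof.
move=> sm_; pose g := Ds s w.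
have sg : sm dirs g by exact: sm_Dseq.
have cg : cc g by exact: cc_pd.
have [h ih hh] := cut_dominated.
have [Bg HBg] := cc_bounded cg.
have lim1 : (fun n => \int[mu]_x (Ds s (cut (sig_ n)) x * g x)) @ \oo -->
    \int[mu]_x ((Ds s w x * (0 < gauge x)%R%:R) * g x).
  apply: (@Rint_dominated _ _ _ mu setT _ _ (fun x => Bg * h x)) => //.
  - move=> n; apply: measurable_funM; last exact: cc_measurable.
    exact (@sm_measurable R d _ setT (sm_Dseq s (sm_cut (sig_ n)))).
  - apply: measurable_funM; last exact: cc_measurable.
    by apply: measurable_funM => //; exact: cc_measurable.
  - exact: integrable_cstM.
  - by apply: aeW => x _; apply: cvgMl; exact: cut_cvg.
  - move=> n x _; rewrite normrM mulrC; apply: ler_pM => //; exact: hh.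
have [Bq HBq] : exists B, forall x, `|Ds (rev s) g x| <= B.
  by apply: cc_bounded; exact: cc_pd.
have w_gauge x : w x * (0 < gauge x)%R%:R = w x.
  have [Tx|Tx] := ltP 0 (gauge x); first by rewrite mulr1.
  have T0 : gauge x = 0 by apply/eqP; rewrite eq_le Tx gauge_ge0.
  by have /= -> := @gauge_eq0 [::] x m0 T0; rewrite mul0r.
have lim2 : (fun n => \int[mu]_x (cut (sig_ n) x * Ds (rev s) g x)) @ \oo -->
    \int[mu]_x (w x * Ds (rev s) g x).
  apply: (@Rint_dominated _ _ _ mu setT _ _ (fun x => Bq * `|w x|)) => //.
  - move=> n; apply: measurable_funM; first exact: cc_measurable.
    by apply: cc_measurable; exact: cc_pd.
  - apply: measurable_funM; first exact: cc_measurable.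
    by apply: cc_measurable; exact: cc_pd.
  - by apply: integrable_cstM => //; apply: integrable_norm; exact: cc_integrable.
  - apply: aeW => x _; apply: cvgMl.
    by have := @cut_cvg [::] x; rewrite /= w_gauge.
  - move=> n x _; rewrite normrM mulrC; apply: ler_pM => //.
    rewrite cutE normrM ger0_norm ?step_ge0// ler_piMl ?step_le1//.
have E : \int[mu]_x ((Ds s w x * (0 < gauge x)%R%:R) * g x) = \int[mu]_x (g x * g x).
  rewrite [RHS](Rint_parts_seq s sw sg cg).
  apply: (cvg_unique _ lim1) => //.
  have lim3 : (fun n => (-1) ^+ size s * \int[mu]_x (cut (sig_ n) x * Ds (rev s) g x)) @ \oo -->
    (-1) ^+ size s * \int[mu]_x (w x * Ds (rev s) g x) by exact: cvgMr lim2.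
  have -> : (fun n => \int[mu]_x (Ds s (cut (sig_ n)) x * g x)) =
    (fun n => (-1) ^+ size s * \int[mu]_x (cut (sig_ n) x * Ds (rev s) g x)).
    by apply/funext => n; rewrite (Rint_parts_seq s (@sm_cut (sig_ n)) sg cg).
  exact: lim3.
have igg : mu.-integrable setT (EFin \o (fun x => g x * g x)).
  by apply: cc_integrable; apply: ccM => //; exact: sm_cont.
have igT : mu.-integrable setT (EFin \o (fun x => Ds s w x * (0 < gauge x)%R%:R * g x)).
  apply: (le_integrable measurableT _ _ igg).
    apply/measurable_EFinP; apply: measurable_funM; last exact: cc_measurable.
    by apply: measurable_funM => //; exact: cc_measurable.
  move=> x _; rewrite lee_fin -/g !normrM ler_wpM2r// ler_piMr//.
  by case: (_ < _) => /=; rewrite ?normr1 ?normr0.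
pose q x := g x * g x - Ds s w x * (0 < gauge x)%R%:R * g x.
have q0 x : 0 <= q x.
  rewrite /q -/(g x); case: (_ < _) => /=; first by rewrite mulr1 subrr.
  by rewrite mulr0 mul0r subr0 -expr2 sqr_ge0.
have iq0 : \int[mu]_x q x = 0 by rewrite RintegralB// E subrr.
have iq : mu.-integrable setT (EFin \o q).
  exact: integrable_sub.
have mq := measurable_int _ iq.
have : (\int[mu]_x `|(EFin \o q) x| = 0)%E.
  rewrite (eq_integral (EFin \o q)); last by move=> x _; rewrite gee0_abs// lee_fin.
  rewrite -[LHS]fineK; last exact: integrable_fin_num.
  by congr EFin; exact: iq0.
move/(ae_eq_integral_abs mu measurableT mq) => H.
apply: filterS H => x /(_ I) [].
rewrite /q -/(g x); case: (_ < _) => /=; first by rewrite mulr1.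
rewrite !mulr0 mul0r subr0 => /eqP; rewrite mulf_eq0 orbb => /eqP.
exact.
Qed.

(** The limit of the derivatives carries the indicator of [gauge > 0], which
    [gauge0_Dseq_ae] removes. *)
Lemma truncation : exists v : nat -> E -> R,
  [/\ forall n, sm dirs (v n) /\ supp_in Omega (v n),
      exists2 g, mu.-integrable setT (EFin \o g) &
        exists2 C, 0 <= C & forall n s x, size s = m -> `|Ds s (v n) x| <= g x /\ `|Ds s (v n) x| <= C &
      forall s, size s = m ->
        {ae mu, forall x, Ds s (v n) x @[n --> \oo] --> Ds s w x}].
Proof.
exists (fun n => cut (sig_ n)); split.
- by move=> n; split; [exact: sm_cut|exact: cut_supp].
- have [g ig hg] := cut_dominated; exists g => //.
  have [C HC] := cut_bounded; exists `|C| => // n s x sm_; split; first exact: hg.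
  by apply: le_trans (ler_norm C); exact: HC.
- move=> s sm_; have := gauge0_Dseq_ae sm_; apply: filterS => x Hx.
  by rewrite Hx; exact: cut_cvg.
Qed.

Lemma Dseq_off_ae s : size s = m -> {ae mu, forall x, ~ Omega x -> Ds s w x = 0}.
Proof.
move=> sm_; have := gauge0_Dseq_ae sm_; apply: filterS => x -> /gauge_out ->.
by rewrite ltxx mulr0.
Qed.

(** The truncations are test functions, and the bound on their derivatives of order
    [m] dominates the integrands. *)
Lemma weak_equation_extends (J : finType) (s_ : J -> seq 'I_d) (H : J -> E -> R) :
  measurable Omega ->
  (forall j, size (s_ j) = m) -> (forall j, mu.-integrable Omega (EFin \o H j)) ->
  (forall phi, sm dirs phi -> supp_in Omega phi ->
    \sum_j \int[mu]_(x in Omega) (Ds (s_ j) phi x * H j x) = 0) ->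
  \sum_j \int[mu]_(x in Omega) (Ds (s_ j) w x * H j x) = 0.
Proof.
move=> mO sj iH eq0.
have [v [v1 [g ig [C C0 HC]] v3]] := truncation.
have lim : (fun n => \sum_j \int[mu]_(x in Omega) (Ds (s_ j) (v n) x * H j x)) @ \oo -->
    \sum_j \int[mu]_(x in Omega) (Ds (s_ j) w x * H j x).
  apply: cvg_sum_seq => j.
  have mH : measurable_fun Omega (H j) by apply/measurable_EFinP; exact: (measurable_int _ (iH j)).
  apply: (@Rint_dominated _ _ _ mu Omega _ _ (fun x => C * `|H j x|)) => //.
  - move=> n; apply: measurable_funM => //.
    exact (@sm_measurable R d _ Omega (sm_Dseq (s_ j) (v1 n).1)).
  - apply: measurable_funM => //.
    exact (@sm_measurable R d _ Omega (sm_Dseq (s_ j) sw)).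
  - by apply: integrable_cstM => //; exact: integrable_norm.
  - by have := v3 _ (sj j); apply: filterS => x Hx _; apply: cvgMl; exact: Hx.
  - move=> n x _; rewrite normrM ler_wpM2r//.
    by have [] := HC n _ x (sj j).
apply: (cvg_unique _ lim) => //.
rewrite (_ : (fun n => _) = cst 0); first exact: cvg_cst.
by apply/funext => n; have [? ?] := v1 n; exact: eq0.
Qed.

End truncation.

(** * Interpolation between orders of differentiation *)

Section discrete_interpolation.
Context {R : realType}.
Variables (m : nat) (Kf : R -> R).
Hypothesis Kf0 : forall eps, 0 < eps -> 0 <= Kf eps.

Definition interpolating (J : nat -> R) := (forall k, 0 <= J k) /\
  forall eps k, 0 < eps -> (k.+2 <= m)%N -> J k.+1 <= eps * J k.+2 + Kf eps * J k.

(** Induction on [k]: the bound for order [k+2] contains order [k+1], which the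
    induction hypothesis trades for half of order [k+2] and order [0]. *)
Lemma interpolating_up k eta : 0 < eta -> exists2 C, 0 <= C &
  forall J, interpolating J -> (k.+2 <= m)%N -> J k.+1 <= eta * J k.+2 + C * J 0%N.
Proof.
elim: k eta => [|k IH] eta eta0.
  by exists (Kf eta) => [|J [_ HJ] km]; [exact: Kf0|exact: HJ].
have e0 : 0 < eta / 2 by rewrite divr_gt0.
have K0 := Kf0 e0; set K := Kf _ in K0.
have K1 : 0 < K + 1 by rewrite ltr_wpDl.
have e'0 : 0 < (2 * (K + 1))^-1 by rewrite invr_gt0 mulr_gt0.
have [C C0 HC] := IH _ e'0.
exists (2 * K * C); first by rewrite !mulr_ge0.
move=> J HJ km; have [J0 HJ'] := HJ.
have h1 := HJ' _ k.+1 e0 km; rewrite -/K in h1.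
have h2 := HC J HJ (ltnW km).
have h3 : K * (2 * (K + 1))^-1 <= 1 / 2.
  by rewrite ler_pdivrMr ?mulr_gt0// mulrA mulfVK// mul1r lerDl.
have h4 : K * J k.+1 <= 1 / 2 * J k.+2 + K * C * J 0%N.
  apply: (le_trans (ler_wpM2l K0 h2)); rewrite mulrDr !mulrA lerD2r.
  by rewrite ler_wpM2r.
lra.
Qed.

(** Iterate [interpolating_up] until order [m] is reached: only the last step needs
    a small constant. *)
Lemma interpolating_bound eta k : 0 < eta -> (k < m)%N -> exists2 C, 0 <= C &
  forall J, interpolating J -> J k <= eta * J m + C * J 0%N.
Proof.
move=> eta0 km; have [n mE] : exists n, m = (k + n.+1)%N.
  by exists (m - k.+1)%N; rewrite addnS -addSn subnKC.
elim: n k mE km => [|n IH] [|k] mE km.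
- by exists 1 => // J [J0 _]; rewrite mul1r lerDr mulr_ge0// ltW.
- have [C C0 HC] := interpolating_up k eta0; exists C => // J HJ.
  have mE' : m = k.+2 by rewrite mE addn1.
  rewrite (_ : J m = J k.+2); last by rewrite mE'.
  exact: (HC J HJ (eq_leq (esym mE'))).
- by exists 1 => // J [J0 _]; rewrite mul1r lerDr mulr_ge0// ltW.
- have mE2 : m = (k.+2 + n.+1)%N by rewrite mE -addSnnS.
  have km2 : (k.+2 < m)%N by rewrite mE2 -[ltnLHS]addn0 ltn_add2l.
  have [C C0 HC] := IH k.+2 mE2 km2.
  have [C' C'0 HC'] := interpolating_up k ltr01.
  exists (C + C'); first by rewrite addr_ge0.
  move=> J HJ; apply: (le_trans (HC' J HJ _)) => //.
  by rewrite mul1r mulrDl addrA lerD2r HC.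
Qed.

Lemma interpolating_bounds eta : 0 < eta -> exists2 C, 0 <= C &
  forall J, interpolating J -> forall k, (k < m)%N -> J k <= eta * J m + C * J 0%N.
Proof.
move=> eta0.
pose F k := if pselect (k < m)%N is left km then
  sval (cid2 (interpolating_bound eta0 km)) else 0.
have F0 k : 0 <= F k by rewrite /F; case: pselect => // km; case: cid2.
exists (\sum_(k < m) F k); first by apply: sumr_ge0.
move=> J HJ k km; have J0 : 0 <= J 0%N by case: HJ.
apply: (@le_trans _ _ (eta * J m + F k * J 0%N)).
  by rewrite /F; case: pselect => // km'; case: cid2 => C ? /=; apply.
rewrite lerD2l ler_wpM2r// (bigD1 (Ordinal km))//= lerDl.
by apply: sumr_ge0.
Qed.

End discrete_interpolation.

Section tuples.
Context {R : realType} {d : nat}.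
Local Notation E := 'rV[R]_d.
Local Notation Ds := (Dseq (@dirs R d)).

Lemma sum_tupleS {I : finType} k (F : seq I -> R) :
  \sum_(t : k.+1.-tuple I) F t = \sum_(t : k.-tuple I) \sum_i F (i :: t).
Proof.
rewrite exchange_big pair_big /=.
pose h (p : I * k.-tuple I) : k.+1.-tuple I := [tuple of p.1 :: p.2].
rewrite (reindex h) //=.
exists (fun t : k.+1.-tuple I => (thead t, [tuple of behead t])) => [[i t] _|t _].
  by rewrite /h theadE; congr pair; apply: val_inj.
by rewrite /h /=; case/tupleP: t => i t; apply: val_inj; rewrite /= theadE.
Qed.

Lemma gradsqS k (f : E -> R) x : gradsq dirs k.+1 f x =
  \sum_(t : k.-tuple 'I_d) \sum_i (pd dirs i (Ds t f) x) ^+ 2.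
Proof. by rewrite /gradsq (@sum_tupleS _ k (fun t => Ds t f x ^+ 2)). Qed.

Lemma gradsqSS_ge k (f : E -> R) x :
  \sum_(t : k.-tuple 'I_d) \sum_i (pd dirs i (pd dirs i (Ds t f)) x) ^+ 2 <=
  gradsq dirs k.+2 f x.
Proof.
rewrite gradsqS (@sum_tupleS _ k (fun t => \sum_j (pd dirs j (Ds t f) x) ^+ 2)).
apply: ler_sum => t _; apply: ler_sum => i _; rewrite (bigD1 i)//= lerDl.
by apply: sumr_ge0 => j _; exact: sqr_ge0.
Qed.

Lemma gradsq0 (f : E -> R) x : gradsq dirs 0 f x = f x ^+ 2.
Proof.
rewrite /gradsq (bigD1 [tuple])//= big1 ?addr0// => t.
by move=> /negP[]; apply/eqP; exact: tuple0.
Qed.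

End tuples.

Section interpolation.
Context {R : realType} {d : nat}.
Local Notation E := 'rV[R]_d.
Local Notation mu := (leb R d).
Local Notation Ds := (Dseq (@dirs R d)).

Lemma pdX {V : normedModType R} {I : Type} (e : I -> V) i (f : V -> R) n x : sm e f ->
  pd e i (f ^+ n.+1) x = n.+1%:R * f x ^+ n * pd e i f x.
Proof.
move=> sf; elim: n => [|n IH]; first by rewrite expr1 expr0 !mul1r.
rewrite exprS pdM//; last exact: smX.
have -> : (f * pd e i (f ^+ n.+1) + f ^+ n.+1 * pd e i f) x =
  f x * pd e i (f ^+ n.+1) x + (f ^+ n.+1) x * pd e i f x by [].
rewrite IH exprfctE [in RHS]exprS -[n.+2]addn1 natrD [in LHS]exprS; ring.
Qed.

(** Young's inequality for the two terms that integration by parts produces; [w]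
    stands for the derivative of the weight [o], [a] for an even power of it. *)
Lemma interpolation_pointwise (o h D1 D2 w b c eps q a : R) : 0 < eps -> 0 < b ->
  0 <= a -> `|w| <= c * b ->
  - (h * (a * o ^+ 2 * D2 + D1 * (q * (a * o) * w))) <=
  (eps / 2) * b ^- 2 * (a * o ^+ 4 * D2 ^+ 2) + 1 / 2 * (a * o ^+ 2 * D1 ^+ 2) +
  (eps^-1 / 2 + q ^+ 2 * c ^+ 2 / 2) * b ^+ 2 * (a * h ^+ 2).
Proof.
move=> eps0 b0 a0 wcb.
have w2 : w ^+ 2 <= c ^+ 2 * b ^+ 2.
  by rewrite -exprMn -real_normK ?num_real// lerXn2r ?nnegrE// (le_trans _ wcb).
have y1 : - (h * (o ^+ 2 * D2)) <=
    (eps / 2) * b ^- 2 * (o ^+ 2 * D2) ^+ 2 + eps^-1 / 2 * b ^+ 2 * h ^+ 2.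
  rewrite -subr_ge0 [leRHS](_ : _ = eps^-1 / 2 * (eps / b * (o ^+ 2 * D2) + b * h) ^+ 2).
    by rewrite mulr_ge0 ?sqr_ge0// divr_ge0// invr_ge0 ltW.
  by field; rewrite !gt_eqF.
have y2 : - (h * (D1 * (q * o * w))) <=
    1 / 2 * (o ^+ 2 * D1 ^+ 2) + q ^+ 2 * c ^+ 2 / 2 * b ^+ 2 * h ^+ 2.
  apply: (@le_trans _ _ (1 / 2 * (o ^+ 2 * D1 ^+ 2) + q ^+ 2 / 2 * h ^+ 2 * w ^+ 2)).
    rewrite -subr_ge0 [leRHS](_ : _ = 1 / 2 * (o * D1 + q * w * h) ^+ 2); last by field.
    by rewrite mulr_ge0 ?sqr_ge0.
  rewrite lerD2l [leRHS](_ : _ = q ^+ 2 / 2 * h ^+ 2 * (c ^+ 2 * b ^+ 2)); last by ring.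
  by rewrite ler_wpM2l// mulr_ge0 ?sqr_ge0// divr_ge0 ?sqr_ge0.
have := lerD (ler_wpM2l a0 y1) (ler_wpM2l a0 y2).
have -> : a * - (h * (o ^+ 2 * D2)) + a * - (h * (D1 * (q * o * w))) =
  - (h * (a * o ^+ 2 * D2 + D1 * (q * (a * o) * w))) by ring.
move=> /le_trans; apply; rewrite le_eqVlt; apply/orP; left; apply/eqP; ring.
Qed.

Lemma cc_expM (om g : E -> R) n : (0 < n)%N -> cc om -> continuous g ->
  cc (fun x => om x ^+ n * g x).
Proof.
case: n => // n _ [co [r omr]] cg; split.
  have cX : continuous (om ^+ n.+1).
    elim: n => [|n IH]; first by rewrite expr1.
    by rewrite exprS => x; exact: (continuousM (co x) (IH x)).
  rewrite (_ : (fun x => _) = om ^+ n.+1 * g); last first.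
    by apply/funext => x; rewrite !(fctE, exprfctE).
  by move=> x; exact: (continuousM (cX x) (cg x)).
by exists r => x xr; rewrite omr// expr0n mul0r.
Qed.

(** The integral of [om^q (D h)^2] is minus that of [h D(om^q D h)], where the
    derivative falls on [D h] or on the weight; half of the left hand side comes
    back and is absorbed. *)
Lemma interpolation_step (om h : E -> R) (i : 'I_d) (p : nat) (b c eps : R) :
  sm dirs om -> cc om -> sm dirs h -> (0 < p)%N ->
  (forall x, `|pd dirs i om x| <= c * b) -> 0 < eps -> 0 < b ->
  \int[mu]_x (om x ^+ (2 * p.+1) * pd dirs i h x ^+ 2) <=
  eps * b ^- 2 * \int[mu]_x (om x ^+ (2 * p.+2) * pd dirs i (pd dirs i h) x ^+ 2) +
  (eps^-1 + (2 * p.+1)%:R ^+ 2 * c ^+ 2) * b ^+ 2 * \int[mu]_x (om x ^+ (2 * p) * h x ^+ 2).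
Proof.
move=> so co sh p0 omb eps0 b0.
have s1 : sm dirs (pd dirs i h) by exact: sm_pd.
have s2 : sm dirs (pd dirs i (pd dirs i h)) by exact: sm_pd.
have sX : sm dirs (om ^+ (2 * p.+1)) by exact: smX.
have cX (g : E -> R) q : (0 < q)%N -> sm dirs g -> mu.-integrable setT (EFin \o (fun x => om x ^+ q * g x ^+ 2)).
  move=> q0 sg; apply: cc_integrable; apply: cc_expM => //.
  rewrite (_ : (fun x => _) = g * g); first by apply: sm_cont; exact: smM.
  by apply/funext => x; rewrite expr2.
set q := (2 * p.+1)%N; set J1 := \int[mu]_x _.
set J2 := \int[mu]_x (_ * pd dirs i (pd dirs i h) _ ^+ 2); set J0 := \int[mu]_x (_ * h _ ^+ 2).
have g1 : cc (om ^+ q * pd dirs i h).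
  rewrite (_ : _ * _ = fun x => om x ^+ q * pd dirs i h x).
    by apply: cc_expM => //; exact: sm_cont.
  by apply/funext => x; rewrite !(fctE, exprfctE).
have sg1 : sm dirs (om ^+ q * pd dirs i h) by exact: smM.
have E1 : J1 = - \int[mu]_x (h x * pd dirs i (om ^+ q * pd dirs i h) x).
  rewrite -Rint_parts//; apply: eq_Rintegral => x _.
  by rewrite !(fctE, exprfctE) expr2; ring.
have step1 : J1 <= \int[mu]_x (eps / 2 * b ^- 2 * (om x ^+ (2 * p.+2) * pd dirs i (pd dirs i h) x ^+ 2)
   + 1 / 2 * (om x ^+ q * pd dirs i h x ^+ 2) +
   (eps^-1 / 2 + q%:R ^+ 2 * c ^+ 2 / 2) * b ^+ 2 * (om x ^+ (2 * p) * h x ^+ 2)).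
  rewrite E1 -[leLHS]mulN1r -RintegralZl//; last first.
    by apply: cc_integrable; apply: ccM; [exact: sm_cont|exact: (cc_pd [:: i])].
  apply: le_Rintegral => //.
  - apply: integrable_cstM => //; apply: cc_integrable.
    by apply: ccM; [exact: sm_cont|exact: (cc_pd [:: i])].
  - apply: integrable_add => //.
      apply: integrable_add => //; apply: integrable_cstM => //; exact: cX.
    by apply: integrable_cstM => //; apply: cX; rewrite // muln_gt0.
  move=> x _; rewrite mulN1r.
  have := @interpolation_pointwise (om x) (h x) (pd dirs i h x) (pd dirs i (pd dirs i h) x)
    (pd dirs i om x) b c eps q%:R (om x ^+ (2 * p)) eps0 b0 _ (omb x).
  rewrite exprM exprn_ge0 ?sqr_ge0// => /(_ isT).
  have qE : q = (2 * p).+2 by rewrite /q mulnS.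
  have oq : om x ^+ q = om x ^+ (2 * p) * om x ^+ 2 by rewrite -exprD qE addn2.
  have oq2 : om x ^+ (2 * p.+2) = om x ^+ (2 * p) * om x ^+ 4.
    by rewrite -exprD -(addn2 p) mulnDr.
  have dE : pd dirs i (om ^+ q * pd dirs i h) x =
      om x ^+ (2 * p) * om x ^+ 2 * pd dirs i (pd dirs i h) x +
      pd dirs i h x * (q%:R * (om x ^+ (2 * p) * om x) * pd dirs i om x).
    rewrite pdM//.
    have -> : (om ^+ q * pd dirs i (pd dirs i h) + pd dirs i h * pd dirs i (om ^+ q)) x =
      (om ^+ q) x * pd dirs i (pd dirs i h) x + pd dirs i h x * pd dirs i (om ^+ q) x by [].
    have -> : pd dirs i (om ^+ q) x = q%:R * om x ^+ (2 * p).+1 * pd dirs i om x.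
      by rewrite qE pdX.
    by rewrite exprfctE oq [om x ^+ (2 * p).+1]exprSr.
  rewrite -exprM dE oq oq2.
  by rewrite [om x ^+ (2 * p) * om x ^+ 2 * (pd dirs i h x ^+ 2)]mulrA.
move: step1; rewrite RintegralD//; last 2 first.
- by apply: integrable_add => //; apply: integrable_cstM => //; exact: cX.
- by apply: integrable_cstM => //; apply: cX => //; rewrite muln_gt0.
rewrite RintegralD//; last 2 first.
- by apply: integrable_cstM => //; exact: cX.
- by apply: integrable_cstM => //; exact: cX.
rewrite !RintegralZl//; do ?[by apply: cX => //; rewrite muln_gt0].
rewrite -/J1 -/J2 -/J0 => H; move: H.
rewrite [eps / 2 * b ^- 2 * J2](_ : _ = (eps * b ^- 2 * J2) / 2); last by ring.
rewrite [X in _ + X](_ : _ = ((eps^-1 + q%:R ^+ 2 * c ^+ 2) * b ^+ 2 * J0) / 2); last by ring.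
lra.
Qed.

End interpolation.

Section Rint_sum.
Context d (T : measurableType d) (R : realType) (mu : {measure set T -> \bar R}).

Lemma integrable_sumR J (r : seq J) (F : J -> T -> R) (D : set T) : measurable D ->
  (forall j, mu.-integrable D (EFin \o F j)) ->
  mu.-integrable D (EFin \o (fun x => \sum_(j <- r) F j x)).
Proof.
move=> mD iF; elim: r => [|j r IH].
  by under eq_fun do rewrite big_nil; exact: integrable0.
under eq_fun do rewrite big_cons.
exact: (integrable_add mD (iF j) IH).
Qed.

Lemma Rint_sum J (r : seq J) (F : J -> T -> R) (D : set T) : measurable D ->
  (forall j, mu.-integrable D (EFin \o F j)) ->
  \int[mu]_(x in D) (\sum_(j <- r) F j x) = \sum_(j <- r) \int[mu]_(x in D) F j x.
Proof.
move=> mD iF; elim: r => [|j r IH].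
  under eq_Rintegral do rewrite big_nil.
  by rewrite big_nil /Rintegral integral0.
under eq_Rintegral do rewrite big_cons.
by rewrite big_cons RintegralD ?IH//; exact: integrable_sumR.
Qed.

End Rint_sum.

Section weighted_norms.
Context {R : realType} {d : nat}.
Local Notation E := 'rV[R]_d.
Local Notation mu := (leb R d).
Local Notation Ds := (Dseq (@dirs R d)).
Implicit Types (om f : E -> R).

Lemma integrable_weighted om f n : (0 < n)%N -> cc om -> sm dirs f ->
  mu.-integrable setT (EFin \o (fun x => om x ^+ n * f x ^+ 2)).
Proof.
move=> n0 co sf; apply: cc_integrable; apply: cc_expM => //.
rewrite (_ : (fun x => _) = f * f); first by apply: sm_cont; exact: smM.
by apply/funext => x; rewrite expr2.
Qed.

Lemma integrable_weighted_gradsq om f n k : (0 < n)%N -> cc om -> sm dirs f ->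
  mu.-integrable setT (EFin \o (fun x => om x ^+ n * gradsq dirs k f x)).
Proof.
move=> n0 co sf.
under eq_fun do rewrite mulr_sumr.
apply: integrable_sumR => // t; apply: integrable_weighted => //.
exact: sm_Dseq.
Qed.

Lemma int_gradsq om f n k : (0 < n)%N -> cc om -> sm dirs f ->
  \int[mu]_x (om x ^+ n * gradsq dirs k f x) =
  \sum_(t : k.-tuple 'I_d) \int[mu]_x (om x ^+ n * Ds t f x ^+ 2).
Proof.
move=> n0 co sf; under eq_Rintegral do rewrite mulr_sumr.
rewrite Rint_sum// => t; apply: integrable_weighted => //.
exact: sm_Dseq.
Qed.

(** Made homogeneous by the power of [b], so that the interpolation constants do not
    depend on the scale. *)
Definition weighted_norm om (b : R) f k : R :=
  (b^-1) ^+ (2 * k) * \int[mu]_x (om x ^+ (2 * k.+1) * gradsq dirs k f x).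

(** [2 * m] bounds the exponents of the weight that get differentiated. *)
Definition interp_const (m : nat) (c eps : R) : R :=
  d%:R * (eps^-1 + (2 * m)%:R ^+ 2 * c ^+ 2).

Lemma weighted_norm_ge0 om b f k : 0 < b -> 0 <= weighted_norm om b f k.
Proof.
move=> b0; rewrite mulr_ge0 ?exprn_ge0 ?invr_ge0 ?(ltW b0)//.
apply: Rintegral_ge0 => x _.
by apply: mulr_ge0; [rewrite exprM exprn_ge0// sqr_ge0|exact: gradsq_ge0].
Qed.

(** [interpolation_step] for each derivative of [f], summed: of the derivatives of
    order [k+2] only those with a repeated direction are needed. *)
Lemma weighted_norm_interpolating m om (b c : R) f :
  sm dirs om -> cc om -> sm dirs f -> 0 < b ->
  (forall i x, `|pd dirs i om x| <= c * b) ->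
  interpolating m (interp_const m c) (weighted_norm om b f).
Proof.
move=> so co sf b0 omb; split; first by move=> k; exact: weighted_norm_ge0.
move=> eps k eps0 km.
pose Kp := eps^-1 + (2 * m)%:R ^+ 2 * c ^+ 2.
have Kp0 : 0 <= Kp by rewrite addr_ge0 ?invr_ge0 ?(ltW eps0)// mulr_ge0 ?sqr_ge0.
pose I2 (t : seq 'I_d) i := \int[mu]_x (om x ^+ (2 * k.+3) * pd dirs i (pd dirs i (Ds t f)) x ^+ 2).
pose I1 (t : seq 'I_d) i := \int[mu]_x (om x ^+ (2 * k.+2) * pd dirs i (Ds t f) x ^+ 2).
pose I0 (t : seq 'I_d) := \int[mu]_x (om x ^+ (2 * k.+1) * Ds t f x ^+ 2).
have I00 t : 0 <= I0 t.
  apply: Rintegral_ge0 => x _.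
  by apply: mulr_ge0; [rewrite exprM exprn_ge0// sqr_ge0|exact: sqr_ge0].
have step t i : I1 t i <= eps * b ^- 2 * I2 t i + Kp * b ^+ 2 * I0 t.
  have := @interpolation_step R d om (Ds t f) i k.+1 b c eps so co (sm_Dseq t sf) isT (omb i) eps0 b0.
  move=> /le_trans; apply; apply: lerD => //.
  apply: ler_wpM2r; first exact: I00.
  apply: ler_wpM2r; first exact: sqr_ge0.
  rewrite /Kp lerD2l; apply: ler_wpM2r; first exact: sqr_ge0.
  by rewrite lerXn2r ?nnegrE// ler_nat leq_mul2l.
have E1 : \int[mu]_x (om x ^+ (2 * k.+2) * gradsq dirs k.+1 f x) =
    \sum_(t : k.-tuple 'I_d) \sum_i I1 t i.
  rewrite int_gradsq//.
  exact: (@sum_tupleS _ _ k (fun t => \int[mu]_x (om x ^+ (2 * k.+2) * Ds t f x ^+ 2))).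
have E2 : \sum_(t : k.-tuple 'I_d) \sum_i I2 t i <=
    \int[mu]_x (om x ^+ (2 * k.+3) * gradsq dirs k.+2 f x).
  rewrite [leLHS](_ : _ = \int[mu]_x (om x ^+ (2 * k.+3) *
     \sum_(t : k.-tuple 'I_d) \sum_i (pd dirs i (pd dirs i (Ds t f)) x) ^+ 2)); last first.
    under [RHS]eq_Rintegral do rewrite mulr_sumr.
    rewrite Rint_sum//; last first.
      move=> t; under eq_fun do rewrite mulr_sumr.
      apply: integrable_sumR => // i; apply: integrable_weighted => //.
      by do 2 apply: sm_pd; exact: sm_Dseq.
    apply: eq_bigr => t _; under [RHS]eq_Rintegral do rewrite mulr_sumr.
    rewrite Rint_sum// => i; apply: integrable_weighted => //.
    by do 2 apply: sm_pd; exact: sm_Dseq.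
  apply: le_Rintegral => //.
  - under eq_fun do rewrite mulr_sumr.
    apply: integrable_sumR => // t; under eq_fun do rewrite mulr_sumr.
    apply: integrable_sumR => // i; apply: integrable_weighted => //.
    by do 2 apply: sm_pd; exact: sm_Dseq.
  - exact: integrable_weighted_gradsq.
  - move=> x _; rewrite ler_wpM2l ?gradsqSS_ge//.
    by rewrite exprM exprn_ge0// sqr_ge0.
have E0 : \sum_(t : k.-tuple 'I_d) I0 t = \int[mu]_x (om x ^+ (2 * k.+1) * gradsq dirs k f x).
  by rewrite int_gradsq.
have bV0 : 0 < b^-1 by rewrite invr_gt0.
have total : \sum_(t : k.-tuple 'I_d) \sum_i I1 t i <=
    eps * b ^- 2 * (\sum_(t : k.-tuple 'I_d) \sum_i I2 t i) +
    d%:R * Kp * b ^+ 2 * \sum_(t : k.-tuple 'I_d) I0 t.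
  apply: (@le_trans _ _ (\sum_(t : k.-tuple 'I_d) \sum_i
     (eps * b ^- 2 * I2 t i + Kp * b ^+ 2 * I0 t))).
    by apply: ler_sum => t _; apply: ler_sum => i _; exact: step.
  rewrite !mulr_sumr -big_split /=; apply: ler_sum => t _.
  rewrite big_split/=; apply: lerD; first by rewrite mulr_sumr.
  by rewrite sumr_const card_ord -[leLHS]mulr_natl !mulrA.
rewrite /weighted_norm E1; apply: (le_trans (ler_wpM2l _ total)).
  by rewrite exprn_ge0// ltW.
rewrite E0 mulrDr; apply: lerD.
  apply: (@le_trans _ _ (b^-1 ^+ (2 * k.+1) * (eps * b ^- 2 *
    \int[mu]_x (om x ^+ (2 * k.+3) * gradsq dirs k.+2 f x)))).
    rewrite ler_wpM2l ?exprn_ge0 ?(ltW bV0)// ler_wpM2l//.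
    by rewrite mulr_ge0 ?(ltW eps0)// invr_ge0 sqr_ge0.
  rewrite le_eqVlt; apply/orP; left; apply/eqP.
  rewrite (_ : (2 * k.+2)%N = (2 * k.+1 + 2)%N); last by rewrite mulnS addnC.
  by rewrite -exprVn [b^-1 ^+ (_ + 2)]exprD; ring.
rewrite le_eqVlt; apply/orP; left; apply/eqP.
rewrite (_ : (2 * k.+1)%N = (2 * k + 2)%N) in E0 *; last by rewrite mulnS addnC.
rewrite [b^-1 ^+ (2 * k + 2)]exprD /interp_const -/Kp.
have -> : b^-1 ^+ (2 * k) * b^-1 ^+ 2 * (d%:R * Kp * b ^+ 2 * \int[mu]_x (om x ^+ (2 * k + 2) * gradsq dirs k f x)) =
  (b^-1 * b) ^+ 2 * (d%:R * Kp * (b^-1 ^+ (2 * k) * \int[mu]_x (om x ^+ (2 * k + 2) * gradsq dirs k f x))).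
  by rewrite exprMn; ring.
by rewrite mulVf ?gt_eqF// expr1n mul1r.
Qed.

Lemma weighted_interpolation (m : nat) (c eta : R) : 0 < eta -> exists2 C, 0 <= C &
  forall om f (b : R), sm dirs om -> cc om -> sm dirs f -> 0 < b ->
  (forall i x, `|pd dirs i om x| <= c * b) -> forall k, (k < m)%N ->
  weighted_norm om b f k <= eta * weighted_norm om b f m + C * weighted_norm om b f 0.
Proof.
move=> eta0.
have K0 eps : 0 < eps -> 0 <= interp_const m c eps.
  move=> e0; rewrite mulr_ge0// addr_ge0 ?invr_ge0 ?(ltW e0)//.
  by rewrite mulr_ge0 ?sqr_ge0.
have [C C0 HC] := interpolating_bounds m K0 eta0.
exists C => // om f b so co sf b0 omb k km.
by apply: HC => //; exact: weighted_norm_interpolating.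
Qed.

End weighted_norms.

(** * Complex numbers and weak derivatives *)

Section complex_parts.
Context {R : realType}.
Local Notation C := (R[i]).
Local Notation Re := (@complex.Re R).
Local Notation Im := (@complex.Im R).

Lemma ReM (x y : C) : Re (x * y) = Re x * Re y - Im x * Im y.
Proof. by case: x => ? ?; case: y. Qed.
Lemma ImM (x y : C) : Im (x * y) = Re x * Im y + Im x * Re y.
Proof. by case: x => ? ?; case: y. Qed.
Lemma ReD (x y : C) : Re (x + y) = Re x + Re y.
Proof. by case: x => ? ?; case: y. Qed.
Lemma ImD (x y : C) : Im (x + y) = Im x + Im y.
Proof. by case: x => ? ?; case: y. Qed.
Lemma ReN (x : C) : Re (- x) = - Re x. Proof. by case: x. Qed.
Lemma ImN (x : C) : Im (- x) = - Im x. Proof. by case: x. Qed.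
Lemma Re_conj (x : C) : Re (x^*)%C = Re x. Proof. by case: x. Qed.
Lemma Im_conj (x : C) : Im (x^*)%C = - Im x. Proof. by case: x. Qed.
Lemma Re_sum J (r : seq J) (F : J -> C) : Re (\sum_(j <- r) F j) = \sum_(j <- r) Re (F j).
Proof. by elim/big_rec2 : _ => // j x y _ <-; rewrite ReD. Qed.
Lemma Im_sum J (r : seq J) (F : J -> C) : Im (\sum_(j <- r) F j) = \sum_(j <- r) Im (F j).
Proof. by elim/big_rec2 : _ => // j x y _ <-; rewrite ImD. Qed.
Lemma complex_eqP (x y : C) : Re x = Re y -> Im x = Im y -> x = y.
Proof. by case: x => ? ?; case: y => ? ? /= -> ->. Qed.

End complex_parts.

Section weak_derivatives.
Context {R : realType} {d : nat}.
Local Notation C := (R[i]).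
Local Notation Re := (@complex.Re R).
Local Notation Im := (@complex.Im R).
Local Notation E := 'rV[R]_d.
Local Notation mu := (leb R d).
Implicit Types (U B : set E) (f g : E -> C).

Definition of_real (phi : E -> R) : E -> C := fun x => Complex (phi x) 0.

Lemma smooth_cst0 : smooth (fun=> 0 : R) (d := d).
Proof. by apply/smoothP; exact: sm_cst. Qed.

Lemma csmooth_of_real phi : sm dirs phi -> csmooth (of_real phi).
Proof. by move=> sp; split; [exact/smoothP|exact: smooth_cst0]. Qed.

Lemma supported_of_real U phi : supp_in U phi -> supported_in U (of_real phi).
Proof. by move=> [K [cK KU fK]]; exists K; split => // x /fK; rewrite /of_real => ->. Qed.

Lemma partial_mi0 k (a : mindex d k) : partial_mi a (fun=> 0 : R) = (fun=> 0).
Proof.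
rewrite partial_miE; elim: (seq_mi a) => //= i s ->.
exact: (pd_cst _ i 0).
Qed.

Lemma cint_of_real U g phi :
  cint U (fun x => g x * of_real phi x) =
  Complex (\int[mu]_(x in U) (Re (g x) * phi x)) (\int[mu]_(x in U) (Im (g x) * phi x)).
Proof.
rewrite /cint; congr Complex; apply: eq_Rintegral => x _.
  by rewrite ReM /= mulr0 subr0.
by rewrite ImM /= mulr0 add0r.
Qed.

Lemma loc_integrable_Re U f : loc_integrable U f -> locally_integrable U (Re \o f).
Proof. by move=> [[mr mi] l]; split => // K cK KU; have [] := l K cK KU. Qed.

Lemma loc_integrable_Im U f : loc_integrable U f -> locally_integrable U (Im \o f).
Proof. by move=> [[mr mi] l]; split => // K cK KU; have [] := l K cK KU. Qed.

Lemma locally_integrableB U (h1 h2 : E -> R) :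
  measurable U -> locally_integrable U h1 -> locally_integrable U h2 ->
  locally_integrable U (fun x => h1 x - h2 x).
Proof.
move=> mU [m1 l1] [m2 l2]; split; first exact: measurable_funB.
move=> K cK KU; apply: integrable_sub; [exact: compact_measurable_rV|exact: l1|exact: l2].
Qed.

(** A test function is bounded with compact support in [U]. *)
Lemma locally_integrableM U (h phi : E -> R) : measurable U ->
  locally_integrable U h -> sm dirs phi -> supp_in U phi ->
  mu.-integrable U (EFin \o (fun x => h x * phi x)).
Proof.
move=> mU [mh lh] sp [K [cK KU pK]].
have mK : measurable K by exact: compact_measurable_rV.
have mp := @sm_measurable R d _ U sp.
have [M HM] : exists M : R, forall x, `|phi x| <= M.
  by apply: cc_bounded; apply: (cc_supp _ cK pK); exact: sm_cont.
have iK : mu.-integrable K (EFin \o (fun x => h x * phi x)).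
  apply: (@le_integrable _ _ _ mu K mK _ (EFin \o (fun x => M * h x))).
  - apply/measurable_EFinP; apply: measurable_funM; first exact: measurable_funS mh.
    exact (@sm_measurable R d _ K sp).
  - move=> x _; rewrite lee_fin !normrM mulrC; apply: ler_wpM2r => //.
    exact: le_trans (HM x) (ler_norm M).
  - by apply: integrable_cstM => //; exact: lh.
have -> : EFin \o (fun x => h x * phi x) = (EFin \o (fun x => h x * phi x)) \_ K.
  apply/funext => x; rewrite patchE; case: ifPn => //.
  by rewrite notin_setE => /pK /= ->; rewrite mulr0.
have := (integrable_mkcond _ mK).1 iK.
exact: integrableS.
Qed.

(** Test functions integrate against both sides, so the difference can be
    tested. *)
Lemma du_bois_reymond_eq U (h1 h2 : E -> R) : open U ->
  locally_integrable U h1 -> locally_integrable U h2 ->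
  (forall phi, sm dirs phi -> supp_in U phi ->
    \int[mu]_(x in U) (h1 x * phi x) = \int[mu]_(x in U) (h2 x * phi x)) ->
  {ae mu, forall x, U x -> h1 x = h2 x}.
Proof.
move=> oU l1 l2 e12; have mU := open_measurable_rV oU.
have := @du_bois_reymond R d U (fun x => h1 x - h2 x) oU (locally_integrableB mU l1 l2).
move=> H; have {}H : {ae mu, forall x, U x -> h1 x - h2 x = 0}.
  apply: H => phi sp up; under eq_Rintegral do rewrite mulrBl.
  rewrite RintegralB//; [|exact: locally_integrableM|exact: locally_integrableM].
  by rewrite e12// subrr.
by apply: filterS H => x Hx Ux; apply/eqP; rewrite -subr_eq0 Hx.
Qed.

(** Real test functions separate the real and imaginary parts. *)
Lemma wderiv_unique U k (a : mindex d k) f g1 g2 : open U ->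
  is_wderiv U a f g1 -> is_wderiv U a f g2 ->
  {ae mu, forall x, U x -> g1 x = g2 x}.
Proof.
move=> oU [_ l1 e1] [_ l2 e2].
have E phi : sm dirs phi -> supp_in U phi ->
    cint U (fun x => g1 x * of_real phi x) = cint U (fun x => g2 x * of_real phi x).
  move=> sp up; have s1 := csmooth_of_real sp; have s2 := supported_of_real up.
  have := e1 _ s1 s2; rewrite (e2 _ s1 s2).
  have n0 : (-1 : C) ^+ k != 0 by rewrite expf_neq0// oppr_eq0 oner_neq0.
  by move=> /(mulfI n0) ->.
have aer : {ae mu, forall x, U x -> (Re \o g1) x = (Re \o g2) x}.
  apply: du_bois_reymond_eq => //; [exact: loc_integrable_Re|exact: loc_integrable_Re|].
  by move=> phi sp up; have := E phi sp up; rewrite !cint_of_real => -[].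
have aei : {ae mu, forall x, U x -> (Im \o g1) x = (Im \o g2) x}.
  apply: du_bois_reymond_eq => //; [exact: loc_integrable_Im|exact: loc_integrable_Im|].
  by move=> phi sp up; have := E phi sp up; rewrite !cint_of_real => -[].
apply: filterS2 aer aei => x Hr Hi Ux.
exact: complex_eqP (Hr Ux) (Hi Ux).
Qed.

Lemma wderiv_ae U k (a : mindex d k) f g : open U -> is_wderiv U a f g ->
  is_wderiv U a f (wderiv U a f) /\ {ae mu, forall x, U x -> wderiv U a f x = g x}.
Proof.
move=> oU wg.
have H : is_wderiv U a f (wderiv U a f).
  by rewrite /wderiv; apply: (@xgetPex _ _ [set g | is_wderiv U a f g]); exists g.
by split => //; exact: wderiv_unique H wg.
Qed.

Lemma Rintegral_widen (U B : set E) (h1 h2 : E -> R) : U `<=` B ->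
  (forall x, U x -> h1 x = h2 x) -> (forall x, B x -> ~ U x -> h2 x = 0) ->
  \int[mu]_(x in U) h1 x = \int[mu]_(x in B) h2 x.
Proof.
move=> UB h12 h20; rewrite Rintegral_mkcond [RHS]Rintegral_mkcond.
apply: eq_Rintegral => x _; rewrite !patchE.
have [xU|/negP xU] := boolP (x \in U).
  by rewrite ifT; [exact/h12/set_mem|exact/mem_set/UB/set_mem].
by case: ifP => // /set_mem xB; rewrite h20// => /mem_set.
Qed.

Lemma cint_widen (U B : set E) (h1 h2 : E -> C) : U `<=` B ->
  (forall x, U x -> h1 x = h2 x) -> (forall x, ~ U x -> h2 x = 0) ->
  cint U h1 = cint B h2.
Proof.
move=> UB h12 h20; rewrite /cint; congr Complex; apply: Rintegral_widen => //.
- by move=> x /h12 ->.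
- by move=> x _ /h20 ->.
- by move=> x /h12 ->.
- by move=> x _ /h20 ->.
Qed.

Lemma loc_integrableS U B f : measurable U -> measurable B -> U `<=` B ->
  loc_integrable B f -> loc_integrable U f.
Proof.
move=> mU mB UB [[mr mi] l]; split.
  by split; [exact: measurable_funS mr|exact: measurable_funS mi].
by move=> K cK KU; apply: l => //; exact: subset_trans KU UB.
Qed.

Lemma eq_loc_integrable U f g : (forall x, U x -> f x = g x) ->
  loc_integrable U f -> loc_integrable U g.
Proof.
move=> fg [[mr mi] l]; split.
  split; [apply: eq_measurable_fun mr|apply: eq_measurable_fun mi];
  by move=> x /set_mem /fg /= ->.
move=> K cK KU; have [ir ii] := l K cK KU.
have mK := compact_measurable_rV cK.
split; [apply: eq_integrable ir => //|apply: eq_integrable ii => //];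
by move=> x /set_mem /KU /fg /= ->.
Qed.

(** A test function on the smaller set is one on the larger set, and it vanishes
    where the zero extension acts. *)
Lemma is_wderiv_restrict U B k (a : mindex d k) f g : open U -> open B -> U `<=` B ->
  is_wderiv B a (zero_ext U f) g -> is_wderiv U a f g.
Proof.
move=> oU oB UB [lf lg eq_]; have mU := open_measurable_rV oU; have mB := open_measurable_rV oB.
have zE x : U x -> zero_ext U f x = f x by move=> Ux; rewrite /zero_ext /patch mem_set.
split.
- by apply: eq_loc_integrable zE _; exact: loc_integrableS lf.
- exact: loc_integrableS lg.
move=> phi sp [K [cK KU pK]].
have cK' : closed K by exact: compact_closed.
have := eq_ phi sp; rewrite -(@cint_widen U B (fun x => f x * cpartial a phi x)) //; last 2 first.
- by move=> x Ux; rewrite zE.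
- by move=> x Ux; rewrite /zero_ext /patch memNset// mul0r.
rewrite -(@cint_widen U B (fun x => g x * phi x)) //; last first.
  by move=> x Ux; rewrite pK ?mulr0// => /KU.
by apply; exists K; split => //; exact: subset_trans KU UB.
Qed.

End weak_derivatives.

(** * The pointwise comparison of the two pairings *)

Section pointwise.
Context {R : realType}.
Local Notation C := (R[i]).
Local Notation Re := (@complex.Re R).
Local Notation Im := (@complex.Im R).

Lemma young (t x y : R) : 0 < t -> x * y <= t / 2 * x ^+ 2 + t^-1 / 2 * y ^+ 2.
Proof.
move=> t0; rewrite -subr_ge0 [leRHS](_ : _ = t^-1 / 2 * (t * x - y) ^+ 2).
  by rewrite mulr_ge0 ?sqr_ge0// divr_ge0// invr_ge0 ltW.
by field; rewrite gt_eqF.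
Qed.

Lemma young_sqr (t s e x y : R) : 0 < t -> 0 <= e -> x ^+ 2 <= s ^+ 2 * e ->
  x * y <= t / 2 * (s ^+ 2 * y ^+ 2) + t^-1 / 2 * e.
Proof.
move=> t0 e0 xs.
have A0 : 0 <= t / 2 * (s ^+ 2 * y ^+ 2) + t^-1 / 2 * e.
  have t0' := ltW t0.
  apply: addr_ge0; apply: mulr_ge0; rewrite ?divr_ge0 ?invr_ge0//.
  by rewrite mulr_ge0 ?sqr_ge0.
have [xy|xy] := leP (x * y) 0; first exact: le_trans xy A0.
rewrite -(ler_pXn2r (n := 2)) ?nnegrE ?(ltW xy)//.
apply: (@le_trans _ _ (s ^+ 2 * e * y ^+ 2)).
  by rewrite exprMn ler_wpM2r ?sqr_ge0.
rewrite -subr_ge0 [leRHS](_ : _ = (t / 2 * (s ^+ 2 * y ^+ 2) - t^-1 / 2 * e) ^+ 2) ?sqr_ge0//.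
by field; rewrite gt_eqF.
Qed.

(** With [p] a component of [grad^m f], the first product is one of
    [grad^m (psi f)] with [A grad^m (psi f)] and the second one of
    [grad^m (psi^2 f)] with the defect of the equation.  The main terms
    [psi^2 p bp] cancel; the others are treated by Young's inequality, where the
    factor [psi^2] in the bound of [Q'] is what keeps the error in terms of
    [psi p] and [psi bp]. *)
Lemma component_inequality (psi p Q Q' bp bQ bH F e1 e2 e : R) :
  0 <= psi <= 1 -> 0 < e1 -> 0 < e2 -> 0 <= e ->
  Q ^+ 2 <= e -> Q' ^+ 2 <= psi ^+ 2 * e ->
  (psi * p + Q) * (psi * bp + bQ) - (psi ^+ 2 * p + Q') * (bp + bH - F) <=
  e1 * (psi ^+ 2 * p ^+ 2) + e2 * (psi ^+ 2 * bp ^+ 2) +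
  (e1^-1 + e2^-1 + 1) * (bQ ^+ 2 + e + bH ^+ 2 + F ^+ 2).
Proof.
move=> /andP[s0 s1] e10 e20 e0 Qe Q'e.
have e1V : 0 < e1^-1 by rewrite invr_gt0.
have e2V : 0 < e2^-1 by rewrite invr_gt0.
have t1 := young (psi * p) bQ e10.
have t2 : Q * (psi * bp) <= e2 / 2 * (psi ^+ 2 * bp ^+ 2) + e2^-1 / 2 * e.
  have := @young_sqr e2 1 e Q (psi * bp) e20 e0.
  by rewrite !expr1n !mul1r exprMn; apply.
have t3 : Q * bQ <= 1 / 2 * e + 1 / 2 * bQ ^+ 2.
  have := young Q bQ ltr01; rewrite invr1 => /le_trans; apply.
  by rewrite lerD2r ler_wpM2l.
have t4 : - Q' * bp <= e2 / 2 * (psi ^+ 2 * bp ^+ 2) + e2^-1 / 2 * e.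
  by apply: young_sqr => //; rewrite sqrrN.
have p2 : psi ^+ 2 <= 1 by rewrite expr_le1.
have d2 : (bH - F) ^+ 2 <= 2 * (bH ^+ 2 + F ^+ 2).
  by have := sqr_ge0 (bH + F); nra.
have p2d : psi ^+ 2 * (bH - F) ^+ 2 <= 2 * (bH ^+ 2 + F ^+ 2).
  by apply: le_trans d2; rewrite ler_piMl// sqr_ge0.
have t5 : (- (psi * p)) * (psi * (bH - F)) <= e1 / 2 * (psi ^+ 2 * p ^+ 2) +
    e1^-1 * (bH ^+ 2 + F ^+ 2).
  have := young (- (psi * p)) (psi * (bH - F)) e10.
  rewrite sqrrN !exprMn => /le_trans; apply; rewrite lerD2l.
  have := ler_wpM2l (ltW e1V) p2d; lra.
have t6 : - Q' * (bH - F) <= 1 / 2 * e + (bH ^+ 2 + F ^+ 2).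
  have := @young_sqr 1 psi e (- Q') (bH - F) ltr01 e0.
  rewrite sqrrN => /(_ Q'e); rewrite invr1; lra.
have E : (psi * p + Q) * (psi * bp + bQ) - (psi ^+ 2 * p + Q') * (bp + bH - F) =
  (psi * p) * bQ + Q * (psi * bp) + Q * bQ + - Q' * bp +
  (- (psi * p)) * (psi * (bH - F)) + - Q' * (bH - F) by ring.
rewrite E.
have bQ2 : 0 <= bQ ^+ 2 by exact: sqr_ge0.
have bH2 : 0 <= bH ^+ 2 by exact: sqr_ge0.
have F2 : 0 <= F ^+ 2 by exact: sqr_ge0.
have m1 := mulr_ge0 (ltW e1V) bQ2.
have m2 := mulr_ge0 (ltW e2V) bQ2.
have m3 := mulr_ge0 (ltW e1V) e0.
have m4 := mulr_ge0 (ltW e2V) (addr_ge0 bH2 F2).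
rewrite exprMn in t1.
lra.
Qed.

Context {d N m : nat}.
Local Notation arr := (array d N C m).
Implicit Types (X Y G F : arr) (B : coeffs d N C m).

(** The real part of the pairing of two arrays. *)
Definition rdot X Y : R := \sum_(j < N) \sum_(a : mindex d m)
  (Re (X j a) * Re (Y j a) + Im (X j a) * Im (Y j a)).

Definition asub X Y : arr := fun j a => X j a - Y j a.

Lemma asqn_ge0 k (G : array d N C k) : 0 <= asqn G.
Proof.
by apply: sumr_ge0 => j _; apply: sumr_ge0 => a _; rewrite addr_ge0 ?sqr_ge0.
Qed.

Lemma le_asqn k (G : array d N C k) j a : sqn (G j a) <= asqn G.
Proof.
have s0 (z : C) : 0 <= sqn z by rewrite addr_ge0 ?sqr_ge0.
rewrite /asqn (bigD1 j)//= (bigD1 a)//= -addrA lerDl addr_ge0//.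
  by apply: sumr_ge0 => b _.
by apply: sumr_ge0 => l _; apply: sumr_ge0 => b _.
Qed.

Definition bounded_by B (Lam : R) := forall G, asqn (cmul B G) <= Lam ^+ 2 * asqn G.

Lemma cmul_scale_add B (s : R) X Y j a :
  cmul B (fun k b => Complex s 0 * X k b + Y k b) j a =
  Complex s 0 * cmul B X j a + cmul B Y j a.
Proof.
rewrite /cmul mulr_sumr -big_split /=; apply: eq_bigr => k _.
rewrite mulr_sumr -big_split /=; apply: eq_bigr => b _.
by rewrite mulrDr !mulrA [B _ _ _ _ * _]mulrC.
Qed.

Lemma cmul_sub B X Y j a : cmul B (asub X Y) j a = cmul B X j a - cmul B Y j a.
Proof.
rewrite /cmul -sumrB; apply: eq_bigr => k _; rewrite -sumrB.
by apply: eq_bigr => b _; rewrite mulrBr.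
Qed.

(** By homogeneity from the unit ball; a zero array is treated apart. *)
Lemma opnorm_bounded B (Lam : R) : 0 <= Lam -> (opnorm B <= Lam%:E)%E -> bounded_by B Lam.
Proof.
move=> L0 BL G.
have unit_ball X : asqn X <= 1 -> asqn (cmul B X) <= Lam ^+ 2.
  move=> X1; have : ((Num.sqrt (asqn (cmul B X)))%:E <= Lam%:E)%E.
    by apply: le_trans BL; apply: ereal_sup_ubound; exists X.
  rewrite lee_fin => H; rewrite -[leLHS]sqr_sqrtr ?asqn_ge0//.
  by rewrite lerXn2r ?nnegrE ?sqrtr_ge0.
have scale (s : R) X : asqn (fun k b => Complex s 0 * X k b) = s ^+ 2 * asqn X.
  rewrite /asqn mulr_sumr; apply: eq_bigr => k _; rewrite mulr_sumr.
  by apply: eq_bigr => b _; rewrite /sqn ReM ImM /=; ring.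
have cscale (s : R) X : cmul B (fun k b => Complex s 0 * X k b) =
    (fun j a => Complex s 0 * cmul B X j a).
  apply/funext => j; apply/funext => a; rewrite /cmul mulr_sumr.
  apply: eq_bigr => k _; rewrite mulr_sumr; apply: eq_bigr => b _.
  by rewrite mulrCA.
have [G0|G0] := eqVneq (asqn G) 0.
  have Gz : G = fun k b => 0.
    apply/funext => k; apply/funext => b.
    have : sqn (G k b) = 0.
      apply/eqP; rewrite eq_le -{1}G0 le_asqn/= addr_ge0 ?sqr_ge0//.
    rewrite /sqn => /eqP; rewrite paddr_eq0 ?sqr_ge0// !sqrf_eq0 => /andP[/eqP ? /eqP ?].
    exact: complex_eqP.
  rewrite G0 mulr0 /asqn big1// => j _; rewrite big1// => a _.
  rewrite /cmul big1 ?big1//; first by rewrite /sqn /= expr0n addr0.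
  by move=> k _; rewrite big1// => b _; rewrite Gz mulr0.
have Gp : 0 < asqn G by rewrite lt_neqAle eq_sym G0 asqn_ge0.
set s := (Num.sqrt (asqn G))^-1.
have s2 : s ^+ 2 = (asqn G)^-1 by rewrite /s exprVn sqr_sqrtr// ltW.
have := unit_ball (fun k b => Complex s 0 * G k b).
rewrite scale s2 mulVf// => /(_ (lexx _)); rewrite cscale scale s2.
by rewrite mulrC ler_pdivrMr.
Qed.

(** From [component_inequality] with [e1 = eps / 2] and [e2] such that
    [e2 * Lam^2 = eps / 2]. *)
Definition absorb_const (eps Lam : R) : R :=
  ((eps / 2)^-1 + (eps / (2 * Lam ^+ 2))^-1 + 1) * (2 * Lam ^+ 2 + 2).

(** [P] and [P2] stand for the gradients of [psi f] and [psi^2 f], [X] for that of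
    [f], and [G] for the array in the equation.  Boundedness of [B] turns the
    terms in [B X] into multiples of [psi^2 |X|^2]. *)
Lemma array_inequality B (Lam eps psi : R) X P P2 G F (e : 'I_N -> mindex d m -> R) :
  0 < Lam -> 0 < eps -> 0 <= psi <= 1 -> bounded_by B Lam -> (forall j a, 0 <= e j a) ->
  (forall j a, (Re (P j a) - psi * Re (X j a)) ^+ 2 <= e j a /\
               (Im (P j a) - psi * Im (X j a)) ^+ 2 <= e j a) ->
  (forall j a, (Re (P2 j a) - psi ^+ 2 * Re (X j a)) ^+ 2 <= psi ^+ 2 * e j a /\
               (Im (P2 j a) - psi ^+ 2 * Im (X j a)) ^+ 2 <= psi ^+ 2 * e j a) ->
  rdot P (cmul B P) - rdot P2 (asub (cmul B G) F) <=
  eps * (psi ^+ 2 * asqn X) + absorb_const eps Lam *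
    (\sum_j \sum_a e j a + asqn (asub G X) + asqn F).
Proof.
move=> L0 eps0 psi01 BL e0 HP HP2.
pose Q : arr := fun j a => P j a - Complex psi 0 * X j a.
have PE : P = fun j a => Complex psi 0 * X j a + Q j a.
  by apply/funext => j; apply/funext => a; rewrite /Q addrC subrK.
have ReQ j a : Re (Q j a) = Re (P j a) - psi * Re (X j a).
  by rewrite /Q ReD ReN ReM /= mul0r subr0.
have ImQ j a : Im (Q j a) = Im (P j a) - psi * Im (X j a).
  by rewrite /Q ImD ImN ImM /= mul0r addr0.
set e1 := eps / 2; set e2 := eps / (2 * Lam ^+ 2).
have e10 : 0 < e1 by rewrite divr_gt0.
have L2 : 0 < 2 * Lam ^+ 2 by rewrite mulr_gt0// exprn_gt0.
have e20 : 0 < e2 by rewrite divr_gt0.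
set K := e1^-1 + e2^-1 + 1.
have K0 : 0 <= K by rewrite !addr_ge0// invr_ge0 ltW.
set BX := cmul B X; set BQ := cmul B Q; set BH := cmul B (asub G X).
have BPE j a : cmul B P j a = Complex psi 0 * BX j a + BQ j a.
  by rewrite {1}PE cmul_scale_add.
have BGE j a : cmul B G j a = BX j a + BH j a.
  by rewrite /BH cmul_sub addrC subrK.
have comp j a :
  (Re (P j a) * Re (cmul B P j a) + Im (P j a) * Im (cmul B P j a)) -
  (Re (P2 j a) * Re (asub (cmul B G) F j a) + Im (P2 j a) * Im (asub (cmul B G) F j a)) <=
  e1 * (psi ^+ 2 * sqn (X j a)) + e2 * (psi ^+ 2 * sqn (BX j a)) +
  K * (sqn (BQ j a) + 2 * e j a + sqn (BH j a) + sqn (F j a)).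
  have [h1 h2] := HP j a; have [h3 h4] := HP2 j a.
  have := component_inequality (Re (X j a)) (Re (BX j a)) (Re (BQ j a))
    (Re (BH j a)) (Re (F j a)) psi01 e10 e20 (e0 j a) h1 h3.
  have := component_inequality (Im (X j a)) (Im (BX j a)) (Im (BQ j a))
    (Im (BH j a)) (Im (F j a)) psi01 e10 e20 (e0 j a) h2 h4.
  rewrite ![psi * _ + (_ - psi * _)]addrC !subrK.
  rewrite ![psi ^+ 2 * _ + (_ - psi ^+ 2 * _)]addrC !subrK.
  rewrite /asub BPE BGE !(ReD, ImD, ReN, ImN, ReM, ImM) /= !mul0r subr0 addr0 /sqn -/K.
  lra.
rewrite /rdot -sumrB.
apply: (@le_trans _ _ (\sum_j \sum_a (e1 * (psi ^+ 2 * sqn (X j a)) + e2 * (psi ^+ 2 * sqn (BX j a)) +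
  K * (sqn (BQ j a) + 2 * e j a + sqn (BH j a) + sqn (F j a))))).
  by apply: ler_sum => j _; rewrite -sumrB; apply: ler_sum => a _; exact: comp.
have sums (f g h i k l : 'I_N -> mindex d m -> R) (c : R) :
  \sum_j \sum_a (e1 * (c * f j a) + e2 * (c * g j a) +
     K * (h j a + 2 * i j a + k j a + l j a)) =
  e1 * (c * \sum_j \sum_a f j a) + e2 * (c * \sum_j \sum_a g j a) +
     K * (\sum_j \sum_a h j a + 2 * \sum_j \sum_a i j a +
          \sum_j \sum_a k j a + \sum_j \sum_a l j a).
  have sum2 (f' : 'I_N -> mindex d m -> R) (c' : R) :
    \sum_j \sum_a (c' * f' j a) = c' * \sum_j \sum_a f' j a.
    by rewrite mulr_sumr; apply: eq_bigr => j _; rewrite mulr_sumr.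
  have sumD (f' g' : 'I_N -> mindex d m -> R) :
    \sum_j \sum_a (f' j a + g' j a) = \sum_j \sum_a f' j a + \sum_j \sum_a g' j a.
    by rewrite -big_split; apply: eq_bigr => j _; rewrite -big_split.
  by rewrite !sumD !sum2 !sumD !sum2.
rewrite (sums (fun j a => sqn (X j a)) (fun j a => sqn (BX j a)) (fun j a => sqn (BQ j a)) e
  (fun j a => sqn (BH j a)) (fun j a => sqn (F j a)) (psi ^+ 2)).
rewrite -/(asqn X) -/(asqn BX) -/(asqn BQ) -/(asqn BH) -/(asqn F).
set S := \sum_j \sum_a e j a.
have S0 : 0 <= S by apply: sumr_ge0 => j _; apply: sumr_ge0.
have hX : asqn BX <= Lam ^+ 2 * asqn X by exact: BL.
have hH : asqn BH <= Lam ^+ 2 * asqn (asub G X) by exact: BL.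
have hQ : asqn BQ <= Lam ^+ 2 * (2 * S).
  apply: (le_trans (BL Q)); rewrite ler_wpM2l ?sqr_ge0//.
  rewrite /asqn /S mulr_sumr; apply: ler_sum => j _; rewrite mulr_sumr.
  apply: ler_sum => a _; rewrite /sqn ReQ ImQ; have [h1 h2] := HP j a; lra.
have psi2 : 0 <= psi ^+ 2 by exact: sqr_ge0.
have X0 := asqn_ge0 X; have H0 := asqn_ge0 (asub G X); have F0 := asqn_ge0 F.
have L20 : 0 <= Lam ^+ 2 by exact: sqr_ge0.
have i1 : e2 * (psi ^+ 2 * asqn BX) <= eps / 2 * (psi ^+ 2 * asqn X).
  have := ler_wpM2l (ltW e20) (ler_wpM2l psi2 hX).
  rewrite [X in _ <= X -> _](_ : _ = eps / 2 * (psi ^+ 2 * asqn X)); first by [].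
  by rewrite /e2; field; rewrite gt_eqF.
have i2 : K * (asqn BQ + 2 * S + asqn BH + asqn F) <=
   K * ((2 * Lam ^+ 2 + 2) * (S + asqn (asub G X) + asqn F)).
  rewrite ler_wpM2l//.
  have j1 := mulr_ge0 L20 S0; have j2 := mulr_ge0 L20 H0; have j3 := mulr_ge0 L20 F0.
  rewrite !mulrDl !mulrDr; lra.
rewrite /absorb_const -/e1 -/e2 -/K.
apply: (@le_trans _ _ (eps / 2 * (psi ^+ 2 * asqn X) + eps / 2 * (psi ^+ 2 * asqn X) +
  K * ((2 * Lam ^+ 2 + 2) * (S + asqn (asub G X) + asqn F)))).
  by apply: lerD => //; apply: lerD.
by rewrite [K * (_ * _)]mulrA -[X in X + _ <= _]mulrDl -splitr.
Qed.

End pointwise.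

(** * Uniform estimates for the cutoffs *)

Section cutoff_package.
Context {R : realType} {d : nat}.
Local Notation E := 'rV[R]_d.
Local Notation Ds := (Dseq (@dirs R d)).

(** One constant for all balls: the estimates of [theta] depend on the radii through
    [b] only. *)
Lemma cutoff_estimates (m : nat) : (0 < m)%N -> exists2 K : R, 0 < K &
  forall (x0 : E) (r rho : R), 0 < r -> r < rho ->
  let b := (rho - r)^-1 in
  let th := theta x0 r rho in
  [/\ forall i x, `|pd dirs i th x| <= K * b,
      forall i x, `|pd dirs i (zeta th) x| <= K * b &
      forall g x s, sm dirs g -> size s = m ->
        (Ds s (psi m th * g) x - psi m th x * Ds s g x) ^+ 2 <=
          K * lower_order dirs m b (zeta th x) g x /\
        (Ds s (psi m th * psi m th * g) x - psi m th x ^+ 2 * Ds s g x) ^+ 2 <=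
          psi m th x ^+ 2 * (K * lower_order dirs m b (zeta th x) g x)].
Proof.
move=> m0; have [M M0 HM] := @Dseq_step_bounded R m.
pose C1 := comp_const m 4 M.
have C10 : 0 <= C1 by exact: comp_const_ge0.
pose K2 := flat_const m C1 * 2 ^+ m.+1.
have K20 : 0 <= K2 by rewrite mulr_ge0 ?exprn_ge0// flat_const_ge0.
pose K3 := 2 ^+ m * (K2 + K2 ^+ 2).
have K30 : 0 <= K3 by rewrite mulr_ge0 ?exprn_ge0// addr_ge0 ?sqr_ge0.
pose K := 1 + C1 + (2 ^+ m * K2) ^+ 2 + (2 ^+ m * K3) ^+ 2.
have KC1 : C1 <= K.
  rewrite /K -addrA -addrA [1 + _]addrC -!addrA lerDl !addr_ge0 ?sqr_ge0//.
have KK2 : (2 ^+ m * K2) ^+ 2 <= K.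
  by rewrite /K -addrA [_ + (_ + _)]addrC -!addrA lerDl !addr_ge0 ?sqr_ge0.
have KK3 : (2 ^+ m * K3) ^+ 2 <= K by rewrite /K lerDr !addr_ge0 ?sqr_ge0.
have K0 : 0 < K.
  by rewrite /K -!addrA ltr_pwDl// !addr_ge0 ?sqr_ge0.
exists K => // x0 r rho r0 rrho b th.
have b0 : 0 <= b by rewrite invr_ge0 subr_ge0 ltW.
have sth : sm dirs th by exact: sm_theta.
have th01 x : 0 <= th x <= 1 by rewrite theta_ge0 theta_le1.
have oth x s : (size s <= m)%N -> `|Ds s th x| <= C1 * b ^+ size s.
  move=> sm_; have o01 : 0 <= (1 : R) <= 1 by rewrite ler01 lexx.
  have := @theta_ordb R d x0 r rho r0 rrho m M x 1 M0 o01 HM s sm_.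
  by rewrite expr1n mulr1.
have dth i x : `|pd dirs i th x| <= C1 * b.
  by have := oth x [:: i] m0; rewrite expr1.
split.
- by move=> i x; apply: le_trans (dth i x) _; rewrite ler_wpM2r.
- move=> i x; rewrite /zeta pdM//; last by apply: smB => //; exact: sm_cst.
  have -> : (th * pd dirs i (cst 1 - th) + (cst 1 - th) * pd dirs i th) x =
      (1 - 2 * th x) * pd dirs i th x.
    have -> : (th * pd dirs i (cst 1 - th) + (cst 1 - th) * pd dirs i th) x =
      th x * pd dirs i (cst 1 - th) x + (1 - th x) * pd dirs i th x by [].
    have -> : pd dirs i (cst 1 - th) x = - pd dirs i th x.
      exact: (@Dseq_onem _ _ _ dirs [:: i]).
    by ring.
  have /andP[t0 t1] := th01 x.
  rewrite normrM; apply: le_trans (_ : 1 * (C1 * b) <= _); last first.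
    by rewrite mul1r ler_wpM2r.
  apply: ler_pM => //; rewrite ler_norml; apply/andP; split; lra.
move=> g x s sg sm_.
have /andP[z0 z1] := zeta01 th01 x; have /andP[p0 p1] := psi01 m th01 x.
have W0 := lower_order_ge0 dirs m g x b0 z0.
have sp : sm dirs (psi m th) by exact: sm_psi.
have D1 := psi_deriv sth th01 b0 C10 (oth x).
have D2 := psi2_deriv sth th01 b0 C10 (oth x).
split.
  apply: (le_trans (leibniz_remainder b0 z0 K20 sp sg sm_ D1)).
  by rewrite ler_wpM2r.
have K3p : 0 <= K3 * psi m th x by rewrite mulr_ge0.
have := leibniz_remainder b0 z0 K3p (smM sp sp) sg sm_ D2.
have -> : (psi m th * psi m th) x = psi m th x ^+ 2 by rewrite expr2.
move=> /le_trans; apply; rewrite mulrA exprMn exprMn mulrAC mulrC.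
rewrite [leLHS](_ : _ = psi m th x ^+ 2 * ((2 ^+ m * K3) ^+ 2 * lower_order dirs m b (zeta th x) g x)); last by ring.
by rewrite ler_wpM2l ?sqr_ge0// ler_wpM2r.
Qed.

End cutoff_package.

(** * Almost everywhere relations and complex integrands *)

Section ae_integrals.
Context d (T : measurableType d) (R : realType) (mu : {measure set T -> \bar R}).
Variable D : set T.
Hypothesis mD : measurable D.

Lemma integrable_ae_le (f g : T -> R) : measurable_fun D f ->
  mu.-integrable D (EFin \o g) -> {ae mu, forall x, D x -> `|f x| <= g x} ->
  mu.-integrable D (EFin \o f).
Proof.
move=> mf ig fg; apply/integrableP; split; first exact/measurable_EFinP.
have /integrableP[mg gfin] := ig.
apply: le_lt_trans gfin; apply: ae_ge0_le_integral => //.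
- by do 2 apply: measurableT_comp => //.
- exact: measurableT_comp.
- apply: filterS fg => x H Dx; rewrite lee_fin.
  by apply: le_trans (H Dx) (ler_norm _).
Qed.

Lemma Rintegral_ae_eq (f g : T -> R) : measurable_fun D f -> measurable_fun D g ->
  {ae mu, forall x, D x -> f x = g x} -> \int[mu]_(x in D) f x = \int[mu]_(x in D) g x.
Proof.
move=> mf mg fg; rewrite /Rintegral; congr fine; apply: ae_eq_integral => //.
- exact/measurable_EFinP.
- exact/measurable_EFinP.
- by apply: filterS fg => x H Dx; rewrite H.
Qed.

Lemma Rintegral_ae_le (f g : T -> R) : mu.-integrable D (EFin \o f) ->
  mu.-integrable D (EFin \o g) -> {ae mu, forall x, D x -> f x <= g x} ->
  \int[mu]_(x in D) f x <= \int[mu]_(x in D) g x.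
Proof.
move=> fi gi fg.
have mf : measurable_fun D f by apply/measurable_EFinP; exact: (measurable_int _ fi).
have mg : measurable_fun D g by apply/measurable_EFinP; exact: (measurable_int _ gi).
have mh : measurable_fun D (fun x => Num.min (f x) (g x)) by exact: measurable_minr.
rewrite (@Rintegral_ae_eq f (fun x => Num.min (f x) (g x)))//; last first.
  by apply: filterS fg => x H Dx; rewrite min_l// H.
apply: le_Rintegral => //; last by move=> x Dx; rewrite ge_min lexx orbT.
apply: (@integrable_ae_le _ (fun x => `|f x|)) => //; first exact: integrable_norm.
by apply: filterS fg => x H Dx; rewrite min_l// H.
Qed.

End ae_integrals.

Section complex_integrals.
Context {R : realType} {d : nat}.
Local Notation C := (R[i]).
Local Notation Re := (@complex.Re R).
Local Notation Im := (@complex.Im R).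
Local Notation E := 'rV[R]_d.
Local Notation mu := (leb R d).

Lemma sqn_ge0 (z : C) : 0 <= sqn z. Proof. by rewrite addr_ge0 ?sqr_ge0. Qed.

Lemma cmeasurable_mul D (f g : E -> C) : cmeasurable D f -> cmeasurable D g ->
  cmeasurable D (fun x => f x * g x).
Proof.
move=> [fr fi] [gr gi]; split.
  rewrite (_ : Re \o _ = fun x => (Re \o f) x * (Re \o g) x - (Im \o f) x * (Im \o g) x).
    by apply: measurable_funB; apply: measurable_funM.
  by apply/funext => x /=; rewrite ReM.
rewrite (_ : Im \o _ = fun x => (Re \o f) x * (Im \o g) x + (Im \o f) x * (Re \o g) x).
  by apply: measurable_funD; apply: measurable_funM.
by apply/funext => x /=; rewrite ImM.
Qed.

Lemma cmeasurable_sub D (f g : E -> C) : cmeasurable D f -> cmeasurable D g ->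
  cmeasurable D (fun x => f x - g x).
Proof.
move=> [fr fi] [gr gi]; split.
  rewrite (_ : Re \o _ = fun x => (Re \o f) x - (Re \o g) x); first exact: measurable_funB.
  by apply/funext => x /=; rewrite ReD ReN.
rewrite (_ : Im \o _ = fun x => (Im \o f) x - (Im \o g) x); first exact: measurable_funB.
by apply/funext => x /=; rewrite ImD ImN.
Qed.

Lemma cmeasurable_sum D J (s : seq J) (F : J -> E -> C) : (forall j, cmeasurable D (F j)) ->
  cmeasurable D (fun x => \sum_(j <- s) F j x).
Proof.
move=> mF; split.
  rewrite (_ : Re \o _ = fun x => \sum_(j <- s) (Re \o F j) x).
    by apply: measurable_sum => j; have [] := mF j.
  by apply/funext => x /=; rewrite Re_sum.
rewrite (_ : Im \o _ = fun x => \sum_(j <- s) (Im \o F j) x).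
  by apply: measurable_sum => j; have [] := mF j.
by apply/funext => x /=; rewrite Im_sum.
Qed.

Lemma cmeasurableS D D' (f : E -> C) : measurable D' -> D `<=` D' ->
  cmeasurable D' f -> cmeasurable D f.
Proof. by move=> mD DD' [? ?]; split; apply: measurable_funS; eauto. Qed.

Lemma cmeasurable_Amul {N m} D (A : coeffs d N (E -> C) m) (H : array d N (E -> C) m) j a :
  measurable D -> measurable_coeffs A -> (forall k b, cmeasurable D (H k b)) ->
  cmeasurable D (Amul A H j a).
Proof.
move=> mD mA mH; rewrite /Amul /cmul /aval /coeff_at.
apply: cmeasurable_sum => k; apply: cmeasurable_sum => b.
by apply: cmeasurable_mul => //; apply: cmeasurableS (mA j k a b).
Qed.

Lemma measurable_sqn D (f : E -> C) : cmeasurable D f -> measurable_fun D (fun x => sqn (f x)).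
Proof.
move=> [fr fi]; rewrite /sqn; apply: measurable_funD;
 by under eq_fun do rewrite expr2; exact: measurable_funM.
Qed.

Lemma L2fun_integrable D (f : E -> C) : measurable D -> L2fun D f ->
  mu.-integrable D (EFin \o (fun x => sqn (f x))).
Proof.
move=> mD [mf fin]; apply/integrableP; split.
  by apply/measurable_EFinP; exact: measurable_sqn.
apply: le_lt_trans fin; rewrite le_eqVlt; apply/orP; left; apply/eqP.
by apply: eq_integral => x _; rewrite gee0_abs// lee_fin sqn_ge0.
Qed.

Lemma sqn_sub_le (x y : C) : sqn (x - y) <= 2 * sqn x + 2 * sqn y.
Proof.
rewrite /sqn ReD ImD ReN ImN.
have := sqr_ge0 (Re x + Re y); have := sqr_ge0 (Im x + Im y); nra.
Qed.

Lemma sqn_le_split (x y : C) : sqn x <= 2 * sqn y + 2 * sqn (x - y).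
Proof.
rewrite /sqn ReD ImD ReN ImN.
have := sqr_ge0 (Re x - 2 * Re y); have := sqr_ge0 (Im x - 2 * Im y); nra.
Qed.

Lemma Re_cdot (x y : C) : Re ((x^*)%C * y) = Re x * Re y + Im x * Im y.
Proof. by rewrite ReM Re_conj Im_conj mulNr opprK. Qed.

Lemma cdot_le (x y : C) : `|Re x * Re y + Im x * Im y| <= sqn x + sqn y.
Proof.
rewrite ler_norml /sqn; apply/andP; split.
- have := sqr_ge0 (Re x + Re y); have := sqr_ge0 (Im x + Im y).
  have := sqr_ge0 (Re x); have := sqr_ge0 (Im x).
  have := sqr_ge0 (Re y); have := sqr_ge0 (Im y); nra.
- have := sqr_ge0 (Re x - Re y); have := sqr_ge0 (Im x - Im y).
  have := sqr_ge0 (Re x); have := sqr_ge0 (Im x).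
  have := sqr_ge0 (Re y); have := sqr_ge0 (Im y); nra.
Qed.

Lemma integrable_asqn {N k} D (F : array d N (E -> C) k) : measurable D -> array_L2 D F ->
  mu.-integrable D (EFin \o (fun x => asqn (aval F x))).
Proof.
move=> mD LF; rewrite /asqn /aval.
apply: integrable_sumR => // j; apply: integrable_sumR => // a.
by apply: L2fun_integrable; [|exact: LF].
Qed.

End complex_integrals.

(** * Gradients of smooth fields *)

Section scaled_fields.
Context {R : realType} {d N : nat}.
Local Notation C := (R[i]).
Local Notation Re := (@complex.Re R).
Local Notation Im := (@complex.Im R).
Local Notation E := 'rV[R]_d.
Local Notation mu := (leb R d).
Local Notation Ds := (Dseq (@dirs R d)).
Variable f : 'I_N -> E -> C.

Definition cscale (g : E -> R) : 'I_N -> E -> C :=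
  fun j x => Complex (g x * Re (f j x)) (g x * Im (f j x)).

Lemma Re_grad m j a x : Re (grad m f j a x) = Ds (seq_mi a) (Re \o f j) x.
Proof. by rewrite /grad /cpartial /= partial_miE. Qed.

Lemma Im_grad m j a x : Im (grad m f j a x) = Ds (seq_mi a) (Im \o f j) x.
Proof. by rewrite /grad /cpartial /= partial_miE. Qed.

Lemma Re_grad_cscale m g j a x :
  Re (grad m (cscale g) j a x) = Ds (seq_mi a) (g * (Re \o f j)) x.
Proof. by rewrite /grad /cpartial /= partial_miE. Qed.

Lemma Im_grad_cscale m g j a x :
  Im (grad m (cscale g) j a x) = Ds (seq_mi a) (g * (Im \o f j)) x.
Proof. by rewrite /grad /cpartial /= partial_miE. Qed.

Hypothesis sf : forall j, csmooth (f j).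

Lemma sm_Re j : sm dirs (Re \o f j).
Proof. by apply/smoothP; have [] := sf j. Qed.
Lemma sm_Im j : sm dirs (Im \o f j).
Proof. by apply/smoothP; have [] := sf j. Qed.

Lemma csmooth_cscale g j : sm dirs g -> csmooth (cscale g j).
Proof.
move=> sg; split; apply/smoothP.
  exact: (smM sg (sm_Re j)).
exact: (smM sg (sm_Im j)).
Qed.

Lemma supported_cscale (U : set E) g j : supp_in U g -> supported_in U (cscale g j).
Proof.
by move=> [K [cK KU gK]]; exists K; split => // x /gK; rewrite /cscale => ->; rewrite !mul0r.
Qed.

Lemma test_cscale U g : sm dirs g -> supp_in U g -> test_fun U (cscale g).
Proof. by move=> sg Ug j; split; [exact: csmooth_cscale|exact: supported_cscale]. Qed.

Definition energy (k : nat) (x : E) : R :=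
  \sum_(j < N) (gradsq dirs k (Re \o f j) x + gradsq dirs k (Im \o f j) x).

Lemma energy0 x : energy 0 x = vsqn (f ^~ x).
Proof. by rewrite /energy /vsqn; apply: eq_bigr => j _; rewrite !gradsq0. Qed.

Lemma seq_mi_inj k : injective (@seq_mi d k).
Proof.
move=> a b ab; apply/val_inj/ffunP => i; apply/val_inj.
by rewrite /= -!count_seq_mi ab.
Qed.

Lemma asqn_grad_le k x : asqn (aval (grad k f) x) <= energy k x.
Proof.
rewrite /asqn /energy; apply: ler_sum => j _.
pose h (a : mindex d k) : k.-tuple 'I_d := Tuple (introT eqP (size_seq_mi a)).
have hi : injective h by move=> a b /(congr1 val) /=; exact: seq_mi_inj.
have le1 (g : E -> R) : \sum_(a : mindex d k) (Ds (seq_mi a) g x) ^+ 2 <= gradsq dirs k g x.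
  pose r := map h (index_enum (mindex d k)).
  have ur : uniq r by rewrite map_inj_uniq// index_enum_uniq.
  have -> : \sum_(a : mindex d k) (Ds (seq_mi a) g x) ^+ 2 = \sum_(t in r) (Ds t g x) ^+ 2.
    by rewrite -(big_uniq _ ur) /r big_map.
  rewrite /gradsq [leRHS](bigID (fun t => t \in r))/=.
  by rewrite lerDl sumr_ge0// => t _; exact: sqr_ge0.
rewrite (eq_bigr (fun a => Ds (seq_mi a) (Re \o f j) x ^+ 2 + Ds (seq_mi a) (Im \o f j) x ^+ 2)).
  by rewrite big_split /=; apply: lerD; exact: le1.
by move=> a _; rewrite /sqn /aval Re_grad Im_grad.
Qed.

Lemma energy_le k x : energy k x <= #|{: k.-tuple 'I_d}|%:R * asqn (aval (grad k f) x).
Proof.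
rewrite /asqn /energy mulr_sumr; apply: ler_sum => j _.
have le1 (t : k.-tuple 'I_d) : Ds t (Re \o f j) x ^+ 2 + Ds t (Im \o f j) x ^+ 2 <=
   \sum_(a : mindex d k) sqn (aval (grad k f) x j a).
  have [a Ha] := Dseq_mi (R := R) (size_tuple t).
  rewrite (Ha _ (sm_Re j)) (Ha _ (sm_Im j)) (bigD1 a)//= lerDl.
  by apply: sumr_ge0 => b _; exact: sqn_ge0.
rewrite /gradsq -big_split /= mulr_natl -sumr_const.
by apply: ler_sum => t _; exact: le1.
Qed.

End scaled_fields.

(** * Testing the equation with fields vanishing off the domain *)

Lemma ae_forall_fin d (T : measurableType d) (R : realType) (mu : {measure set T -> \bar R})
    (I : finType) (P : I -> T -> Prop) :
  (forall i, {ae mu, forall x, P i x}) -> {ae mu, forall x, forall i, P i x}.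
Proof.
move=> H; have : {ae mu, forall x, forall i, i \in enum I -> P i x}.
  elim: (enum I) => [|i s IH]; first by apply: aeW => x i; rewrite in_nil.
  apply: filterS2 (H i) IH => x Hi IH j; rewrite inE => /orP[/eqP ->//|]; exact: IH.
by apply: filterS => x Hx i; apply: Hx; rewrite mem_enum.
Qed.

Section eball_facts.
Context {R : realType} {d : nat}.
Local Notation E := 'rV[R]_d.
Local Notation mu := (leb R d).

Lemma open_eball (x0 : E) (rho : R) : open (eball x0 rho).
Proof.
rewrite (_ : eball x0 rho = sqdist x0 @^-1` [set t | t < rho ^+ 2])//.
apply: open_comp; last exact: open_lt.
by move=> x _; exact: (sm_cont (sm_sqdist x0)).
Qed.

Lemma eball_sub_cbox (x0 : E) (rho : R) : 0 < rho -> eball x0 rho `<=` cbox x0 rho.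
Proof.
move=> rho0 x xr i; rewrite -(ler_pXn2r (n := 2)) ?nnegrE ?(ltW rho0)//.
rewrite real_normK ?num_real//; apply: le_trans (ltW xr).
by rewrite (bigD1 i)//= lerDl sumr_ge0// => k _; exact: sqr_ge0.
Qed.

Lemma leb_sub_eball_fin (x0 : E) (rho : R) (U : set E) : 0 < rho -> measurable U ->
  U `<=` eball x0 rho -> (mu U < +oo)%E.
Proof.
move=> rho0 mU Ur; apply: le_lt_trans (leb_cbox_fin x0 rho).
apply: le_measure; rewrite ?inE//; first exact: measurable_cbox.
exact: subset_trans Ur (eball_sub_cbox rho0).
Qed.

Lemma sqn_integrable_Re (U : set E) (h : E -> R[i]) : measurable U -> (mu U < +oo)%E ->
  cmeasurable U h -> mu.-integrable U (EFin \o (fun x => sqn (h x))) ->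
  mu.-integrable U (EFin \o (fun x => complex.Re (h x))) /\
  mu.-integrable U (EFin \o (fun x => complex.Im (h x))).
Proof.
move=> mU Ufin [hr hi] ih.
have i1 : mu.-integrable U (EFin \o (fun x => 1 + sqn (h x))).
  apply: integrable_add => //.
  have := (integrable_mkcond (EFin \o (\1_U : E -> R)) mU).2.
  move=> H; apply: (@eq_integrable _ _ _ mu U mU (EFin \o (\1_U : E -> R))).
    by move=> x xU; rewrite /= indicE xU.
  apply: integrableS (integrable_indic_fin mU Ufin) => //.
have aux (u v : R) : `|u| <= 1 + (u ^+ 2 + v ^+ 2).
  have u2 : `|u| ^+ 2 = u ^+ 2 by rewrite real_normK// num_real.
  have := sqr_ge0 (`|u| - 1); have := sqr_ge0 v; have := normr_ge0 u.
  by rewrite -u2; nra.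
split; apply: (@integrable_ae_le _ _ _ mu U mU _ _ _ i1).
- exact (hr).
- by apply: aeW => x Ux; exact: aux.
- exact (hi).
- by apply: aeW => x Ux; rewrite /sqn [_ ^+ 2 + _]addrC; exact: aux.
Qed.

End eball_facts.

Section equation.
Context {R : realType} {d N : nat}.
Local Notation C := (R[i]).
Local Notation Re := (@complex.Re R).
Local Notation Im := (@complex.Im R).
Local Notation E := 'rV[R]_d.
Local Notation mu := (leb R d).
Local Notation Ds := (Dseq (@dirs R d)).
Variables (m : nat) (Omega : set E) (x0 : E) (rho Lam : R)
  (A : coeffs d N (E -> C) m) (F G : array d N (E -> C) m).
Hypotheses (m0 : (0 < m)%N) (rho0 : 0 < rho) (oO : open Omega)
  (OB : Omega `<=` eball x0 rho) (mA : measurable_coeffs A)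
  (bA : {ae mu, forall x, bounded_by (coeff_at A x) Lam})
  (L2G : array_L2 Omega G) (L2F : array_L2 Omega F)
  (eqn : forall phi, test_fun Omega phi ->
     pairing Omega (grad m phi) (Amul A G) = pairing Omega (grad m phi) F).

Let mO : measurable Omega. Proof. exact: open_measurable_rV. Qed.
Let Ofin : (mu Omega < +oo)%E. Proof. exact: leb_sub_eball_fin rho0 mO OB. Qed.

Definition defect : array d N (E -> C) m := fun j a x => Amul A G j a x - F j a x.

Lemma cmeasurable_AG j a : cmeasurable Omega (Amul A G j a).
Proof. by apply: cmeasurable_Amul => // k c; have [] := L2G k c. Qed.

Lemma integrable_sqn_AG j a : mu.-integrable Omega (EFin \o (fun x => sqn (Amul A G j a x))).
Proof.
apply: (@integrable_ae_le _ _ _ mu _ mO _ (fun x => Lam ^+ 2 * asqn (aval G x))).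
- by apply: measurable_sqn; exact: cmeasurable_AG.
- by apply: integrable_cstM => //; exact: integrable_asqn.
- apply: filterS bA => x Bx Ox; rewrite ger0_norm ?sqn_ge0//.
  apply: le_trans (Bx (aval G x)).
  exact: (le_asqn (cmul (coeff_at A x) (aval G x)) j a).
Qed.

Lemma integrable_AG j a :
  mu.-integrable Omega (EFin \o (fun x => Re (Amul A G j a x))) /\
  mu.-integrable Omega (EFin \o (fun x => Im (Amul A G j a x))).
Proof.
apply: sqn_integrable_Re => //; first exact: cmeasurable_AG.
exact: integrable_sqn_AG.
Qed.

Lemma integrable_F j a :
  mu.-integrable Omega (EFin \o (fun x => Re (F j a x))) /\
  mu.-integrable Omega (EFin \o (fun x => Im (F j a x))).
Proof.
apply: sqn_integrable_Re => //; first by have [] := L2F j a.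
by apply: L2fun_integrable => //; exact: L2F.
Qed.

Lemma integrable_defect j a :
  mu.-integrable Omega (EFin \o (fun x => Re (defect j a x))) /\
  mu.-integrable Omega (EFin \o (fun x => Im (defect j a x))).
Proof.
have [h1 h2] := integrable_AG j a; have [h3 h4] := integrable_F j a.
rewrite /defect; split.
  under eq_fun do rewrite ReD ReN; exact: integrable_sub.
by under eq_fun do rewrite ImD ImN; exact: integrable_sub.
Qed.

Lemma test_integrable (phi h : E -> R) : sm dirs phi -> supp_in Omega phi ->
  mu.-integrable Omega (EFin \o h) -> forall s,
  mu.-integrable Omega (EFin \o (fun x => Ds s phi x * h x)).
Proof.
move=> sp [K [cK KU pK]] ih s.
have [B HB] : exists B, forall x, `|Ds s phi x| <= B.
  by apply: cc_bounded; apply: cc_pd => //; apply: (cc_supp _ cK pK); exact: sm_cont.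
have mh : measurable_fun Omega h by apply/measurable_EFinP; exact: (measurable_int _ ih).
apply: (@le_integrable _ _ _ mu Omega mO _ (EFin \o (fun x => B * h x))).
- apply/measurable_EFinP; apply: measurable_funM => //.
  exact (@sm_measurable R d _ Omega (sm_Dseq s sp)).
- move=> x _; rewrite lee_fin !normrM; apply: ler_wpM2r => //.
  exact: le_trans (HB x) (ler_norm B).
- exact: integrable_cstM.
Qed.

(** A test field with one nonzero real component singles out one equation, and the
    real and imaginary parts of it. *)
Lemma defect_eq (phi : E -> R) j : sm dirs phi -> supp_in Omega phi ->
  \sum_(a : mindex d m) \int[mu]_(x in Omega) (Ds (seq_mi a) phi x * Re (defect j a x)) = 0 /\
  \sum_(a : mindex d m) \int[mu]_(x in Omega) (Ds (seq_mi a) phi x * Im (defect j a x)) = 0.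
Proof.
move=> sp up.
pose Phi : 'I_N -> E -> C := fun k => if k == j then of_real phi else fun=> 0.
have tPhi : test_fun Omega Phi.
  move=> k; rewrite /Phi; case: (k == j).
    by split; [exact: csmooth_of_real|exact: supported_of_real].
  split; first by split; exact: smooth_cst0.
  by exists set0; split => //; exact: compact0.
have pairE (H : array d N (E -> C) m) : pairing Omega (grad m Phi) H =
    \sum_(a : mindex d m) cint Omega (fun x => Complex (Ds (seq_mi a) phi x) 0 * H j a x).
  rewrite /pairing (bigD1 j)//= [X in _ + X]big1 ?addr0.
    apply: eq_bigr => a _; congr cint; apply/funext => x.
    rewrite /grad /Phi eqxx (_ : Im \o of_real phi = fun=> 0)// partial_mi0 oppr0.
    by rewrite -partial_miE.
  move=> k kj; apply: big1 => a _; rewrite /grad /Phi (negbTE kj).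
  have R0 : (Re \o (fun=> 0 : C) : E -> R) = fun=> 0 by [].
  have I0 : (Im \o (fun=> 0 : C) : E -> R) = fun=> 0 by [].
  rewrite /cint; apply: complex_eqP => /=; rewrite -[RHS](Rintegral_set0 mu (fun=> 0));
    rewrite /Rintegral integral0_eq ?integral_set0// => x _;
    rewrite R0 ?I0 !partial_mi0 /= ?ReM ?ImM /= ?oppr0 !mul0r ?subr0 ?addr0//.
have := eqn tPhi; rewrite !pairE => /eqP; rewrite -subr_eq0 -sumrB => /eqP eq0.
have part (S : C -> R) (S0 : S 0 = 0) (SD : forall z w, S (z + w) = S z + S w)
     (SN : forall z, S (- z) = - S z)
     (SC : forall (t : R) z, S (Complex t 0 * z) = t * S z)
     (Sint : forall h : E -> C, S (cint Omega h) = \int[mu]_(x in Omega) S (h x))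
     (Si : forall a, mu.-integrable Omega (EFin \o (fun x => S (Amul A G j a x))) /\
        mu.-integrable Omega (EFin \o (fun x => S (F j a x)))) :
   \sum_(a : mindex d m) \int[mu]_(x in Omega) (Ds (seq_mi a) phi x * S (defect j a x)) = 0.
  rewrite -[RHS]S0 -eq0.
  have -> : S (\sum_a (cint Omega (fun x => Complex (Ds (seq_mi a) phi x) 0 * Amul A G j a x) -
     cint Omega (fun x => Complex (Ds (seq_mi a) phi x) 0 * F j a x))) =
     \sum_a S (cint Omega (fun x => Complex (Ds (seq_mi a) phi x) 0 * Amul A G j a x) -
     cint Omega (fun x => Complex (Ds (seq_mi a) phi x) 0 * F j a x)).
    by apply: (big_morph S SD S0).
  apply: eq_bigr => a _; have [i1 i2] := Si a; rewrite SD SN !Sint.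
  under [X in _ = X - _]eq_Rintegral do rewrite SC.
  under [X in _ = _ - X]eq_Rintegral do rewrite SC.
  rewrite -RintegralB//; [|exact: test_integrable|exact: test_integrable].
  by apply: eq_Rintegral => x _; rewrite /defect SD SN mulrBr.
split.
  apply: part => //; [exact: ReD|exact: ReN| |].
    by move=> t z; rewrite ReM /= mul0r subr0.
  by move=> a; have [] := integrable_AG j a; have [] := integrable_F j a.
apply: part => //; [exact: ImD|exact: ImN| |].
  by move=> t z; rewrite ImM /= mul0r addr0.
by move=> a; have [] := integrable_AG j a; have [] := integrable_F j a.
Qed.

(** [w1] and [w2] are the real and imaginary parts of the test field; they can be
    tested separately by [defect_eq]. *)
Lemma defect_rdot0 (w1 w2 : 'I_N -> E -> R) :
  (forall j, sm dirs (w1 j)) -> (forall j, sm dirs (w2 j)) ->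
  (forall j, cc (w1 j)) -> (forall j, cc (w2 j)) ->
  (forall j s x, (size s < m)%N -> ~ Omega x -> Ds s (w1 j) x = 0) ->
  (forall j s x, (size s < m)%N -> ~ Omega x -> Ds s (w2 j) x = 0) ->
  let D x := \sum_j \sum_(a : mindex d m) (Ds (seq_mi a) (w1 j) x * Re (defect j a x) +
      Ds (seq_mi a) (w2 j) x * Im (defect j a x)) in
  mu.-integrable Omega (EFin \o D) /\ \int[mu]_(x in Omega) D x = 0.
Proof.
move=> s1 s2 c1 c2 v1 v2 D.
have bi (w : E -> R) (h : E -> R) s : sm dirs w -> cc w -> mu.-integrable Omega (EFin \o h) ->
    mu.-integrable Omega (EFin \o (fun x => Ds s w x * h x)).
  move=> sw cw ih; have [B HB] := cc_bounded (cc_pd s sw cw).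
  have mh : measurable_fun Omega h by apply/measurable_EFinP; exact: (measurable_int _ ih).
  apply: (@le_integrable _ _ _ mu Omega mO _ (EFin \o (fun x => B * h x))).
  - apply/measurable_EFinP; apply: measurable_funM => //.
    exact (@sm_measurable R d _ Omega (sm_Dseq s sw)).
  - move=> x _; rewrite lee_fin !normrM; apply: ler_wpM2r => //.
    exact: le_trans (HB x) (ler_norm B).
  - exact: integrable_cstM.
have ia j a : mu.-integrable Omega (EFin \o (fun x => Ds (seq_mi a) (w1 j) x * Re (defect j a x) +
      Ds (seq_mi a) (w2 j) x * Im (defect j a x))).
  by have [h1 h2] := integrable_defect j a; apply: integrable_add => //; exact: bi.
split; first by apply: integrable_sumR => // j; apply: integrable_sumR.
rewrite /D Rint_sum//; last by move=> j; apply: integrable_sumR.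
rewrite big1// => j _; rewrite Rint_sum//.
rewrite (eq_bigr (fun a => \int[mu]_(x in Omega) (Ds (seq_mi a) (w1 j) x * Re (defect j a x)) +
   \int[mu]_(x in Omega) (Ds (seq_mi a) (w2 j) x * Im (defect j a x)))); last first.
  move=> a _; have [h1 h2] := integrable_defect j a.
  by rewrite RintegralD//; exact: bi.
rewrite big_split /=.
rewrite (weak_equation_extends m0 (s1 j) (c1 j) (v1 j) mO (s_ := fun a : mindex d m => seq_mi a)
  (H := fun a x => Re (defect j a x))).
rewrite (weak_equation_extends m0 (s2 j) (c2 j) (v2 j) mO (s_ := fun a : mindex d m => seq_mi a)
  (H := fun a x => Im (defect j a x))) ?addr0//.
- by move=> a; exact: size_seq_mi.
- by move=> a; have [] := integrable_defect j a.
- by move=> phi sp up; have [] := defect_eq j sp up.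
- by move=> a; exact: size_seq_mi.
- by move=> a; have [] := integrable_defect j a.
- by move=> phi sp up; have [] := defect_eq j sp up.
Qed.

End equation.

(** * Weighted norms of fields *)

Section field_norms.
Context {R : realType} {d N : nat}.
Local Notation C := (R[i]).
Local Notation Re := (@complex.Re R).
Local Notation Im := (@complex.Im R).
Local Notation E := 'rV[R]_d.
Local Notation mu := (leb R d).
Local Notation Ds := (Dseq (@dirs R d)).
Implicit Types (f : 'I_N -> E -> C) (om : E -> R).

Definition field_norm om (b : R) f k :=
  (b^-1) ^+ (2 * k) * \int[mu]_x (om x ^+ (2 * k.+1) * energy f k x).

Definition lower_field m (b z : R) f x : R := \sum_(j < N)
  (lower_order dirs m b z (Re \o f j) x + lower_order dirs m b z (Im \o f j) x).

Lemma energy_ge0 f k x : 0 <= energy f k x.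
Proof. by apply: sumr_ge0 => j _; rewrite addr_ge0 ?gradsq_ge0. Qed.

Lemma integrable_weighted_energy om f n k : (0 < n)%N -> cc om -> (forall j, csmooth (f j)) ->
  mu.-integrable setT (EFin \o (fun x => om x ^+ n * energy f k x)).
Proof.
move=> n0 co sf; under eq_fun do rewrite mulr_sumr.
apply: integrable_sumR => // j; under eq_fun do rewrite mulrDr.
by apply: integrable_add => //; apply: integrable_weighted_gradsq => //;
  [exact: sm_Re|exact: sm_Im].
Qed.

Lemma field_normE om b f k : cc om -> (forall j, csmooth (f j)) ->
  field_norm om b f k = \sum_j (weighted_norm om b (Re \o f j) k + weighted_norm om b (Im \o f j) k).
Proof.
move=> co sf.
have iR j : mu.-integrable setT (EFin \o (fun x => om x ^+ (2 * k.+1) * gradsq dirs k (Re \o f j) x)).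
  by apply: integrable_weighted_gradsq => //; exact: sm_Re.
have iI j : mu.-integrable setT (EFin \o (fun x => om x ^+ (2 * k.+1) * gradsq dirs k (Im \o f j) x)).
  by apply: integrable_weighted_gradsq => //; exact: sm_Im.
rewrite /field_norm /energy; under eq_Rintegral do rewrite mulr_sumr.
rewrite Rint_sum//; last first.
  by move=> j; under eq_fun do rewrite mulrDr; exact: integrable_add.
rewrite mulr_sumr; apply: eq_bigr => j _.
under eq_Rintegral do rewrite mulrDr.
by rewrite RintegralD// mulrDr.
Qed.

Lemma field_norm0 om b f : field_norm om b f 0 = \int[mu]_x (om x ^+ 2 * vsqn (f ^~ x)).
Proof.
rewrite /field_norm muln0 expr0 mul1r muln1.
by apply: eq_Rintegral => x _; rewrite energy0.
Qed.

Lemma lower_fieldE m b z f x :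
  lower_field m b z f x = \sum_(k < m) b ^+ (2 * (m - k)) * z ^+ (2 * k.+1) * energy f k x.
Proof.
rewrite /lower_field /lower_order /energy; under eq_bigr do rewrite -big_split /=.
rewrite exchange_big /=; apply: eq_bigr => k _; rewrite mulr_sumr.
by apply: eq_bigr => j _; rewrite mulrDr.
Qed.

Lemma integrable_lower_field m b om f : cc om -> (forall j, csmooth (f j)) ->
  mu.-integrable setT (EFin \o (fun x => lower_field m b (om x) f x)).
Proof.
move=> co sf; under eq_fun do rewrite lower_fieldE.
apply: integrable_sumR => // k; under eq_fun do rewrite -mulrA.
by apply: integrable_cstM => //; exact: integrable_weighted_energy.
Qed.

Lemma int_lower_field m b om f : 0 < b -> cc om -> (forall j, csmooth (f j)) ->
  \int[mu]_x lower_field m b (om x) f x = b ^+ (2 * m) * \sum_(k < m) field_norm om b f k.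
Proof.
move=> b0 co sf; under eq_Rintegral do rewrite lower_fieldE.
have ie k : mu.-integrable setT (EFin \o (fun x => om x ^+ (2 * k.+1) * energy f k x)).
  exact: integrable_weighted_energy.
rewrite Rint_sum//; last first.
  by move=> k; under eq_fun do rewrite -mulrA; exact: integrable_cstM.
rewrite mulr_sumr; apply: eq_bigr => k _.
under eq_Rintegral do rewrite -mulrA.
rewrite RintegralZl// /field_norm mulrA; congr (_ * _).
have -> : (2 * m = 2 * (m - k) + 2 * k)%N by rewrite -mulnDr subnK// ltnW.
by rewrite exprD -mulrA -exprMn mulfV ?gt_eqF// expr1n mulr1.
Qed.

Lemma integrable_weighted_asqn (p : E -> R) f k : cc p -> (forall j, csmooth (f j)) ->
  mu.-integrable setT (EFin \o (fun x => p x ^+ 2 * asqn (aval (grad k f) x))).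
Proof.
move=> cp sf; under eq_fun do rewrite mulr_sumr; apply: integrable_sumR => // j.
under eq_fun do rewrite mulr_sumr; apply: integrable_sumR => // a.
rewrite /sqn /aval; under eq_fun do rewrite mulrDr.
have sX : sm dirs (fun x => Re (grad k f j a x)) /\ sm dirs (fun x => Im (grad k f j a x)).
  split; [under eq_fun do rewrite Re_grad|under eq_fun do rewrite Im_grad]; apply: sm_Dseq;
   [exact: sm_Re|exact: sm_Im].
by have [s1 s2] := sX; apply: integrable_add => //; apply: integrable_weighted.
Qed.

(** Powers [om^(m+1)] of the weight are dominated by the flat cutoff, so the top order
    term of the interpolation can be absorbed into the energy. *)
Lemma field_norm_top om (p : E -> R) b f m : 0 < b -> cc om -> cc p ->
  (forall j, csmooth (f j)) -> (forall x, 0 <= om x) -> (forall x, om x ^+ m.+1 <= p x) ->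
  b ^+ (2 * m) * field_norm om b f m <=
  #|{: m.-tuple 'I_d}|%:R * \int[mu]_x (p x ^+ 2 * asqn (aval (grad m f) x)).
Proof.
move=> b0 co cp sf om0 omp; rewrite /field_norm mulrA -exprMn mulfV ?gt_eqF// expr1n mul1r.
set n := _%:R.
have ie : mu.-integrable setT (EFin \o (fun x => p x ^+ 2 * energy f m x)).
  exact: integrable_weighted_energy.
have ia := integrable_weighted_asqn m cp sf.
rewrite -RintegralZl//; apply: le_Rintegral => //.
- exact: integrable_weighted_energy.
- exact: integrable_cstM.
- move=> x _; rewrite mulrCA; apply: (@le_trans _ _ (p x ^+ 2 * energy f m x)).
    rewrite ler_wpM2r ?energy_ge0// mulnC exprM; apply: lerXn2r => //; rewrite nnegrE.
      by rewrite exprn_ge0.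
    by apply: le_trans (omp x); rewrite exprn_ge0.
  by rewrite ler_wpM2l ?sqr_ge0// energy_le.
Qed.

(** A cutoff equal to [1] on the ball turns the weighted integrability into
    integrability on [D]. *)
Lemma integrable_on_ball (g : E -> R) (x0 : E) (rho : R) (D : set E) : 0 < rho ->
  (forall om, cc om -> mu.-integrable setT (EFin \o (fun x => om x ^+ 2 * g x))) ->
  measurable D -> D `<=` eball x0 rho -> mu.-integrable D (EFin \o g).
Proof.
move=> rho0 ig mD DB; pose th := theta x0 rho (rho + rho).
have rr : rho < rho + rho by rewrite ltrDl.
have cth : cc th.
  apply: (@cc_supp _ _ _ (theta_supp x0 rho (rho + rho))).
  - by apply: sm_cont; exact: sm_theta.
  - exact: theta_supp_compact.
  - by move=> x; exact: theta_out.
apply: (@eq_integrable _ _ _ mu D mD (EFin \o (fun x => th x ^+ 2 * g x))).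
  by move=> x /set_mem /DB /ltW xr /=; rewrite /th theta_eq1 ?expr1n ?mul1r.
by apply: integrableS (ig _ cth).
Qed.

Lemma integrable_asqn_on f k (x0 : E) (rho : R) (D : set E) : 0 < rho ->
  (forall j, csmooth (f j)) -> measurable D -> D `<=` eball x0 rho ->
  mu.-integrable D (EFin \o (fun x => asqn (aval (grad k f) x))).
Proof.
move=> rho0 sf; apply: integrable_on_ball => // om co.
exact: integrable_weighted_asqn.
Qed.

Lemma integrable_vsqn_on f (x0 : E) (rho : R) (D : set E) : 0 < rho ->
  (forall j, csmooth (f j)) -> measurable D -> D `<=` eball x0 rho ->
  mu.-integrable D (EFin \o (fun x => vsqn (f ^~ x))).
Proof.
move=> rho0 sf; apply: integrable_on_ball => // om co.
under eq_fun do rewrite -energy0; exact: integrable_weighted_energy.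
Qed.

End field_norms.

(** The constant does not depend on the number [N] of components, since each
    component is interpolated separately. *)
Lemma field_interpolation (R : realType) (d m : nat) (c eta : R) : 0 < eta -> exists2 K, 0 <= K &
  forall N om (f : 'I_N -> 'rV[R]_d -> R[i]) (b : R), sm dirs om -> cc om -> (forall j, csmooth (f j)) -> 0 < b ->
  (forall i x, `|pd dirs i om x| <= c * b) -> forall k, (k < m)%N ->
  field_norm om b f k <= eta * field_norm om b f m + K * field_norm om b f 0.
Proof.
move=> eta0; have [K K0 HK] := @weighted_interpolation R d m c eta eta0.
exists K => // N om f b so co sf b0 omb k km; rewrite !field_normE// !mulr_sumr -big_split /=.
apply: ler_sum => j _; rewrite [_ * (_ + _)]mulrDr [K * (_ + _)]mulrDr addrACA.
by apply: lerD; apply: HK => //; [exact: sm_Re|exact: sm_Im].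
Qed.

(** * The Garding inequality on test fields *)

Section garding.
Context {R : realType} {d N : nat}.
Local Notation C := (R[i]).
Local Notation Re := (@complex.Re R).
Local Notation Im := (@complex.Im R).
Local Notation E := 'rV[R]_d.
Local Notation mu := (leb R d).
Local Notation Ds := (Dseq (@dirs R d)).
Variables (m : nat) (Lam : R) (A : coeffs d N (E -> C) m) (w : 'I_N -> E -> C).
Hypotheses (mA : measurable_coeffs A)
  (bA : {ae mu, forall x, bounded_by (coeff_at A x) Lam}) (tw : test_fun setT w).

Let sw j : csmooth (w j). Proof. by have [] := tw j. Qed.

Let cw j : cc (Re \o w j) /\ cc (Im \o w j).
Proof.
have [_ [K [cK _ wK]]] := tw j.
by split; apply: (cc_supp _ cK);
  [exact: (sm_cont (sm_Re sw j))|move=> x /wK /= ->|exact: (sm_cont (sm_Im sw j))|move=> x /wK /= ->].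
Qed.

Lemma cmeasurable_grad (D : set E) k j a : measurable D -> cmeasurable D (grad k w j a).
Proof.
move=> mD; split.
  rewrite (_ : Re \o _ = Ds (seq_mi a) (Re \o w j)); last by apply/funext => x; rewrite -Re_grad.
  exact (@sm_measurable R d _ D (sm_Dseq _ (sm_Re sw j))).
rewrite (_ : Im \o _ = Ds (seq_mi a) (Im \o w j)); last by apply/funext => x; rewrite -Im_grad.
exact (@sm_measurable R d _ D (sm_Dseq _ (sm_Im sw j))).
Qed.

Lemma integrable_sqn_test (h1 h2 : E -> R) : cc h1 -> cc h2 ->
  mu.-integrable setT (EFin \o (fun x => sqn (Complex (h1 x) (h2 x)))).
Proof.
move=> c1 c2; rewrite /sqn /=; apply: cc_integrable; apply: ccD.
  by under eq_fun do rewrite expr2; apply: ccM => //; have [] := c1.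
by under eq_fun do rewrite expr2; apply: ccM => //; have [] := c2.
Qed.

Lemma integrable_asqn_test k : mu.-integrable setT (EFin \o (fun x => asqn (aval (grad k w) x))).
Proof.
apply: integrable_sumR => // j; apply: integrable_sumR => // a.
rewrite (_ : (fun x => _) = (fun x => sqn (Complex (Ds (seq_mi a) (Re \o w j) x)
   (Ds (seq_mi a) (Im \o w j) x)))).
  apply: integrable_sqn_test; have [c1 c2] := cw j.
    exact: cc_pd (sm_Re sw j) c1.
  exact: cc_pd (sm_Im sw j) c2.
by apply/funext => x; rewrite /sqn /aval Re_grad Im_grad.
Qed.

Lemma integrable_vsqn_test : mu.-integrable setT (EFin \o (fun x => vsqn (w ^~ x))).
Proof.
apply: integrable_sumR => // j; have [c1 c2] := cw j.
rewrite (_ : (fun x => _) = (fun x => sqn (Complex ((Re \o w j) x) ((Im \o w j) x)))).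
  exact: integrable_sqn_test.
by apply/funext => x.
Qed.

Let P x := aval (grad m w) x.

Lemma integrable_rdot_component j a : mu.-integrable setT (EFin \o (fun x =>
  Re (grad m w j a x) * Re (Amul A (grad m w) j a x) +
  Im (grad m w j a x) * Im (Amul A (grad m w) j a x))).
Proof.
have mP k b : cmeasurable setT (grad m w k b) by exact: cmeasurable_grad.
have mAP : cmeasurable setT (Amul A (grad m w) j a) by exact: cmeasurable_Amul.
apply: (@integrable_ae_le _ _ _ mu setT measurableT _ (fun x => (1 + Lam ^+ 2) * asqn (P x))).
- have [p1 p2] := mP j a; have [q1 q2] := mAP.
  by apply: measurable_funD; apply: measurable_funM.
- by apply: integrable_cstM => //; exact: integrable_asqn_test.
- apply: filterS bA => x Bx _; apply: le_trans (cdot_le _ _) _.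
  rewrite mulrDl mul1r; apply: lerD; first exact: (le_asqn (P x) j a).
  by apply: le_trans (Bx (P x)); exact: (le_asqn (cmul (coeff_at A x) (P x)) j a).
Qed.

Lemma integrable_rdot :
  mu.-integrable setT (EFin \o (fun x => rdot (P x) (cmul (coeff_at A x) (P x)))).
Proof.
by apply: integrable_sumR => // j; apply: integrable_sumR => // a;
  exact: integrable_rdot_component.
Qed.

Lemma Re_pairing_rdot : Re (pairing setT (grad m w) (Amul A (grad m w))) =
  \int[mu]_x rdot (P x) (cmul (coeff_at A x) (P x)).
Proof.
rewrite /pairing Re_sum /rdot Rint_sum//; last first.
  by move=> j; apply: integrable_sumR => // a; exact: integrable_rdot_component.
apply: eq_bigr => j _; rewrite Re_sum Rint_sum//; last exact: integrable_rdot_component.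
by apply: eq_bigr => a _; apply: eq_Rintegral => x _; rewrite Re_cdot.
Qed.

(** All three integrals are finite for a test field, so the inequality holds between
    real numbers. *)
Lemma garding_test (lam delta : R) : weak_garding A lam delta ->
  lam * \int[mu]_x asqn (P x) - delta * \int[mu]_x vsqn (w ^~ x) <=
  \int[mu]_x rdot (P x) (cmul (coeff_at A x) (P x)).
Proof.
move=> /(_ w tw); rewrite Re_pairing_rdot.
have fin (h : E -> R) : mu.-integrable setT (EFin \o h) ->
    (\int[mu]_x (h x)%:E)%E = (\int[mu]_x h x)%:E.
  by move=> ih; rewrite /Rintegral fineK//; exact: (integrable_fin_num _ ih).
rewrite /L2sq /L2sqv fin; last exact: integrable_asqn_test.
rewrite fin; last exact: integrable_vsqn_test.
by rewrite -!EFinM -EFinB lee_fin.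
Qed.

End garding.

(** * Absorption of the top order energy *)

Section absorption.
Context {R : realType} {d N : nat}.
Local Notation C := (R[i]).
Local Notation Re := (@complex.Re R).
Local Notation Im := (@complex.Im R).
Local Notation E := 'rV[R]_d.
Local Notation mu := (leb R d).
Local Notation Ds := (Dseq (@dirs R d)).
Variables (m : nat) (Omega : set E) (x0 : E) (r rho lam Lam delta K : R)
  (A : coeffs d N (E -> C) m) (F G : array d N (E -> C) m) (f : 'I_N -> E -> C).
Hypotheses (m0 : (0 < m)%N) (r0 : 0 < r) (rrho : r < rho) (oO : open Omega)
  (OB : Omega `<=` eball x0 rho) (lam0 : 0 < lam) (Lam0 : 0 < Lam)
  (mA : measurable_coeffs A)
  (bA : {ae mu, forall x, bounded_by (coeff_at A x) Lam})
  (gA : weak_garding A lam delta)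
  (L2G : array_L2 Omega G) (L2F : array_L2 Omega F)
  (eqn : forall phi, test_fun Omega phi ->
     pairing Omega (grad m phi) (Amul A G) = pairing Omega (grad m phi) F)
  (sf : forall j, csmooth (f j)) (vf : forall j, vanishes m (eball x0 rho) Omega (f j))
  (K0 : 0 < K).

Let b := (rho - r)^-1.
Let th : E -> R := theta x0 r rho.
Let ps : E -> R := psi m th.
Let ze : E -> R := zeta th.

Hypothesis remainders : forall g x s, sm dirs g -> size s = m ->
  (Ds s (ps * g) x - ps x * Ds s g x) ^+ 2 <= K * lower_order dirs m b (ze x) g x /\
  (Ds s (ps * ps * g) x - ps x ^+ 2 * Ds s g x) ^+ 2 <=
    ps x ^+ 2 * (K * lower_order dirs m b (ze x) g x).

Let mO : measurable Omega. Proof. exact: open_measurable_rV. Qed.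
Let rho0 : 0 < rho. Proof. exact: lt_trans rrho. Qed.
Let b0 : 0 < b. Proof. by rewrite invr_gt0 subr_gt0. Qed.
Let sth : sm dirs th. Proof. exact: sm_theta. Qed.
Let th01 x : 0 <= th x <= 1. Proof. by rewrite theta_ge0 theta_le1. Qed.
Let sps : sm dirs ps. Proof. exact: sm_psi. Qed.
Let ps01 x : 0 <= ps x <= 1. Proof. exact: psi01. Qed.
Let ze01 x : 0 <= ze x <= 1. Proof. exact: zeta01. Qed.

Let mulfctE (g h : E -> R) x : (g * h) x = g x * h x. Proof. by []. Qed.

Let supp_ps x : ~ theta_supp x0 r rho x -> ps x = 0.
Proof. by move=> xK; apply: psi_eq0; exact: theta_out. Qed.

Let supp_ps2 x : ~ theta_supp x0 r rho x -> (ps * ps) x = 0.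
Proof. by move=> /supp_ps p0; rewrite mulfctE p0 mul0r. Qed.

Lemma supp_in_theta (g : E -> R) :
  (forall x, ~ theta_supp x0 r rho x -> g x = 0) -> supp_in setT g.
Proof. by exists (theta_supp x0 r rho); split => //; exact: theta_supp_compact. Qed.

Lemma cc_theta (g : E -> R) : sm dirs g ->
  (forall x, ~ theta_supp x0 r rho x -> g x = 0) -> cc g.
Proof. by move=> sg; apply: (cc_supp (sm_cont sg)); exact: theta_supp_compact. Qed.

Let ccze : cc ze.
Proof.
apply: cc_theta; first exact: sm_zeta.
by move=> x xK; rewrite /ze zetaE {1}/th theta_out// mul0r.
Qed.

Let ccps : cc ps. Proof. exact: cc_theta. Qed.

(** Off [B] the cutoff vanishes to all orders, on [B \ Omega] the field does so to
    order [m]. *)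
Lemma cutoff_vanishes (g : E -> R) : sm dirs g ->
  (forall k (a : mindex d k) x, (k < m)%N -> eball x0 rho x -> ~ Omega x -> partial_mi a g x = 0) ->
  forall s x, (size s < m)%N -> ~ Omega x -> Ds s (ps * ps * g) x = 0.
Proof.
move=> sg vg s x sm_ xO; have [xK|xK] := pselect (theta_supp x0 r rho x); last first.
  apply: (@Dseq_out _ _ _ _ _ _ (theta_supp x0 r rho)) => //.
    by apply: compact_closed => //; exact: theta_supp_compact.
  by move=> y /supp_ps2 p0; rewrite mulfctE p0 mul0r.
rewrite DseqM//; last exact: smM.
rewrite big_seq big1// => q /splits_size qs.
have [a ->//] := @Dseq_mi R d (size q.2) q.2 erefl.
rewrite vg ?mulr0//; last exact: (theta_supp_sub r0 rrho).
by apply: leq_ltn_trans sm_; rewrite -qs leq_addl.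
Qed.

Let vR j s x : (size s < m)%N -> ~ Omega x -> Ds s (ps * ps * (Re \o f j)) x = 0.
Proof.
apply: cutoff_vanishes => //; first exact: sm_Re.
by move=> k a y km yB yO; have := congr1 Re (@vf j k a km y (conj yB yO)).
Qed.
Let vI j s x : (size s < m)%N -> ~ Omega x -> Ds s (ps * ps * (Im \o f j)) x = 0.
Proof.
apply: cutoff_vanishes => //; first exact: sm_Im.
by move=> k a y km yB yO; have := congr1 Im (@vf j k a km y (conj yB yO)).
Qed.

Let sR j : sm dirs (ps * ps * (Re \o f j)).
Proof. by apply: smM; [exact: smM|exact: sm_Re]. Qed.
Let sI j : sm dirs (ps * ps * (Im \o f j)).
Proof. by apply: smM; [exact: smM|exact: sm_Im]. Qed.
Let cR j : cc (ps * ps * (Re \o f j)).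
Proof. by apply: cc_theta => // x /supp_ps2 p0; rewrite mulfctE p0 mul0r. Qed.
Let cI j : cc (ps * ps * (Im \o f j)).
Proof. by apply: cc_theta => // x /supp_ps2 p0; rewrite mulfctE p0 mul0r. Qed.

Let P x := aval (grad m (cscale f ps)) x.
Let P2 x := aval (grad m (cscale f (ps * ps))) x.
Let X x := aval (grad m f) x.

Let P2_off : {ae mu, forall x, ~ Omega x -> forall j a, P2 x j a = 0}.
Proof.
have H j a : {ae mu, forall x, ~ Omega x -> P2 x j a = 0}.
  have := Dseq_off_ae m0 (sR j) (cR j) (@vR j) (size_seq_mi a).
  apply: filterS2 (Dseq_off_ae m0 (sI j) (cI j) (@vI j) (size_seq_mi a)) => x h1 h2 xO.
  by apply: complex_eqP; [rewrite /P2 /aval Re_grad_cscale h2|rewrite /P2 /aval Im_grad_cscale h1].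
have H1 j : {ae mu, forall x, forall a, ~ Omega x -> P2 x j a = 0} by exact: ae_forall_fin.
by have := ae_forall_fin H1; apply: filterS => x Hx xO j a; exact: Hx.
Qed.

Let e j x := K * (lower_order dirs m b (ze x) (Re \o f j) x + lower_order dirs m b (ze x) (Im \o f j) x).

Let e_ge0 j x : 0 <= e j x.
Proof.
have /andP[z0 _] := ze01 x.
by rewrite mulr_ge0 ?(ltW K0)// addr_ge0 ?lower_order_ge0// ltW.
Qed.

Let loRe j x : K * lower_order dirs m b (ze x) (Re \o f j) x <= e j x.
Proof.
have /andP[z0 _] := ze01 x.
by rewrite ler_wpM2l ?(ltW K0)// lerDl lower_order_ge0// ltW.
Qed.
Let loIm j x : K * lower_order dirs m b (ze x) (Im \o f j) x <= e j x.
Proof.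
have /andP[z0 _] := ze01 x.
by rewrite ler_wpM2l ?(ltW K0)// lerDr lower_order_ge0// ltW.
Qed.

Let rem1 x j a : (Re (P x j a) - ps x * Re (X x j a)) ^+ 2 <= e j x /\
  (Im (P x j a) - ps x * Im (X x j a)) ^+ 2 <= e j x.
Proof.
rewrite /P /X /aval Re_grad_cscale Im_grad_cscale Re_grad Im_grad.
have [h1 _] := remainders x (sm_Re sf j) (size_seq_mi a).
have [h2 _] := remainders x (sm_Im sf j) (size_seq_mi a).
by split; [exact: le_trans h1 _|exact: le_trans h2 _].
Qed.

Let rem2 x j a : (Re (P2 x j a) - ps x ^+ 2 * Re (X x j a)) ^+ 2 <= ps x ^+ 2 * e j x /\
  (Im (P2 x j a) - ps x ^+ 2 * Im (X x j a)) ^+ 2 <= ps x ^+ 2 * e j x.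
Proof.
rewrite /P2 /X /aval Re_grad_cscale Im_grad_cscale Re_grad Im_grad.
have [_ h1] := remainders x (sm_Re sf j) (size_seq_mi a).
have [_ h2] := remainders x (sm_Im sf j) (size_seq_mi a).
have mono t : t <= e j x -> ps x ^+ 2 * t <= ps x ^+ 2 * e j x by move=> ?; rewrite ler_wpM2l ?sqr_ge0.
by split; [apply: le_trans h1 _; exact: mono|apply: le_trans h2 _; exact: mono].
Qed.

Let n : R := #|{: mindex d m}|%:R.

Let sum_e x : \sum_j \sum_(a : mindex d m) e j x = n * K * lower_field m b (ze x) f x.
Proof.
rewrite /lower_field mulr_sumr; apply: eq_bigr => j _.
by rewrite sumr_const -mulr_natl mulrA.
Qed.

Lemma pairing_on (eps : R) x : 0 < eps -> bounded_by (coeff_at A x) Lam ->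
  rdot (P x) (cmul (coeff_at A x) (P x)) <=
  rdot (P2 x) (aval (defect A F G) x) + eps * (ps x ^+ 2 * asqn (X x)) +
  absorb_const eps Lam * (n * K * lower_field m b (ze x) f x +
     (asqn (asub (aval G x) (X x)) + asqn (aval F x))).
Proof.
move=> eps0 Bx.
have := array_inequality (P := P x) (P2 := P2 x) (aval G x) (aval F x) Lam0 eps0 (ps01 x) Bx
  (fun j a => e_ge0 j x) (rem1 x) (rem2 x).
rewrite sum_e lerBlDl => /le_trans; apply.
by rewrite -!addrA lexx.
Qed.

(** Off [Omega] there is no equation, but there the gradient of [psi^2 f] vanishes,
    and the comparison holds with the gradient of [f] in place of [G]. *)
Lemma pairing_off (eps : R) x : 0 < eps -> bounded_by (coeff_at A x) Lam ->
  (forall j a, P2 x j a = 0) ->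
  rdot (P x) (cmul (coeff_at A x) (P x)) <= eps * (ps x ^+ 2 * asqn (X x)) +
  absorb_const eps Lam * (n * K * lower_field m b (ze x) f x).
Proof.
move=> eps0 Bx P20.
have := array_inequality (P := P x) (P2 := P2 x) (X x) (fun _ _ => 0) Lam0 eps0 (ps01 x) Bx
  (fun j a => e_ge0 j x) (rem1 x) (rem2 x).
have -> : rdot (P2 x) (asub (cmul (coeff_at A x) (X x)) (fun _ _ => 0)) = 0.
  by rewrite /rdot big1// => j _; rewrite big1// => a _; rewrite P20 !mul0r addr0.
have z0 (Y : array d N C m) : (forall j a, Y j a = 0) -> asqn Y = 0.
  move=> Y0; rewrite /asqn big1// => j _; rewrite big1// => a _.
  by rewrite Y0 /sqn /= expr0n addr0.
rewrite sum_e subr0 [asqn (asub _ _)]z0; last by move=> j a; rewrite /asub subrr.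
by rewrite (z0 (fun _ _ => 0))// !addr0.
Qed.

(** The energy with the cutoff outside the gradient is that of [psi f] up to the
    commutator. *)
Lemma weighted_asqn_le x : ps x ^+ 2 * asqn (X x) <=
  2 * asqn (P x) + 4 * (n * K * lower_field m b (ze x) f x).
Proof.
rewrite -sum_e /asqn !mulr_sumr -big_split /=; apply: ler_sum => j _.
rewrite !mulr_sumr -big_split /=; apply: ler_sum => a _.
have [h1 h2] := rem1 x j a; move: h1 h2; rewrite /sqn.
move: (Re (P x j a)) (Im (P x j a)) (Re (X x j a)) (Im (X x j a)) (e j x) (ps x).
move=> pr pi xr xi ee p h1 h2.
have := sqr_ge0 (2 * pr - p * xr); have := sqr_ge0 (2 * pi - p * xi); nra.
Qed.

Lemma asqn_sub_le (Y Z : array d N C m) : asqn (asub Y Z) <= 2 * asqn Y + 2 * asqn Z.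
Proof.
rewrite /asqn !mulr_sumr -big_split /=; apply: ler_sum => j _.
rewrite !mulr_sumr -big_split /=; apply: ler_sum => a _; exact: sqn_sub_le.
Qed.

Lemma integrable_error : mu.-integrable Omega
  (EFin \o (fun x => asqn (asub (aval G x) (X x)) + asqn (aval F x))).
Proof.
apply: integrable_add => //; last exact: integrable_asqn.
apply: (@integrable_ae_le _ _ _ mu Omega mO _ (fun x => 2 * asqn (aval G x) + 2 * asqn (X x))).
- apply: measurable_sum => j; apply: measurable_sum => a; apply: measurable_sqn.
  apply: cmeasurable_sub; first by have [] := L2G j a.
  split.
    rewrite (_ : Re \o _ = Ds (seq_mi a) (Re \o f j)); last by apply/funext => x; rewrite -Re_grad.
    exact (@sm_measurable R d _ Omega (sm_Dseq _ (sm_Re sf j))).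
  rewrite (_ : Im \o _ = Ds (seq_mi a) (Im \o f j)); last by apply/funext => x; rewrite -Im_grad.
  exact (@sm_measurable R d _ Omega (sm_Dseq _ (sm_Im sf j))).
- apply: integrable_add => //; apply: integrable_cstM => //; first exact: integrable_asqn.
  exact: integrable_asqn_on rho0 sf mO OB.
- by apply: aeW => x _; rewrite ger0_norm ?asqn_ge0//; exact: asqn_sub_le.
Qed.

Let hX x := ps x ^+ 2 * asqn (X x).
Let hS x := n * K * lower_field m b (ze x) f x.
Let hY x := asqn (asub (aval G x) (X x)) + asqn (aval F x).
Let hA x := rdot (P x) (cmul (coeff_at A x) (P x)).
Let hD x := rdot (P2 x) (aval (defect A F G) x).

Let tP : test_fun setT (cscale f ps).
Proof. by apply: test_cscale => //; exact: supp_in_theta. Qed.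

Let iX : mu.-integrable setT (EFin \o hX). Proof. exact: integrable_weighted_asqn. Qed.
Let iS : mu.-integrable setT (EFin \o hS).
Proof. by apply: integrable_cstM => //; exact: integrable_lower_field. Qed.
Let iA : mu.-integrable setT (EFin \o hA). Proof. exact (integrable_rdot mA bA tP). Qed.
Let iSub (D : set E) h : measurable D -> mu.-integrable setT (EFin \o h) ->
  mu.-integrable D (EFin \o h).
Proof. by move=> mD; apply: integrableS. Qed.

Let hD0 : mu.-integrable Omega (EFin \o hD) /\ \int[mu]_(x in Omega) hD x = 0.
Proof.
have := @defect_rdot0 R d N m Omega x0 rho Lam A F G m0 rho0 oO OB mA bA L2G L2F eqn _ _
  sR sI cR cI vR vI.
rewrite /hD /rdot => H; set D1 := (fun x => _) in H.
rewrite (_ : (fun x => _) = D1)//; apply/funext => x; rewrite /D1.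
apply: eq_bigr => j _; apply: eq_bigr => a _.
by rewrite /P2 /aval Re_grad_cscale Im_grad_cscale.
Qed.

(** The pairing with the defect integrates to [0] over [Omega]. *)
Lemma pairing_estimate (eps : R) : 0 < eps -> \int[mu]_x hA x <=
  eps * \int[mu]_x hX x + absorb_const eps Lam * (\int[mu]_x hS x + \int[mu]_(x in Omega) hY x).
Proof.
move=> eps0; have [iD D0] := hD0; have iY := integrable_error.
set K1 := absorb_const eps Lam.
have mO' : measurable (~` Omega) by exact: measurableC.
have split_int h : mu.-integrable setT (EFin \o h) ->
    \int[mu]_x h x = \int[mu]_(x in Omega) h x + \int[mu]_(x in ~` Omega) h x.
  move=> ih; rewrite -Rintegral_setU ?setUv//.
  by apply/disj_setPS => x [].
have on_ : \int[mu]_(x in Omega) hA x <= eps * \int[mu]_(x in Omega) hX x +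
    K1 * (\int[mu]_(x in Omega) hS x + \int[mu]_(x in Omega) hY x).
  apply: (@le_trans _ _ (\int[mu]_(x in Omega) (hD x + (eps * hX x + K1 * (hS x + hY x))))).
    apply: Rintegral_ae_le => //; first exact: iSub.
      apply: integrable_add => //; apply: integrable_add => //.
        by apply: integrable_cstM => //; exact: iSub.
      by apply: integrable_cstM => //; apply: integrable_add => //; exact: iSub.
    by apply: filterS bA => x Bx _; rewrite addrA; exact: pairing_on.
  rewrite RintegralD//; last first.
    apply: integrable_add => //; first by apply: integrable_cstM => //; exact: iSub.
    by apply: integrable_cstM => //; apply: integrable_add => //; exact: iSub.
  rewrite D0 add0r RintegralD//.
  - rewrite RintegralZl//; last exact: iSub.
    rewrite RintegralZl//; last by apply: integrable_add => //; exact: iSub.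
    by rewrite RintegralD//; exact: iSub.
  - by apply: integrable_cstM => //; exact: iSub.
  - by apply: integrable_cstM => //; apply: integrable_add => //; exact: iSub.
have off : \int[mu]_(x in ~` Omega) hA x <= eps * \int[mu]_(x in ~` Omega) hX x +
    K1 * \int[mu]_(x in ~` Omega) hS x.
  apply: (@le_trans _ _ (\int[mu]_(x in ~` Omega) (eps * hX x + K1 * hS x))).
    apply: Rintegral_ae_le => //; first exact: iSub.
      by apply: integrable_add => //; apply: integrable_cstM => //; exact: iSub.
    by apply: filterS2 P2_off bA => x Px Bx xO; apply: pairing_off => //; exact: Px.
  rewrite RintegralD//; [|by apply: integrable_cstM => //; exact: iSub..].
  do 2 (rewrite RintegralZl; [|by []|exact: iSub]); by [].

rewrite (split_int hA)// (split_int hX)// (split_int hS)//.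
apply: le_trans (lerD on_ off) _.
by rewrite le_eqVlt; apply/orP; left; apply/eqP; ring.
Qed.

(** The choice [eps = lam / 4] absorbs half of the left hand side. *)
Lemma absorbed_estimate : \int[mu]_x hX x <=
  4 / lam * (delta * \int[mu]_x (ps x ^+ 2 * vsqn (f ^~ x))) +
  (4 / lam * absorb_const (lam / 4) Lam + 8) *
     (\int[mu]_x hS x + \int[mu]_(x in Omega) hY x).
Proof.
have l4 : 0 < lam / 4 by rewrite divr_gt0.
have := garding_test mA bA tP gA; rewrite -/(hA _).
have -> : \int[mu]_x vsqn (cscale f ps ^~ x) = \int[mu]_x (ps x ^+ 2 * vsqn (f ^~ x)).
  apply: eq_Rintegral => x _; rewrite /vsqn mulr_sumr; apply: eq_bigr => j _.
  by rewrite /sqn /cscale /=; ring.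
have := pairing_estimate l4.
have : \int[mu]_x hX x <= 2 * \int[mu]_x asqn (P x) + 4 * \int[mu]_x hS x.
  have iP := integrable_asqn_test tP m.
  rewrite -!RintegralZl// -RintegralD//; [|exact: integrable_cstM..].
  apply: le_Rintegral => //; last by move=> x _; exact: weighted_asqn_le.
  by apply: integrable_add => //; exact: integrable_cstM.
have Y0 : 0 <= \int[mu]_(x in Omega) hY x.
  by apply: Rintegral_ge0 => x _; rewrite addr_ge0 ?asqn_ge0.
move: Y0; move: (\int[mu]_x hX x) (\int[mu]_x asqn (P x)) (\int[mu]_x hS x)
  (\int[mu]_(x in Omega) hY x) (\int[mu]_x hA x) (delta * _) (absorb_const _ _).
move=> vX vP vS vY vA vV K1 Y0 h1 h2 h3.
have h4 : lam * vP <= vV + (lam / 4 * vX + K1 * (vS + vY)) by lra.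
have h5 : vP <= lam^-1 * (vV + (lam / 4 * vX + K1 * (vS + vY))).
  by rewrite mulrC ler_pdivlMr// mulrC.
have h6 : lam^-1 * (vV + (lam / 4 * vX + K1 * (vS + vY))) =
   lam^-1 * vV + vX / 4 + lam^-1 * K1 * (vS + vY) by field; rewrite gt_eqF.
rewrite h6 in h5.
rewrite [leRHS](_ : _ = 4 * (lam^-1 * vV) + 4 * (lam^-1 * K1 * (vS + vY)) + 8 * (vS + vY)); last by ring.
move: h5; move: (lam^-1 * vV) (lam^-1 * K1 * (vS + vY)) => q1 q2.
lra.
Qed.

End absorption.

(** * The Caccioppoli inequality for smooth fields *)

Section smooth_fields.
Context {R : realType} {d : nat}.
Local Notation C := (R[i]).
Local Notation E := 'rV[R]_d.
Local Notation mu := (leb R d).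
Local Notation Ds := (Dseq (@dirs R d)).

(** The array [G] solves the equation but need not be the gradient of [f]; the
    difference enters the estimates through [data_error]. *)
Record approximate_problem N m (lam Lam delta : R) (x0 : E) (rho : R) (Omega : set E)
    (A : coeffs d N (E -> C) m) (F G : array d N (E -> C) m) (f : 'I_N -> E -> C) : Prop :=
  ApproximateProblem {
    ap_open : open Omega;
    ap_sub : Omega `<=` eball x0 rho;
    ap_meas : measurable_coeffs A;
    ap_bound : {ae mu, forall x, bounded_by (coeff_at A x) Lam};
    ap_garding : weak_garding A lam delta;
    ap_G : array_L2 Omega G;
    ap_F : array_L2 Omega F;
    ap_eq : forall phi, test_fun Omega phi ->
      pairing Omega (grad m phi) (Amul A G) = pairing Omega (grad m phi) F;
    ap_smooth : forall j, csmooth (f j);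
    ap_vanishes : forall j, vanishes m (eball x0 rho) Omega (f j) }.

Definition data_error {N m} (Omega : set E) (F G : array d N (E -> C) m) f : R :=
  \int[mu]_(x in Omega) (asqn (asub (aval G x) (aval (grad m f) x)) + asqn (aval F x)).

Lemma data_error_ge0 {N m} Omega (F G : array d N (E -> C) m) f : 0 <= data_error Omega F G f.
Proof. by apply: Rintegral_ge0 => x _; rewrite addr_ge0 ?asqn_ge0. Qed.

Lemma cc_cutoff (g : E -> R) x0 (r rho : R) : 0 < r -> r < rho -> sm dirs g ->
  (forall x, theta x0 r rho x = 0 -> g x = 0) -> cc g.
Proof.
move=> r0 rrho sg g0; apply: (@cc_supp _ _ _ (theta_supp x0 r rho)); [exact: sm_cont|exact: theta_supp_compact|].
by move=> x /(theta_out r0 rrho)/g0.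
Qed.

(** Absorption of the lower order terms: interpolation with a small constant
    [eta] leaves half of the energy and the term of order [0], whose weight
    [zeta^2] is supported in the annulus. *)
Lemma cutoff_energy_estimate (m : nat) (lam Lam : R) : (0 < m)%N -> 0 < lam -> 0 < Lam ->
  exists2 K : R, 0 < K & forall N (delta : R) x0 rho Omega A F G (f : 'I_N -> E -> C) r,
  approximate_problem (m := m) lam Lam delta x0 rho Omega A F G f -> 0 < delta -> 0 < r -> r < rho ->
  let th := theta x0 r rho in
  \int[mu]_x (psi m th x ^+ 2 * asqn (aval (grad m f) x)) <=
  K * ((rho - r)^-1 ^+ (2 * m) * \int[mu]_x (zeta th x ^+ 2 * vsqn (f ^~ x)) +
       delta * \int[mu]_x (psi m th x ^+ 2 * vsqn (f ^~ x)) + data_error Omega F G f).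
Proof.
move=> m0 lam0 Lam0; have [K K0 HK] := @cutoff_estimates R d m m0.
pose c1 := 4 / lam; pose c2 := 4 / lam * absorb_const (lam / 4) Lam + 8.
have c10 : 0 < c1 by rewrite divr_gt0.
have c20 : 0 < c2.
  have : 0 <= absorb_const (lam / 4) Lam.
    have i1 : 0 <= (lam / 4 / 2)^-1 by rewrite invr_ge0 !divr_ge0// ltW.
    have i2 : 0 <= (lam / 4 / (2 * Lam ^+ 2))^-1.
      by rewrite invr_ge0 !divr_ge0 ?mulr_ge0 ?sqr_ge0// ltW.
    apply: mulr_ge0; first by apply: addr_ge0 => //; exact: addr_ge0.
    by apply: addr_ge0 => //; apply: mulr_ge0 => //; exact: sqr_ge0.
  by move=> A0; rewrite ltr_wpDl// mulr_ge0// ltW.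
pose n : R := #|{: mindex d m}|%:R; pose q : R := #|{: m.-tuple 'I_d}|%:R.
pose a := c2 * (n * K) * m%:R.
have a0 : 0 <= a by rewrite !mulr_ge0 ?(ltW c20) ?(ltW K0) ?ler0n.
pose eta := (2 * (a * q + 1))^-1.
have aq0 : 0 <= a * q by rewrite mulr_ge0 ?ler0n.
have eta0 : 0 < eta by rewrite invr_gt0 mulr_gt0// ltr_wpDl.
have eta_half : a * q * eta <= 1 / 2.
  by rewrite /eta ler_pdivrMr ?mulr_gt0 ?ltr_wpDl//; lra.
have [c3 c30 Hc3] := @field_interpolation R d m K eta eta0.
pose Kf := 2 * c1 + 2 * (a * c3) + 2 * c2.
have ac := mulr_ge0 a0 c30.
exists Kf; first by move: ac c10 c20; rewrite /Kf; move: (a * c3) (c1) (c2) => t1 t2 t3; clear => *; lra.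
move=> N delta x0 rho Omega A F G f r H delta0 r0 rrho.
cbv zeta; set th := theta x0 r rho.
have [oO OB mA bA gA LG LF eqn sf vf] := H.
have [dth dze rem] := HK x0 r rho r0 rrho.
have th01 x : 0 <= th x <= 1 by rewrite theta_ge0 theta_le1.
have b0 : 0 < (rho - r)^-1 by rewrite invr_gt0 subr_gt0.
have sth : sm dirs th by exact: sm_theta.
have sze : sm dirs (zeta th) by exact: sm_zeta.
have sps : sm dirs (psi m th) by exact: sm_psi.
have cze : cc (zeta th) by apply: (cc_cutoff (x0 := x0) r0 rrho) => // x t0; rewrite zetaE /th t0 mul0r.
have cps : cc (psi m th) by apply: (cc_cutoff (x0 := x0) r0 rrho) => // x t0; apply: psi_eq0; exact: t0.
have := absorbed_estimate m0 r0 rrho oO OB lam0 Lam0 mA bA gA LG LF eqn sf vf K0 rem.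
rewrite -/c1 -/c2 -/th -/n; set T := \int[mu]_x (psi m th x ^+ 2 * asqn _).
set V := \int[mu]_x (psi m th x ^+ 2 * vsqn _).
set S := \int[mu]_x (n * K * _); rewrite -/(data_error Omega F G f).
have Y0 := data_error_ge0 Omega F G f; set Y := data_error _ _ _ _ in Y0 *.
have V0 : 0 <= V.
  apply: Rintegral_ge0 => x _; rewrite mulr_ge0 ?sqr_ge0// -energy0 energy_ge0//.
set b := (rho - r)^-1 in b0 *.
have SE : S = n * K * (b ^+ (2 * m) * \sum_(k < m) field_norm (zeta th) b f k).
  by rewrite /S RintegralZl ?int_lower_field//; exact: integrable_lower_field.
set Z := \int[mu]_x _.
have Z0 : 0 <= Z.
  apply: Rintegral_ge0 => x _; rewrite mulr_ge0 ?sqr_ge0// -energy0 energy_ge0//.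
have fn0 : field_norm (zeta th) b f 0 = Z by rewrite field_norm0.
have top : b ^+ (2 * m) * field_norm (zeta th) b f m <= q * T.
  apply: field_norm_top => // x; first by have /andP[] := zeta01 th01 x.
  have /andP[z0 _] := zeta01 th01 x; have /andP[t0 _] := th01 x.
  by apply: le_trans (psi_ge m th01 x); apply: lerXn2r; rewrite ?nnegrE ?zeta_le.
have sum_le : \sum_(k < m) field_norm (zeta th) b f k <=
    m%:R * (eta * field_norm (zeta th) b f m + c3 * Z).
  rewrite -fn0 mulr_natl -[X in _ *+ X]card_ord -sumr_const.
  by apply: ler_sum => k _; exact: Hc3.
have T0 : 0 <= T by apply: Rintegral_ge0 => x _; rewrite mulr_ge0 ?sqr_ge0 ?asqn_ge0.
have B0 : 0 <= b ^+ (2 * m) by rewrite exprn_ge0// ltW.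
have cS : c2 * S <= 1 / 2 * T + a * c3 * (b ^+ (2 * m) * Z).
  rewrite SE; apply: (@le_trans _ _ (c2 * (n * K * (b ^+ (2 * m) *
     (m%:R * (eta * field_norm (zeta th) b f m + c3 * Z)))))).
    rewrite ler_wpM2l ?(ltW c20)// ler_wpM2l ?mulr_ge0 ?ler0n ?(ltW K0)//.
    by rewrite ler_wpM2l.
  rewrite [leLHS](_ : _ = a * eta * (b ^+ (2 * m) * field_norm (zeta th) b f m) +
    a * c3 * (b ^+ (2 * m) * Z)); last by rewrite /a; ring.
  rewrite lerD2r; apply: (@le_trans _ _ (a * eta * (q * T))).
    by rewrite ler_wpM2l// mulr_ge0// ltW.
  by rewrite [leLHS](_ : _ = a * q * eta * T) ?ler_wpM2r//; ring.
move=> h; have {h} : T <= c1 * (delta * V) + c2 * S + c2 * Y.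
  by apply: le_trans h _; rewrite mulrDr addrA.
have dV0 : 0 <= delta * V by rewrite mulr_ge0// ltW.
have W0 : 0 <= b ^+ (2 * m) * Z by rewrite mulr_ge0.
have ac0 : 0 <= a * c3 by rewrite mulr_ge0.
rewrite /Kf; move: cS T0 dV0 W0 Y0 ac0 (ltW c10) (ltW c20).
move: (c2 * S) (T) (delta * V) (b ^+ (2 * m) * Z) (Y) (a * c3) (c1) (c2).
clear => cS T V' W Y ac e1 e2 h1 T0 V0' W0 Y0 ac0 e10 e20 h2.
have p1 := mulr_ge0 e10 W0; have p2 := mulr_ge0 e10 Y0.
have p3 := mulr_ge0 ac0 V0'; have p4 := mulr_ge0 ac0 Y0.
have p5 := mulr_ge0 e20 V0'; have p6 := mulr_ge0 e20 W0.
nra.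
Qed.

Lemma Rintegral_split (D : set E) (h : E -> R) : measurable D -> mu.-integrable setT (EFin \o h) ->
  \int[mu]_x h x = \int[mu]_(x in D) h x + \int[mu]_(x in ~` D) h x.
Proof.
move=> mD ih; rewrite -Rintegral_setU ?setUv//; first exact: measurableC.
by apply/disj_setPS => x [].
Qed.

Lemma Rintegral_cutoff_le (om g : E -> R) (D : set E) : measurable D ->
  mu.-integrable setT (EFin \o (fun x => om x ^+ 2 * g x)) -> mu.-integrable D (EFin \o g) ->
  (forall x, 0 <= g x) -> (forall x, 0 <= om x <= 1) -> (forall x, ~ D x -> om x = 0) ->
  \int[mu]_x (om x ^+ 2 * g x) <= \int[mu]_(x in D) g x.
Proof.
move=> mD i1 i2 g0 om01 omD.
rewrite -(@Rintegral_widen _ _ D setT (fun x => om x ^+ 2 * g x))//; last first.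
  by move=> x _ /omD ->; rewrite expr0n mul0r.
apply: le_Rintegral => //; first exact: integrableS i1.
move=> x _; have /andP[h0 h1] := om01 x.
by rewrite ler_piMl// exprn_ile1.
Qed.

Lemma Rintegral_le_cutoff (om g h : E -> R) n (D : set E) : measurable D ->
  mu.-integrable setT (EFin \o (fun x => om x ^+ n * g x)) -> mu.-integrable D (EFin \o h) ->
  (forall x, 0 <= h x <= g x) -> (forall x, 0 <= om x) -> (forall x, D x -> om x = 1) ->
  \int[mu]_(x in D) h x <= \int[mu]_x (om x ^+ n * g x).
Proof.
move=> mD i1 i2 hg om0 om1.
rewrite (Rintegral_split mD i1) -[leLHS]addr0; apply: lerD.
  apply: le_Rintegral => //; first exact: integrableS i1.
  by move=> x /om1 ->; rewrite expr1n mul1r; have /andP[] := hg x.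
apply: Rintegral_ge0 => x _; rewrite mulr_ge0 ?exprn_ge0//.
by have /andP[h0 h1] := hg x; exact: le_trans h1.
Qed.

Lemma eball_subset (x0 : E) (r s : R) : 0 <= r -> r <= s -> eball x0 r `<=` eball x0 s.
Proof.
move=> r0 rs x xr; apply: lt_le_trans xr _; apply: lerXn2r => //; rewrite nnegrE//.
exact: le_trans rs.
Qed.

(** The top order is [cutoff_energy_estimate] with the supports of the cutoffs made
    explicit; the other orders follow by interpolation with the weight [theta],
    which is [1] on the inner ball. *)
Theorem smooth_caccioppoli (m : nat) (lam Lam : R) : (0 < m)%N -> 0 < lam -> 0 < Lam ->
  exists2 K : R, 0 < K & forall N (delta : R) x0 rho Omega A F G (f : 'I_N -> E -> C) r,
  approximate_problem (m := m) lam Lam delta x0 rho Omega A F G f -> 0 < delta -> 0 < r -> r < rho ->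
  (forall k, (k <= m)%N ->
    \int[mu]_(x in eball x0 r) asqn (aval (grad k f) x) <=
    K * ((rho - r)^-1 ^+ (2 * k) * \int[mu]_(x in eball x0 rho) vsqn (f ^~ x) +
       (rho - r) ^+ (2 * m - 2 * k) *
       (delta * \int[mu]_(x in eball x0 rho) vsqn (f ^~ x) + data_error Omega F G f))) /\
  \int[mu]_(x in eball x0 r) asqn (aval (grad m f) x) <=
    K * ((rho - r)^-1 ^+ (2 * m) * \int[mu]_(x in eball x0 rho `\` eball x0 r) vsqn (f ^~ x) +
       delta * \int[mu]_(x in eball x0 rho) vsqn (f ^~ x) + data_error Omega F G f).
Proof.
move=> m0 lam0 Lam0.
have [K1 K10 HK1] := @cutoff_energy_estimate m lam Lam m0 lam0 Lam0.
have [K2 K20 HK2] := @cutoff_estimates R d m m0.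
have [c c0 Hc] := @field_interpolation R d m K2 1 ltr01.
pose q : R := #|{: m.-tuple 'I_d}|%:R.
have q0 : 0 <= q by rewrite ler0n.
exists (q * K1 + c + K1).
  by rewrite ltr_wpDl// addr_ge0// mulr_ge0// ltW.
move=> N delta x0 rho Omega A F G f r H delta0 r0 rrho.
have := HK1 _ _ _ _ _ _ _ _ _ _ H delta0 r0 rrho; cbv zeta.
have [dth _ _] := HK2 x0 r rho r0 rrho.
have sf := ap_smooth H.
set th := theta x0 r rho in dth *; set s := rho - r in dth *; set B := eball x0 rho.
have s0 : 0 < s by rewrite subr_gt0.
have b0 : 0 < s^-1 by rewrite invr_gt0.
have rho0 : 0 < rho by exact: lt_trans rrho.
have th01 x : 0 <= th x <= 1 by rewrite theta_ge0 theta_le1.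
have sth : sm dirs th by exact: sm_theta.
have sze : sm dirs (zeta th) by exact: sm_zeta.
have sps : sm dirs (psi m th) by exact: sm_psi.
have cth : cc th by exact: (cc_cutoff (x0 := x0) r0 rrho).
have cze : cc (zeta th) by apply: (cc_cutoff (x0 := x0) r0 rrho) => // x t0; rewrite zetaE /th t0 mul0r.
have cps : cc (psi m th) by apply: (cc_cutoff (x0 := x0) r0 rrho) => // x t0; apply: psi_eq0; exact: t0.
have mB : measurable B by apply: open_measurable_rV; exact: open_eball.
have mb : measurable (eball x0 r) by apply: open_measurable_rV; exact: open_eball.
have bB : eball x0 r `<=` B by apply: eball_subset; exact: ltW.
have th1 x : eball x0 r x -> th x = 1 by move=> /ltW xr; exact: theta_eq1.
have thB x : ~ B x -> th x = 0.
  by move=> xB; apply: theta_out => // /(theta_supp_sub r0 rrho).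
have v0 x : 0 <= vsqn (f ^~ x) by rewrite -energy0 energy_ge0.
have iv om : cc om -> mu.-integrable setT (EFin \o (fun x => om x ^+ 2 * vsqn (f ^~ x))).
  by move=> co; under eq_fun do rewrite -energy0; exact: integrable_weighted_energy.
set T := \int[mu]_x (psi m th x ^+ 2 * asqn _).
set V := \int[mu]_x (psi m th x ^+ 2 * vsqn _); set Z := \int[mu]_x (zeta th x ^+ 2 * vsqn _).
set VB := \int[mu]_(x in B) _; set VA := \int[mu]_(x in B `\` _) _.
have Y0 := data_error_ge0 Omega F G f; set Y := data_error _ _ _ _ in Y0 *.
have iVB : mu.-integrable B (EFin \o (fun x => vsqn (f ^~ x))).
  by apply: (integrable_vsqn_on rho0 sf mB); exact: subset_refl.
have VVB : V <= VB.
  apply: Rintegral_cutoff_le => //; first exact: iv.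
  - by move=> x; exact: psi01.
  - by move=> x /thB/psi_eq0.
have ZVB : Z <= VB.
  apply: Rintegral_cutoff_le => //; first exact: iv.
  - by move=> x; exact: zeta01.
  - by move=> x /thB t0; rewrite zetaE t0 mul0r.
have ThVB : field_norm th s^-1 f 0 <= VB.
  by rewrite field_norm0; apply: Rintegral_cutoff_le => //; exact: iv.
have mA : measurable (B `\` eball x0 r) by exact: measurableD.
have ZVA : Z <= VA.
  apply: Rintegral_cutoff_le => //; first exact: iv.
  - by apply: (integrable_vsqn_on rho0 sf mA); exact: subDsetl.
  - by move=> x; exact: zeta01.
  - move=> x /not_andP[/thB t0|/contrapT /th1 t1]; rewrite zetaE ?t0 ?mul0r// t1 subrr mulr0//.
have ia k := integrable_asqn_on k rho0 sf mb bB.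
have lhs_T : \int[mu]_(x in eball x0 r) asqn (aval (grad m f) x) <= T.
  apply: Rintegral_le_cutoff => //; first exact: integrable_weighted_asqn.
  - by move=> x; rewrite asqn_ge0 lexx.
  - by move=> x; have /andP[] := psi01 m th01 x.
  - by move=> x /th1/psi_eq1.
have VB0 : 0 <= VB by exact: Rintegral_ge0.
have VA0 : 0 <= VA by exact: Rintegral_ge0.
have bm0 k : 0 <= s^-1 ^+ k by rewrite exprn_ge0// ltW.
have sk0 k : 0 <= s ^+ k by rewrite exprn_ge0// ltW.
have qc : 0 <= q * K1 + c by rewrite addr_ge0// mulr_ge0// ltW.
have dVB : delta * V <= delta * VB by rewrite ler_wpM2l// ltW.
have dVB0 : 0 <= delta * VB by rewrite mulr_ge0// ltW.
move=> HT; split; last first.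
  apply: (le_trans lhs_T); apply: (le_trans HT).
  apply: (@le_trans _ _ (K1 * (s^-1 ^+ (2 * m) * VA + delta * VB + Y))).
    by rewrite ler_wpM2l ?(ltW K10)// lerD2r lerD// ler_wpM2l.
  rewrite ler_wpM2r//; last by rewrite lerDr.
  by rewrite !addr_ge0// mulr_ge0.
move=> k km.
have T_le : T <= K1 * (s^-1 ^+ (2 * m) * VB + (delta * VB + Y)).
  apply: (le_trans HT); rewrite ler_wpM2l ?(ltW K10)// addrA lerD2r lerD// ler_wpM2l//.
set I := \int[mu]_x (th x ^+ (2 * k.+1) * energy f k x).
have lhs_I : \int[mu]_(x in eball x0 r) asqn (aval (grad k f) x) <= I.
  apply: Rintegral_le_cutoff => //; first exact: integrable_weighted_energy.
  - by move=> x; rewrite asqn_ge0 asqn_grad_le.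
  - by move=> x; have /andP[] := th01 x.
have IE : I = s^-1 ^+ (2 * k) * field_norm th s^-1 f k.
  by rewrite /field_norm invrK mulrA -exprMn mulVf ?gt_eqF// expr1n mul1r.
have fm : field_norm th s^-1 f m <= s ^+ (2 * m) * (q * T).
  have top : s^-1 ^+ (2 * m) * field_norm th s^-1 f m <= q * T.
    apply: field_norm_top => // x; first by have /andP[] := th01 x.
    exact: psi_ge.
  apply: (@le_trans _ _ (s ^+ (2 * m) * (s^-1 ^+ (2 * m) * field_norm th s^-1 f m))).
    by rewrite mulrA -exprMn mulfV ?gt_eqF// expr1n mul1r.
  by rewrite ler_wpM2l.
have fk : field_norm th s^-1 f k <= field_norm th s^-1 f m + c * VB.
  move: km; rewrite leq_eqVlt => /orP[/eqP ->|km]; first by rewrite lerDl mulr_ge0.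
  apply: (le_trans (Hc _ th f _ sth cth sf b0 dth k km)).
  by rewrite mul1r lerD2l ler_wpM2l.
have e1 : s^-1 ^+ (2 * k) * s ^+ (2 * m) = s ^+ (2 * m - 2 * k).
  have -> : (2 * m = 2 * k + (2 * m - 2 * k))%N by rewrite subnKC// leq_mul2l.
  by rewrite addKn exprD mulrA -exprMn mulVf ?gt_eqF// expr1n mul1r.
have e2 : s ^+ (2 * m - 2 * k) * s^-1 ^+ (2 * m) = s^-1 ^+ (2 * k).
  have -> : (2 * m = 2 * k + (2 * m - 2 * k))%N by rewrite subnKC// leq_mul2l.
  by rewrite addKn exprD mulrCA -exprMn mulfV ?gt_eqF// expr1n mulr1.
apply: (le_trans lhs_I); rewrite IE.
apply: (@le_trans _ _ (s^-1 ^+ (2 * k) * (s ^+ (2 * m) *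
   (q * (K1 * (s^-1 ^+ (2 * m) * VB + (delta * VB + Y)))) + c * VB))).
  rewrite ler_wpM2l//; apply: (le_trans fk); rewrite lerD2r; apply: (le_trans fm).
  by rewrite ler_wpM2l// ler_wpM2l.
rewrite [leLHS](_ : _ = q * K1 * ((s^-1 ^+ (2 * k) * s ^+ (2 * m)) * s^-1 ^+ (2 * m) * VB +
  (s^-1 ^+ (2 * k) * s ^+ (2 * m)) * (delta * VB + Y)) + c * (s^-1 ^+ (2 * k) * VB)); last by ring.
rewrite e1 e2.
have W0 : 0 <= s ^+ (2 * m - 2 * k) * (delta * VB + Y) by rewrite mulr_ge0// addr_ge0.
have B0 : 0 <= s^-1 ^+ (2 * k) * VB by rewrite mulr_ge0.
have qK0 : 0 <= q * K1 by rewrite mulr_ge0// ltW.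
move: W0 B0 qK0 c0 (ltW K10).
move: (s ^+ _ * _) (s^-1 ^+ _ * _) (q * K1) (c) (K1) => W B' u1 u2 u3; clear => W0 B0 u10 u20 u30.
have p1 := mulr_ge0 u20 W0; have p2 := mulr_ge0 u30 W0; have p3 := mulr_ge0 u30 B0.
lra.
Qed.

End smooth_fields.

(** * Approximation of the weak gradients *)

Section approximation.
Context {R : realType} {d : nat}.
Local Notation C := (R[i]).
Local Notation Re := (@complex.Re R).
Local Notation Im := (@complex.Im R).
Local Notation E := 'rV[R]_d.
Local Notation mu := (leb R d).
Local Notation Ds := (Dseq (@dirs R d)).

Definition small_on (D : set E) (h : E -> R) (e : R) :=
  mu.-integrable D (EFin \o h) /\ \int[mu]_(x in D) h x <= e.

Lemma small_on_ereal (D : set E) (h : E -> R) e : measurable D -> measurable_fun D h -> (forall x, 0 <= h x) ->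
  (\int[mu]_(x in D) (h x)%:E <= e%:E)%E -> small_on D h e.
Proof.
move=> mD mh h0 he.
have ih : mu.-integrable D (EFin \o h).
  apply/integrableP; split; first exact/measurable_EFinP.
  apply: le_lt_trans (ltry e); apply: le_trans he.
  rewrite le_eqVlt; apply/orP; left; apply/eqP.
  by apply: eq_integral => x _; rewrite /= ger0_norm.
by split => //; rewrite -lee_fin /Rintegral fineK//; exact: (integrable_fin_num mD ih).
Qed.

Lemma small_on_sum J (s : seq J) (D : set E) (h : J -> E -> R) e : measurable D ->
  (forall j, small_on D (h j) e) ->
  small_on D (fun x => \sum_(j <- s) h j x) ((size s)%:R * e).
Proof.
move=> mD H; have ih j := (H j).1; split; first exact: integrable_sumR.
rewrite Rint_sum// mulr_natl -(sum_const_seq s e).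
by apply: ler_sum => j _; have [] := H j.
Qed.

Lemma cpartial_measurable k (a : mindex d k) (f : E -> C) (D : set E) : measurable D ->
  csmooth f -> cmeasurable D (cpartial a f).
Proof.
move=> mD [/smoothP s1 /smoothP s2]; split.
  rewrite (_ : Re \o _ = Ds (seq_mi a) (Re \o f)); last by rewrite -partial_miE.
  exact (@sm_measurable R d _ D (sm_Dseq _ s1)).
rewrite (_ : Im \o _ = Ds (seq_mi a) (Im \o f)); last by rewrite -partial_miE.
exact (@sm_measurable R d _ D (sm_Dseq _ s2)).
Qed.

Lemma seq_mi0 (a : mindex d 0) : seq_mi a = [::].
Proof. by apply/size0nil/size_seq_mi. Qed.

Lemma cpartial0 (a : mindex d 0) (f : E -> C) x : cpartial a f x = f x.
Proof.
by apply: complex_eqP; rewrite /cpartial /= partial_miE seq_mi0.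
Qed.

(** [h] is a representative of the limit [g] on the smaller set. *)
Lemma small_ae (U B : set E) (p g h : E -> C) e : measurable U -> measurable B -> U `<=` B ->
  cmeasurable B p -> cmeasurable B g -> cmeasurable U h ->
  h = g %[ae mu in U] ->
  (\int[mu]_(x in B) (sqn (p x - g x))%:E <= e%:E)%E ->
  small_on U (fun x => sqn (h x - p x)) e.
Proof.
move=> mU mB UB mp mg mh hg le_e.
have mpU := cmeasurableS mB UB mp; have mgU := cmeasurableS mB UB mg.
apply: small_on_ereal => //.
- by apply: measurable_sqn; exact: cmeasurable_sub.
- by move=> x; exact: sqn_ge0.
apply: le_trans le_e.
rewrite (@ae_eq_integral _ _ _ mu U (fun x => (sqn (p x - g x))%:E))//.
- apply: ge0_subset_integral => //.
  + by apply/measurable_EFinP; apply: measurable_sqn; exact: cmeasurable_sub.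
  + by move=> x _; rewrite lee_fin sqn_ge0.
- by apply/measurable_EFinP; apply: measurable_sqn; exact: cmeasurable_sub.
- by apply/measurable_EFinP; apply: measurable_sqn; exact: cmeasurable_sub.
- apply: filterS hg => x Hx Ux; rewrite (Hx Ux); congr EFin.
  by rewrite /sqn !ReD !ImD !ReN !ImN -[_ - Re (p x)]opprB sqrrN -[_ - Im (p x)]opprB sqrrN.
Qed.

Variables (N m : nat) (B Omega : set E) (u : 'I_N -> E -> C).
Hypotheses (oB : open B) (oO : open Omega) (OB : Omega `<=` B)
  (zu : zero_extendable m B Omega u).

Let mB : measurable B. Proof. exact: open_measurable_rV. Qed.
Let mO : measurable Omega. Proof. exact: open_measurable_rV. Qed.

Lemma wderiv_wgrad j k (a : mindex d k) : (k <= m)%N ->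
  is_wderiv Omega a (u j) (wderiv Omega a (u j)).
Proof.
move=> km; have [phi [_ /(_ j k a km)[g wg _]]] := zu.
by have [] := wderiv_ae oO (is_wderiv_restrict oO oB OB wg).
Qed.

(** Order [0] is compared on all of [B] with the zero extension of [u], which is its
    own weak derivative of order [0]; the higher orders are compared on [Omega]
    only. *)
Lemma approximation e : 0 < e -> exists f : 'I_N -> E -> C,
  [/\ forall j, csmooth (f j) /\ vanishes m B Omega (f j),
      forall k, (k <= m)%N -> forall j (a : mindex d k),
        small_on Omega (fun x => sqn (wgrad Omega k u j a x - grad k f j a x)) e &
      forall j, small_on B (fun x => sqn (zero_ext Omega (u j) x - f j x)) e].
Proof.
move=> e0; have [phi [Hphi cvg_phi]] := zu.
have [a0 _] := @Dseq_mi R d 0 [::] erefl.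
have near_small (h : nat -> \bar R) : h n @[n --> \oo] --> 0%E ->
    \forall n \near \oo, (h n <= e%:E)%E.
  move=> ch; apply: (ch [set y | (y <= e%:E)%E]).
  exists e => //= y; rewrite /ball /= sub0r normrN => ye.
  by rewrite lee_fin (le_trans (ler_norm y))// ltW.
have near1 (k : 'I_m.+1) : \forall n \near \oo, forall j (a : mindex d k),
    small_on Omega (fun x => sqn (wgrad Omega k u j a x - grad k (phi n) j a x)) e.
  have km : (k <= m)%N by rewrite -ltnS.
  apply: filter_forall => j; apply: filter_forall => a.
  have [g wg cg] := cvg_phi j k a km.
  have [w1 w2] := wderiv_ae oO (is_wderiv_restrict oO oB OB wg).
  have := near_small _ cg; apply: filterS => n.
  apply: (small_ae mO mB OB) => //.
  - by apply: cpartial_measurable => //; have [] := Hphi n j.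
  - by have [_ [+ _] _] := wg.
  - by have [_ [+ _] _] := w1.
have near0 : \forall n \near \oo, forall j,
    small_on B (fun x => sqn (zero_ext Omega (u j) x - phi n j x)) e.
  apply: filter_forall => j.
  have [g wg cg] := cvg_phi j 0 a0 (leq0n _).
  have lz : loc_integrable B (zero_ext Omega (u j)) by have [] := wg.
  have wz : is_wderiv B a0 (zero_ext Omega (u j)) (zero_ext Omega (u j)).
    split => // p _ _; rewrite expr0 mul1r; congr cint.
    by apply/funext => x; rewrite cpartial0.
  have := near_small _ cg; apply: filterS => n.
  under eq_integral do rewrite cpartial0.
  apply: (small_ae mB mB) => //.
  - have := @cpartial_measurable 0 a0 (phi n j) B mB; rewrite (_ : cpartial a0 _ = phi n j).
      by apply; have [] := Hphi n j.
    by apply/funext => x; rewrite cpartial0.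
  - by have [_ [+ _] _] := wg.
  - by have [] := lz.
  - exact: wderiv_unique oB wz wg.
have near1' : \forall n \near \oo, forall (k : 'I_m.+1) j (a : mindex d k),
    small_on Omega (fun x => sqn (wgrad Omega k u j a x - grad k (phi n) j a x)) e.
  exact: filter_forall.
have [n [h1 h2]] := filter_ex (filterI near1' near0).
exists (phi n); split => // k km.
have := h1 (Ordinal (km : (k < m.+1)%N)); exact.
Qed.

End approximation.

(** * Passage to the limit *)

Section limit.
Context {R : realType} {d : nat}.
Local Notation C := (R[i]).
Local Notation E := 'rV[R]_d.
Local Notation mu := (leb R d).

(** The form in which the errors of the approximation are removed. *)
Lemma le_vanishing_error (x y c : R) : 0 <= c -> (forall e, 0 < e -> x <= y + e * c) -> x <= y.
Proof.
move=> c0 H; apply/ler_addgt0Pr => e e0; have c1 : 0 < c + 1 by rewrite ltr_wpDl.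
apply: (le_trans (H (e / (c + 1)) _)); first by rewrite divr_gt0.
rewrite lerD2l mulrAC ler_pdivrMr// ler_wpM2l ?(ltW e0)// lerDl//.
Qed.

Lemma asqn_le_split N k (Y Z : array d N C k) :
  asqn Y <= 2 * asqn Z + 2 * asqn (asub Y Z).
Proof.
rewrite /asqn !mulr_sumr -big_split /=; apply: ler_sum => j _.
rewrite !mulr_sumr -big_split /=; apply: ler_sum => a _; exact: sqn_le_split.
Qed.

Lemma vsqn_le_split N (y z : 'I_N -> C) :
  vsqn y <= 2 * vsqn z + 2 * vsqn (fun j => y j - z j).
Proof.
rewrite /vsqn !mulr_sumr -big_split /=; apply: ler_sum => j _; exact: sqn_le_split.
Qed.

Lemma vsqn_ge0 N (y : 'I_N -> C) : 0 <= vsqn y.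
Proof. by apply: sumr_ge0 => j _; exact: sqn_ge0. Qed.

Section doubling.
Variables (D : set E) (f g h : E -> R).
Hypotheses (mD : measurable D) (mf : measurable_fun D f) (f0 : forall x, 0 <= f x)
  (ig : mu.-integrable D (EFin \o g)) (ih : mu.-integrable D (EFin \o h))
  (fgh : forall x, f x <= 2 * g x + 2 * h x).

Lemma integrable_doubling : mu.-integrable D (EFin \o f).
Proof.
apply: (@integrable_ae_le _ _ _ mu D mD _ (fun x => 2 * g x + 2 * h x)) => //.
  by apply: integrable_add => //; exact: integrable_cstM.
by apply: aeW => x _; rewrite ger0_norm.
Qed.

Lemma Rintegral_doubling :
  \int[mu]_(x in D) f x <= 2 * \int[mu]_(x in D) g x + 2 * \int[mu]_(x in D) h x.
Proof.
rewrite -!RintegralZl// -RintegralD//; [|exact: integrable_cstM..].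
apply: le_Rintegral => //; first exact: integrable_doubling.
by apply: integrable_add => //; exact: integrable_cstM.
Qed.
End doubling.

Lemma Rintegral_le_set (D D' : set E) (f : E -> R) : measurable D -> measurable D' -> D `<=` D' ->
  mu.-integrable D' (EFin \o f) -> (forall x, 0 <= f x) ->
  \int[mu]_(x in D) f x <= \int[mu]_(x in D') f x.
Proof.
move=> mD mD' DD' i f0.
rewrite [leLHS](@Rintegral_widen _ _ D D' f (fun x => \1_D x * f x))//.
- apply: le_Rintegral => //.
  + apply: (@integrable_ae_le _ _ _ mu D' mD' _ f) => //.
      apply: measurable_funM; first exact (measurable_indic mD).
      by apply/measurable_EFinP; exact: (measurable_int _ i).
    by apply: aeW => x _; rewrite ger0_norm indicE ?mulr_ge0// ler_piMl// lern1 leq_b1.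
  + by move=> x _; rewrite indicE ler_piMl// lern1 leq_b1.
- by move=> x Dx; rewrite indicE mem_set// mul1r.
- by move=> x _ Dx; rewrite indicE memNset// mul0r.
Qed.

Variables (N m : nat) (lam Lam delta K : R) (x0 : E) (rho : R) (Omega : set E)
  (A : coeffs d N (E -> C) m) (u : 'I_N -> E -> C) (F : array d N (E -> C) m).
Hypotheses (rho0 : 0 < rho) (oO : open Omega) (OB : Omega `<=` eball x0 rho) (delta0 : 0 < delta)
  (mA : measurable_coeffs A) (bA : {ae mu, forall x, bounded_by (coeff_at A x) Lam})
  (gA : weak_garding A lam delta) (L2F : array_L2 Omega F)
  (eqn : solves A Omega u F) (zu : zero_extendable m (eball x0 rho) Omega u) (K0 : 0 < K).

Local Notation B := (eball x0 rho).
Let z j := zero_ext Omega (u j).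
Let mO : measurable Omega. Proof. exact: open_measurable_rV. Qed.
Let mBall r : measurable (eball x0 r). Proof. by apply: open_measurable_rV; exact: open_eball. Qed.

Let cmeas_wgrad k (km : (k <= m)%N) j (a : mindex d k) : cmeasurable Omega (wgrad Omega k u j a).
Proof. by have [_ [+ _] _] := wderiv_wgrad (@open_eball R d x0 rho) oO OB zu j a km. Qed.

Let cmeas_zero_ext j : cmeasurable B (z j).
Proof.
have [phi [_ H]] := zu; have [a0 _] := @Dseq_mi R d 0 [::] erefl.
by have [g [[+ _] _ _] _] := H j 0 a0 (leq0n _).
Qed.

Lemma summed_approximation : exists2 c : R, 0 <= c & forall e, 0 < e -> exists f : 'I_N -> E -> C,
  [/\ forall j, csmooth (f j) /\ vanishes m B Omega (f j),
      forall k, (k <= m)%N ->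
        small_on Omega (fun x => asqn (asub (aval (wgrad Omega k u) x) (aval (grad k f) x))) (e * c) &
      small_on B (fun x => vsqn (fun j => z j x - f j x)) (e * c)].
Proof.
pose nn k := (size (index_enum 'I_N) * size (index_enum (mindex d k)))%N.
pose M := (size (index_enum 'I_N) + \sum_(k < m.+1) nn k)%N.
exists M%:R => // e e0.
have [f [sf approx approx0]] := approximation (@open_eball R d x0 rho) oO OB zu e0.
have weaken (D : set E) h (k : nat) : (k <= M)%N -> small_on D h (k%:R * e) -> small_on D h (e * M%:R).
  move=> kM [ih hk]; split => //; apply: (le_trans hk).
  by rewrite mulrC ler_wpM2l ?(ltW e0)// ler_nat.
exists f; split => // [k km|].
  apply: (@weaken _ _ (nn k)).
    rewrite /M (bigD1 (Ordinal (km : (k < m.+1)%N)))//= addnCA; exact: leq_addr.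
  rewrite /asqn /nn natrM -mulrA; apply: small_on_sum => // j.
  by apply: small_on_sum => // a; exact: approx.
apply: (@weaken _ _ (size (index_enum 'I_N))); first exact: leq_addr.
by rewrite /vsqn; apply: small_on_sum.
Qed.

Lemma measurable_asqn_wgrad k : (k <= m)%N ->
  measurable_fun Omega (fun x => asqn (aval (wgrad Omega k u) x)).
Proof.
move=> km; apply: measurable_sum => j; apply: measurable_sum => a.
by apply: measurable_sqn; exact: cmeas_wgrad.
Qed.

Lemma measurable_vsqn_zero_ext : measurable_fun B (fun x => vsqn (z ^~ x)).
Proof. by apply: measurable_sum => j; apply: measurable_sqn; exact: cmeas_zero_ext. Qed.

Lemma integrable_wgrad k : (k <= m)%N ->
  mu.-integrable Omega (EFin \o (fun x => asqn (aval (wgrad Omega k u) x))).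
Proof.
move=> km; have [c c0 H] := summed_approximation; have [f [sf app _]] := H 1 ltr01.
apply: (integrable_doubling mO (measurable_asqn_wgrad km) _ _ (app k km).1).
- by move=> x; exact: asqn_ge0.
- exact: (integrable_asqn_on k rho0 (fun j => (sf j).1) mO OB).
- by move=> x; exact: asqn_le_split.
Qed.

Lemma integrable_zero_ext : mu.-integrable B (EFin \o (fun x => vsqn (z ^~ x))).
Proof.
have [c c0 H] := summed_approximation; have [f [sf _ app]] := H 1 ltr01.
apply: (integrable_doubling (mBall rho) measurable_vsqn_zero_ext _ _ app.1).
- by move=> x; exact: vsqn_ge0.
- apply: (integrable_vsqn_on rho0 (fun j => (sf j).1) (mBall rho)); exact: subset_refl.
- by move=> x; exact: vsqn_le_split.
Qed.

Lemma array_L2_wgrad : array_L2 Omega (wgrad Omega m u).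
Proof.
move=> j a; split; first exact: cmeas_wgrad.
have /integrableP[_] := integrable_wgrad (leqnn m); apply: le_lt_trans.
apply: ge0_le_integral => //.
- by move=> x _; rewrite lee_fin sqn_ge0.
- by apply/measurable_EFinP; apply: measurable_sqn; exact: cmeas_wgrad.
- by apply: measurableT_comp => //; apply/measurable_EFinP; exact: measurable_asqn_wgrad.
- move=> x _; rewrite lee_fin ger0_norm ?asqn_ge0//.
  exact: (le_asqn (aval (wgrad Omega m u) x) j a).
Qed.

Variable r : R.
Hypotheses (r0 : 0 < r) (rrho : r < rho).
Local Notation ball := (eball x0 r).
Local Notation s := (rho - r).
Local Notation G := (wgrad Omega m u).
Hypothesis smooth_bound : forall f, approximate_problem lam Lam delta x0 rho Omega A F G f ->
  (forall k, (k <= m)%N ->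
    \int[mu]_(x in ball) asqn (aval (grad k f) x) <=
    K * (s^-1 ^+ (2 * k) * \int[mu]_(x in B) vsqn (f ^~ x) +
       s ^+ (2 * m - 2 * k) *
       (delta * \int[mu]_(x in B) vsqn (f ^~ x) + data_error Omega F G f))) /\
  \int[mu]_(x in ball) asqn (aval (grad m f) x) <=
    K * (s^-1 ^+ (2 * m) * \int[mu]_(x in B `\` ball) vsqn (f ^~ x) +
       delta * \int[mu]_(x in B) vsqn (f ^~ x) + data_error Omega F G f).

Let U := \int[mu]_(x in B) vsqn (z ^~ x).
Let V := \int[mu]_(x in B `\` ball) vsqn (z ^~ x).
Let Fo := \int[mu]_(x in Omega) asqn (aval F x).

(** Each passage between [u] and its approximation costs a factor [2], whence the
    constant [4 * K]. *)
Lemma limit_bounds :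
  (forall k, (k <= m)%N -> \int[mu]_(x in ball `&` Omega) asqn (aval (wgrad Omega k u) x) <=
    4 * K * (s^-1 ^+ (2 * k) * U + s ^+ (2 * m - 2 * k) * (delta * U + Fo))) /\
  \int[mu]_(x in ball `&` Omega) asqn (aval G x) <=
    4 * K * (s^-1 ^+ (2 * m) * V + delta * U + Fo).
Proof.
have [c c0 app] := summed_approximation.
have s0 : 0 < s by rewrite subr_gt0.
have bB : ball `<=` B by apply: eball_subset; exact: ltW.
have mbO : measurable (ball `&` Omega) by exact: measurableI.
have mBb : measurable (B `\` ball) by exact: measurableD.
have Fo0 : 0 <= Fo by apply: Rintegral_ge0 => x _; exact: asqn_ge0.
have iF := integrable_asqn mO L2F.
have key e : 0 < e -> exists f : 'I_N -> E -> C, [/\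
    approximate_problem lam Lam delta x0 rho Omega A F G f,
    forall k, (k <= m)%N -> \int[mu]_(x in ball `&` Omega) asqn (aval (wgrad Omega k u) x) <=
      2 * \int[mu]_(x in ball) asqn (aval (grad k f) x) + 2 * (e * c),
    \int[mu]_(x in B) vsqn (f ^~ x) <= 2 * U + 2 * (e * c),
    \int[mu]_(x in B `\` ball) vsqn (f ^~ x) <= 2 * V + 2 * (e * c) &
    data_error Omega F G f <= e * c + Fo].
  move=> e0; have [f [sf small small0]] := app e e0.
  have sf1 j := (sf j).1; have sf2 j := (sf j).2.
  have iz := integrable_zero_ext; have mz := measurable_vsqn_zero_ext.
  have iB := integrable_vsqn_on rho0 sf1 (mBall rho) (@subset_refl _ B).
  have mBf : measurable_fun B (fun x => vsqn (f ^~ x)).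
    by apply/measurable_EFinP; exact: (measurable_int _ iB).
  have sym x : vsqn (f ^~ x) <= 2 * vsqn (z ^~ x) + 2 * vsqn (fun j => z j x - f j x).
    have := vsqn_le_split (f ^~ x) (z ^~ x); congr (_ <= _ + 2 * _).
    apply: eq_bigr => j _; rewrite -opprB /sqn ReN ImN !sqrrN//.
  exists f; split.
  - by split => //; exact: array_L2_wgrad.
  - move=> k km; have [i1 le1] := small k km.
    have sub : ball `&` Omega `<=` Omega by apply: subIsetr.
    have iw := integrable_wgrad km.
    have ig := integrable_asqn_on k rho0 sf1 mO OB.
    have igb := integrable_asqn_on k rho0 sf1 (mBall r) bB.
    apply: le_trans (Rintegral_doubling mbO _ (fun x => asqn_ge0 _) _ _ (fun x => asqn_le_split _ _)) _.
    + by apply: measurable_funS (measurable_asqn_wgrad km).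
    + exact: integrableS mO mbO sub ig.
    + exact: integrableS mO mbO sub i1.
    + apply: lerD; rewrite ler_wpM2l//.
        by apply: Rintegral_le_set => // x; exact: asqn_ge0.
      by apply: le_trans le1; apply: Rintegral_le_set => // x; exact: asqn_ge0.
  - have [i1 le1] := small0.
    apply: le_trans (Rintegral_doubling (mBall rho) mBf (fun x => vsqn_ge0 _) iz i1 sym) _.
    by rewrite lerD2l ler_wpM2l.
  - have [i1 le1] := small0; have sub : B `\` ball `<=` B by exact: subDsetl.
    have := Rintegral_doubling mBb (measurable_funS (mBall rho) sub mBf) (fun x => vsqn_ge0 _)
      (integrableS (mBall rho) mBb sub iz) (integrableS (mBall rho) mBb sub i1) sym.
    move=> /le_trans; apply; rewrite lerD2l ler_wpM2l//.
    by apply: le_trans le1; apply: Rintegral_le_set => // x; exact: vsqn_ge0.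
  - have [i1 le1] := small m (leqnn m).
    by rewrite /data_error RintegralD// lerD2r.
have sp k : 0 <= s^-1 ^+ k by rewrite exprn_ge0// invr_ge0 ltW.
have sq k : 0 <= s ^+ k by rewrite exprn_ge0// ltW.
have le_dbl t t' w w' (q : R) : 0 <= q -> t <= t' -> w <= w' -> q * t + w <= q * t' + w'.
  by move=> q0 tt ww; apply: lerD => //; rewrite ler_wpM2l.
split.
  move=> k km; set bk := s^-1 ^+ (2 * k); set sk := s ^+ (2 * m - 2 * k).
  have bk0 : 0 <= bk by exact: sp.
  have sk0 : 0 <= sk by exact: sq.
  pose cst := (2 * K * (2 * bk + sk * (2 * delta + 1)) + 2) * c.
  apply: (@le_vanishing_error _ _ cst).
    by rewrite mulr_ge0// addr_ge0// !mulr_ge0 ?(ltW K0)// addr_ge0 ?mulr_ge0// addr_ge0 ?mulr_ge0// ltW.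
  move=> e e0; have [f [apf /(_ k km) h1 h2 _ h4]] := key e e0.
  have [/(_ k km) h5 _] := smooth_bound apf.
  apply: (le_trans h1).
  apply: (@le_trans _ _ (2 * (K * (bk * (2 * U + 2 * (e * c)) +
     sk * (delta * (2 * U + 2 * (e * c)) + (e * c + Fo)))) + 2 * (e * c))).
    rewrite lerD2r ler_wpM2l//; apply: (le_trans h5).
    rewrite ler_wpM2l ?(ltW K0)//; apply: (le_dbl) => //.
    by rewrite ler_wpM2l//; apply: (le_dbl) => //; exact: ltW.
  have p : 0 <= 2 * K * (sk * Fo) by rewrite !mulr_ge0// ltW.
  rewrite -subr_ge0 [leRHS](_ : _ = 2 * K * (sk * Fo))//.
  by rewrite /cst; ring.
set bm := s^-1 ^+ (2 * m).
have bm0 : 0 <= bm by exact: sp.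
pose cst := (2 * K * (2 * bm + 2 * delta + 1) + 2) * c.
apply: (@le_vanishing_error _ _ cst).
  by rewrite mulr_ge0// addr_ge0// !mulr_ge0 ?(ltW K0)// addr_ge0// addr_ge0 ?mulr_ge0// ltW.
move=> e e0; have [f [apf /(_ m (leqnn m)) h1 h2 h3 h4]] := key e e0.
have [_ h5] := smooth_bound apf.
apply: (le_trans h1).
apply: (@le_trans _ _ (2 * (K * (bm * (2 * V + 2 * (e * c)) +
   delta * (2 * U + 2 * (e * c)) + (e * c + Fo))) + 2 * (e * c))).
  rewrite lerD2r ler_wpM2l//; apply: (le_trans h5).
  rewrite ler_wpM2l ?(ltW K0)// -!addrA; apply: (le_dbl) => //.
  by apply: (le_dbl) => //; exact: ltW.
have p : 0 <= 2 * K * Fo by rewrite !mulr_ge0// ltW.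
rewrite -subr_ge0 [leRHS](_ : _ = 2 * K * Fo)//.
by rewrite /cst; ring.
Qed.

End limit.

Lemma Linfty_norm_bounded (R : realType) (d N m : nat) (A : coeffs d N ('rV[R]_d -> R[i]) m) (Lam : R) :
  0 <= Lam -> (Linfty_norm A <= Lam%:E)%E ->
  {ae leb R d, forall x, bounded_by (coeff_at A x) Lam}.
Proof.
move=> L0 /ess_supP; apply: filterS => x; exact: opnorm_bounded.
Qed.

Lemma integral_EFin_Rintegral d (T : measurableType d) (R : realType)
    (mu : {measure set T -> \bar R}) (D : set T) (h : T -> R) : measurable D ->
  mu.-integrable D (EFin \o h) -> (\int[mu]_(x in D) (h x)%:E)%E = (\int[mu]_(x in D) h x)%:E.
Proof. by move=> mD ih; rewrite /Rintegral fineK//; exact: (integrable_fin_num mD ih). Qed.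

Theorem corollary3p15 (R : realType) (d m : nat) (lam Lam : R)
    (d_gt0 : (0 < d)%N) (m_gt0 : (0 < m)%N)
    (lam_gt0 : 0 < lam) (Lam_gt0 : 0 < Lam) :
  exists2 C : R, 0 < C &
  forall (N : nat) (x0 : 'rV[R]_d) (rho : R) (Omega : set 'rV[R]_d)
    (delta : R) (A : coeffs d N ('rV[R]_d -> R[i]) m)
    (u : 'I_N -> 'rV[R]_d -> R[i]) (F : array d N ('rV[R]_d -> R[i]) m),
  (0 < N)%N ->
  0 < rho ->
  domain Omega -> Omega `<=` eball x0 rho ->
  0 < delta ->
  measurable_coeffs A -> (Linfty_norm A <= Lam%:E)%E ->
  weak_garding A lam delta ->
  in_Wdot m Omega u -> array_L2 Omega F ->
  solves A Omega u F ->
  zero_extendable m (eball x0 rho) Omega u ->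
  forall r : R, 0 < r -> r < rho ->
  (forall j : nat, (j <= m)%N ->
    (L2sq (eball x0 r `&` Omega) (wgrad Omega j u) <=
     (C / (rho - r) ^+ (2 * j))%:E * L2sqv (Omega `&` eball x0 rho) u +
     (C * rho ^+ (2 * m - 2 * j))%:E *
       (L2sq Omega F + delta%:E * L2sqv Omega u))%E) /\
  (L2sq (eball x0 r `&` Omega) (wgrad Omega m u) <=
   (C / (rho - r) ^+ (2 * m))%:E *
     L2sqv (Omega `&` (eball x0 rho `\` eball x0 r)) u +
   C%:E * (L2sq Omega F + delta%:E * L2sqv Omega u))%E.
Proof.
have [K K0 HK] := @smooth_caccioppoli R d m lam Lam m_gt0 lam_gt0 Lam_gt0.
exists (4 * K); first by rewrite mulr_gt0.
move=> N x0 rho Omega delta A u F _ rho0 [oO _ _] OB delta0 mA LA gA _ L2F eqn zu r r0 rrho.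
have bA := Linfty_norm_bounded (ltW Lam_gt0) LA.
have [bound_k bound_m] := limit_bounds rho0 oO OB delta0 mA bA gA L2F eqn zu K0 r0 rrho
  (fun f apf => HK _ _ _ _ _ _ _ _ _ _ apf delta0 r0 rrho).
have mO : measurable Omega by exact: open_measurable_rV.
have mBall s : measurable (eball x0 s) by apply: open_measurable_rV; exact: open_eball.
set z := fun j => zero_ext Omega (u j) in bound_k bound_m.
have iz : (leb R d).-integrable (eball x0 rho) (EFin \o (fun x => vsqn (z ^~ x))).
  exact: (integrable_zero_ext rho0 oO OB zu).
have zE (D : set 'rV[R]_d) : D `<=` Omega -> L2sqv D u = L2sqv D z.
  move=> DO; apply: eq_integral => x /set_mem xD; congr (_ %:E); rewrite /vsqn.
  by apply: eq_bigr => j _; rewrite /z /zero_ext /patch mem_set//; exact: DO.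
have L2sqv_zE (D : set 'rV[R]_d) : measurable D -> D `<=` eball x0 rho ->
    L2sqv (Omega `&` D) u = (\int[leb R d]_(x in D) vsqn (z ^~ x))%:E.
  move=> mD DB; rewrite zE; last exact: subIsetl.
  have mOD : measurable (Omega `&` D) by exact: measurableI.
  rewrite /L2sqv integral_EFin_Rintegral//; last first.
    exact: (integrableS (mBall rho) mOD (subset_trans (@subIsetr _ Omega D) DB) iz).
  congr (_ %:E); apply: (Rintegral_widen (@subIsetr _ Omega D)) => // x xD /not_andP[xO|//]; rewrite /vsqn big1// => j _.
  by rewrite /z /zero_ext /patch memNset// /sqn /= expr0n addr0.
have OBE : Omega = Omega `&` eball x0 rho by rewrite setIidl.
have uE : L2sqv Omega u = (\int[leb R d]_(x in eball x0 rho) vsqn (z ^~ x))%:E.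
  by rewrite {1}OBE; exact: L2sqv_zE.
have FE : L2sq Omega F = (\int[leb R d]_(x in Omega) asqn (aval F x))%:E.
  by rewrite /L2sq integral_EFin_Rintegral//; exact: integrable_asqn.
have wE k : (k <= m)%N -> L2sq (eball x0 r `&` Omega) (wgrad Omega k u) =
    (\int[leb R d]_(x in eball x0 r `&` Omega) asqn (aval (wgrad Omega k u) x))%:E.
  move=> km; have mrO : measurable (eball x0 r `&` Omega) by exact: measurableI.
  rewrite /L2sq integral_EFin_Rintegral//.
  exact: (integrableS mO mrO (@subIsetr _ _ Omega) (integrable_wgrad rho0 oO OB zu km)).
have s0 : 0 < rho - r by rewrite subr_gt0.
set U := \int[leb R d]_(x in eball x0 rho) _ in bound_k bound_m uE.
set Fo := \int[leb R d]_(x in Omega) _ in bound_k bound_m FE.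
have U0 : 0 <= U by apply: Rintegral_ge0 => x _; exact: vsqn_ge0.
have Fo0 : 0 <= Fo by apply: Rintegral_ge0 => x _; exact: asqn_ge0.
have W0 : 0 <= delta * U + Fo by rewrite addr_ge0// mulr_ge0// ltW.
split => [k km|].
  rewrite wE// -OBE uE FE -!EFinM -EFinD lee_fin.
  apply: (le_trans (bound_k k km)).
  rewrite mulrDr -!mulrA exprVn [Fo + _]addrC lerD2l !ler_wpM2l ?(ltW K0)//.
  by rewrite ler_wpM2r// lerXn2r ?nnegrE ?(ltW s0) ?(ltW rho0)// gerBl ltW.
rewrite wE// L2sqv_zE; [|exact: measurableD|exact: subDsetl].
rewrite uE FE -!EFinM -EFinD lee_fin; apply: (le_trans bound_m).
by rewrite exprVn le_eqVlt; apply/orP; left; apply/eqP; ring.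
Qed.
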